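(* Let $n\ge 1$ be an integer, $0<\sigma<2$, $\beta\in\mathbb{R}$, $p>1$ and $b_0>0$. Let $(u_0,u_1)$ be real-valued with $$(u_0,u_1)\in \big(L^1(\mathbb{R}^n)\cap H^1(\mathbb{R}^n)\big)\times\big(L^1(\mathbb{R}^n)\cap L^2(\mathbb{R}^n)\big),\qquad \int_{\mathbb{R}^n}u_1(x)\,dx>0 .$$ Assume that either the following subcritical condition holds: $$\begin{cases}\displaystyle 1<p<\min\left\{\frac{n+1}{(n-1)_+},\ \frac{n}{(n-\sigma)_+}\right\} & \text{if } \sigma\ge 1-\beta,\\[3mm] \displaystyle 1<p<\min\left\{\frac{n(1-\beta)+\sigma}{(n(1-\beta)-\sigma)_+},\ \frac{n}{(n-\sigma)_+}\right\} & \text{if } \sigma\le 1-\beta,\end{cases}$$ or one of the following critical conditions holds: $$\begin{cases}\displaystyle p=\frac{n+1}{n-1}, & \text{with } \sigma\ge 1-\beta,\ \ \sigma>\dfrac{2n}{n+1},\ \ n\ge 2,\\[3mm] \displaystyle p=\frac{n(1-\beta)+\sigma}{n(1-\beta)-\sigma}, & \text{with } n(1+\beta)<\sigma\le 1-\beta,\ \ n\ge 1.\end{cases}$$ Then the Cauchy problem $$\begin{cases} u_{tt}-\Delta u+\dfrac{b_0}{(1+t)^{\beta}}(-\Delta)^{\sigma/2}u_t=|u|^p, & x\in\mathbb{R}^n,\ t>0,\\[2mm] u(0,x)=u_0(x),\quad u_t(0,x)=u_1(x), & x\in\mathbb{R}^n,\end{cases}$$ has no global weak solution.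
   Context: Notation: $(a)_+:=\max\{0,a\}$, and a quotient with positive numerator and denominator $0$ inside the minima is read as $+\infty$. In the second critical condition the denominator $n(1-\beta)-\sigma$ is required to be nonzero (hence positive) for the condition to make sense. Fractional Laplacian: for $s\in(0,1)$ and a Schwartz function $v$ on $\mathbb{R}^n$, $$(-\Delta)^s v(x)=C_{n,s}\,\mathrm{p.v.}\int_{\mathbb{R}^n}\frac{v(x)-v(y)}{|x-y|^{n+2s}}\,dy,\qquad C_{n,s}=\frac{s\,4^s\,\Gamma(\frac n2+s)}{\pi^{n/2}\,\Gamma(1-s)},$$ where p.v. denotes the Cauchy principal value. The operator is extended to less regular functions as usual; on $L^2$-based Sobolev spaces it is the Fourier multiplier with symbol $|\xi|^{2s}$. Function spaces: for $\delta\in(0,2)$, $$H^\delta(\mathbb{R}^n)=\begin{cases}\{u\in L^2(\mathbb{R}^n):(-\Delta)^{\delta/2}u\in L^2(\mathbb{R}^n)\}, & \delta\in(0,1),\\ H^1(\mathbb{R}^n), & \delta=1,\\ \{u\in H^1(\mathbb{R}^n):(-\Delta)^{\delta/2}u\in L^2(\mathbb{R}^n)\}, & \delta\in(1,2),\end{cases}$$ with norm $\|u\|_{L^2}+\|(-\Delta)^{\delta/2}u\|_{L^2}$ if $\delta\in(0,1)$, $\|u\|_{L^2}+\|\nabla u\|_{L^2}$ if $\delta=1$, and $\|u\|_{L^2}+\|\nabla u\|_{L^2}+\|(-\Delta)^{\delta/2}u\|_{L^2}$ if $\delta\in(1,2)$. For $T>0$ let $Q_T:=[0,T]\times\mathbb{R}^n$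 and $$X_{\delta,T}=\{\varphi\in C([0,\infty),H^2(\mathbb{R}^n))\cap C^1([0,\infty),H^\delta(\mathbb{R}^n))\cap C^2([0,\infty),L^2(\mathbb{R}^n)):\ \operatorname{supp}\varphi\subset Q_T\}.$$ Weak solution: let $T>0$ and $u_0,u_1\in L^2(\mathbb{R}^n)$. A (real-valued) function $u\in L^1((0,T),L^2(\mathbb{R}^n))\cap L^p((0,T),L^{2p}(\mathbb{R}^n))$ is a weak solution of the Cauchy problem on $[0,T)\times\mathbb{R}^n$ if $$\begin{aligned}&\int_{Q_T}|u|^p\varphi\,dt\,dx+\int_{\mathbb{R}^n}u_1(x)\varphi(0,x)\,dx+b_0\int_{\mathbb{R}^n}u_0(x)(-\Delta)^{\sigma/2}\varphi(0,x)\,dx-\int_{\mathbb{R}^n}u_0(x)\varphi_t(0,x)\,dx\\ &=\int_{Q_T}u\,\varphi_{tt}\,dt\,dx-\int_0^T\frac{b_0}{(1+t)^{\beta}}\int_{\mathbb{R}^n}u\,(-\Delta)^{\sigma/2}\varphi_t\,dx\,dt-\int_{Q_T}u\,\Delta\varphi\,dt\,dx+\int_0^T\frac{b_0\,\beta}{(1+t)^{\beta+1}}\int_{\mathbb{R}^n}u\,(-\Delta)^{\sigma/2}\varphi\,dx\,dt\end{aligned}$$ holds for all $\varphi\in X_{\sigma,T}$. Global weak solution: a function $u$ on $(0,\infty)\times\mathbb{R}^n$ that is a weak solution on $[0,T)\times\mathbb{R}^n$ for every $T>0$ (i.e. $T>0$ can be chosen arbitrarily). *)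

(* Defs.v *)
From HB Require Import structures.
From mathcomp Require Import all_boot all_order all_algebra.
From mathcomp Require Import all_classical all_reals all_analysis.
Set Implicit Arguments.
Unset Strict Implicit.
Unset Printing Implicit Defensive.
Import Order.TTheory GRing.Theory Num.Theory.
Import numFieldNormedType.Exports.
Local Open Scope classical_set_scope.
Local Open Scope ring_scope.

Definition row_display : measure_display.
Proof. exact: default_measure_display. Qed.

Section measurable_row.
Context {R : realType} (n : nat).

Let coor : 'I_n -> 'rV[R]_n -> R := fun i x => x ord0 i.

Let row_set0 : g_sigma_preimage coor set0.
Proof. exact: sigma_algebra0. Qed.

Let row_setC A : g_sigma_preimage coor A -> g_sigma_preimage coor (~` A).
Proof. exact: sigma_algebraC. Qed.

Let row_bigcup (F : _^nat) : (forall i, g_sigma_preimage coor (F i)) ->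
  g_sigma_preimage coor (\bigcup_i (F i)).
Proof. exact: sigma_algebra_bigcup. Qed.

(* The sigma-algebra generated by the coordinates is the Borel one. *)
HB.instance Definition _ := @isMeasurable.Build row_display
  'rV[R]_n (g_sigma_preimage coor) row_set0 row_setC row_bigcup.

End measurable_row.

Section row_maps.
Context {R : realType} (n : nat).

Lemma measurable_coor (i : 'I_n) :
  measurable_fun [set: 'rV[R]_n] (fun x : 'rV[R]_n => x ord0 i).
Proof.
move=> _ Y mY; rewrite setTI; apply: sub_sigma_algebra => /=.
rewrite -bigcup_seq/=; exists i => /=; first by rewrite mem_index_enum.
by exists Y => //; rewrite setTI.
Qed.

Lemma measurable_rowP d (T : measurableType d) (f : T -> 'rV[R]_n) :
  (forall i, measurable_fun [set: T] (fun t => f t ord0 i)) ->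
  measurable_fun [set: T] f.
Proof.
move=> mf.
pose coor := fun (i : 'I_n) (x : 'rV[R]_n) => x ord0 i.
suff prefS : g_sigma_preimage (fun i => coor i \o f) `<=` measurable.
  by move=> _ A mA; apply: prefS; rewrite g_sigma_preimage_comp; exists A.
apply: smallest_sub; first exact: sigma_algebra_measurable.
elim/big_ind : _ => [|A B hA hB|i _]; first by [].
- by rewrite subUset.
- by move=> A [B mB <-]; exact: mf.
Qed.

End row_maps.

Section row_cons.
Context {R : realType} (n : nat).

Definition row_cons (z : R * 'rV[R]_n) : 'rV[R]_n.+1 :=
  \row_i if unlift ord0 i is Some j then z.2 ord0 j else z.1.

Definition row_uncons (x : 'rV[R]_n.+1) : R * 'rV[R]_n :=
  (x ord0 ord0, \row_j x ord0 (lift ord0 j)).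

Lemma row_consK : cancel row_cons row_uncons.
Proof.
move=> [r v]; rewrite /row_uncons mxE unlift_none/=; congr pair.
by apply/rowP => j; rewrite !mxE liftK.
Qed.

Lemma measurable_row_cons : measurable_fun setT row_cons.
Proof.
apply: measurable_rowP => i.
case: (unliftP ord0 i) => [j|] ->.
- rewrite [X in measurable_fun _ X](_ : _ = (fun x : 'rV[R]_n => x ord0 j) \o snd).
    by apply: measurableT_comp => //; exact: measurable_coor.
  by apply/funext => z /=; rewrite mxE liftK.
- rewrite [X in measurable_fun _ X](_ : _ = fst) //.
  by apply/funext => z /=; rewrite mxE unlift_none.
Qed.

Lemma measurable_row_uncons : measurable_fun setT row_uncons.
Proof.
apply: measurable_fun_pair; first exact: measurable_coor.
apply: measurable_rowP => j.
rewrite [X in measurable_fun _ X](_ : _ = fun x : 'rV[R]_n.+1 => x ord0 (lift ord0 j)).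
  exact: measurable_coor.
by apply/funext => x; rewrite mxE.
Qed.

End row_cons.

Section row_measure_step.
Context {R : realType} (n : nat).
Variable m : {sigma_finite_measure set 'rV[R]_n -> \bar R}.
Local Open Scope ereal_scope.

Definition row_measure_step : set 'rV[R]_n.+1 -> \bar R :=
  pushforward (@lebesgue_measure R \x m) (@row_cons R n).

Let mrow_cons : measurable_fun [set: measurableTypeR R * 'rV[R]_n] (@row_cons R n).
Proof. exact: measurable_row_cons. Qed.

Let row_measure_step0 : row_measure_step set0 = 0.
Proof. by rewrite /row_measure_step /pushforward preimage_set0 measure0. Qed.

Let row_measure_step_ge0 A : 0 <= row_measure_step A.
Proof. exact: measure_ge0. Qed.

Let row_measure_step_sigma_additive : semi_sigma_additive row_measure_step.
Proof.
move=> F mF tF mUF; rewrite /row_measure_step /pushforward preimage_bigcup.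
apply: measure_semi_sigma_additive.
- by move=> k; rewrite -[X in measurable X]setTI; exact: mrow_cons.
- apply/trivIsetP => /= i j _ _ ij; rewrite -preimage_setI.
  by move/trivIsetP : tF => /(_ _ _ _ _ ij) ->//; rewrite preimage_set0.
- by rewrite -preimage_bigcup -[X in measurable X]setTI; exact: mrow_cons.
Qed.

HB.instance Definition _ := isMeasure.Build _ _ _ row_measure_step
  row_measure_step0 row_measure_step_ge0 row_measure_step_sigma_additive.

Let row_measure_step_sigma_finite : sigma_finite setT row_measure_step.
Proof.
have /sigma_finiteP[F [TF ndF Foo]] := sigma_finiteT (@lebesgue_measure R).
have /sigma_finiteP[G [TG ndG Goo]] := sigma_finiteT m.
exists (fun k => @row_uncons R n @^-1` (F k `*` G k)).
  rewrite -preimage_bigcup (_ : \bigcup_k _ = setT) ?preimage_setT//.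
  apply/seteqP; split=> // -[x y] _.
  have [i _ Fix] : (\bigcup_k F k) x by rewrite -TF.
  have [j _ Gjy] : (\bigcup_k G k) y by rewrite -TG.
  exists (maxn i j) => //; split.
  - by move: x Fix; exact/subsetPset/ndF/leq_maxl.
  - by move: y Gjy; exact/subsetPset/ndG/leq_maxr.
move=> k; have [mF Fk] := Foo k; have [mG Gk] := Goo k; split.
  rewrite -[X in measurable X]setTI; apply: measurable_row_uncons => //.
  exact: measurableX.
rewrite /row_measure_step /pushforward -comp_preimage.
rewrite (_ : _ \o _ = id); last by apply/funext => z; exact: row_consK.
by rewrite preimage_id product_measure1E// lte_mul_pinfty// ge0_fin_numE.
Qed.

HB.instance Definition _ := Measure_isSigmaFinite.Build _ _ _
  row_measure_step row_measure_step_sigma_finite.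

End row_measure_step.

(* Lebesgue measure on R^n = 'rV[R]_n *)
Fixpoint lebesgue_row (R : realType) (n : nat) :
    {sigma_finite_measure set 'rV[R]_n -> \bar R} :=
  if n is n'.+1 return {sigma_finite_measure set 'rV[R]_n -> \bar R}
  then row_measure_step (lebesgue_row R n') else dirac (0 : 'rV[R]_0).

Section problem.
Context {R : realType} {n : nat}.
Local Notation Rn := 'rV[R]_n.
Local Notation mu := (lebesgue_row R n).
Implicit Types (u v w psi : Rn -> R) (l : seq 'I_n).

(* `|x| on 'rV[R]_n is the max-norm, hence the need for the Euclidean one. *)
Definition enorm (x : Rn) : R := Num.sqrt (\sum_i x ord0 i ^+ 2).

Definition partial l (f : Rn -> R) : Rn -> R :=
  foldr (fun i g => 'D_(delta_mx ord0 i) g) f l.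

Definition smooth (f : Rn -> R) : Prop := forall l,
  continuous (partial l f) /\
  forall i x, derivable (partial l f) x (delta_mx ord0 i).

Definition test_function (f : Rn -> R) : Prop :=
  smooth f /\ compact (closure [set x | f x != 0]).

Definition schwartz (f : Rn -> R) : Prop := smooth f /\
  forall (k : nat) l, exists C : R,
    forall x, (1 + enorm x) ^+ k * `|partial l f x| <= C.

Definition Gamma (z : R) : R :=
  \int[lebesgue_measure]_(t in `]0, +oo[) (t `^ (z - 1) * expR (- t)).

Definition fraclap_cst (s : R) : R :=
  s * 4 `^ s * Gamma (n%:R / 2 + s) / (pi `^ (n%:R / 2) * Gamma (1 - s)).

(* (-Delta)^s v for v Schwartz and 0 < s < 1 *)
Definition fraclap_schwartz (s : R) v (x : Rn) : R :=
  fraclap_cst s *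
  lim ((\int[mu]_(y in [set y | e < enorm (x - y)])
          ((v x - v y) / enorm (x - y) `^ (n%:R + 2 * s))) @[e --> 0^'+]).

Definition L2 : set (Rn -> R) := [set u | u \in Lfun mu 2%:E].

Definition L2norm (u : Rn -> R) : \bar R := ('N[mu]_2%:E[EFin \o u])%E.

(* w \in L^2 represents the distribution (-Delta)^s u, u \in L^2: the operator
   is extended from Schwartz functions to L^2 by duality (it is symmetric), so
   that its Fourier symbol is still |xi|^(2 s). *)
Definition is_fraclap (s : R) u w : Prop := L2 w /\
  forall psi, schwartz psi ->
    \int[mu]_x (w x * psi x) = \int[mu]_x (u x * fraclap_schwartz s psi x).

(* v \in L^2 represents the distributional derivative of u along l *)
Definition is_partial l u v : Prop := L2 v /\
  forall psi, test_function psi ->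
    \int[mu]_x (v x * psi x) =
    (-1) ^+ size l * \int[mu]_x (u x * partial l psi x).

Definition is_gradient u (g : 'I_n -> Rn -> R) : Prop :=
  forall i, is_partial [:: i] u (g i).

Definition is_laplacian u v : Prop := exists g : 'I_n -> Rn -> R,
  (forall i, is_partial [:: i; i] u (g i)) /\
  v = (fun x => \sum_i g i x).

(* W^{k,2} = H^k, k integer *)
Definition sobolev (k : nat) : set (Rn -> R) :=
  [set u | L2 u /\ forall l, (size l <= k)%N -> exists v, is_partial l u v].

(* H^delta, 0 < delta < 2 *)
Definition Hspace (delta : R) : set (Rn -> R) := [set u |
  if delta < 1 then L2 u /\ exists w, is_fraclap (delta / 2) u w
  else if delta == 1 then sobolev 1 u
  else sobolev 1 u /\ exists w, is_fraclap (delta / 2) u w].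

(* As (-Delta)^s u, D u, ... are unique up to null sets, the infima below are
   taken over at most one value, and are +oo if u is not in the space. *)
Definition norm_fraclap (s : R) u : \bar R :=
  ereal_inf [set L2norm w | w in is_fraclap s u].

Definition norm_partial l u : \bar R :=
  ereal_inf [set L2norm v | v in is_partial l u].

Definition norm_gradient u : \bar R :=
  ereal_inf [set L2norm (fun x => enorm (\row_i g i x)) | g in is_gradient u].

Definition Hnorm (delta : R) u : \bar R := (
  if (delta < 1)%R then L2norm u + norm_fraclap (delta / 2) u
  else if delta == 1%R then L2norm u + norm_gradient u
  else L2norm u + norm_gradient u + norm_fraclap (delta / 2) u)%E.

Definition H2norm u : \bar R :=
  (L2norm u + \sum_i norm_partial [:: i] u
   + \sum_i \sum_j norm_partial [:: i; j] u)%E.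

(* phi \in C([0, oo), S), where N is the norm of S *)
Definition continuous_curve (S : set (Rn -> R)) (N : (Rn -> R) -> \bar R)
    (phi : R -> Rn -> R) : Prop := forall t, 0 <= t -> S (phi t) /\
  N (phi s \- phi t) @[s --> within [set s | 0 <= s] (nbhs t)] --> 0%E.

(* phi' is the derivative of phi on [0, oo), one-sided at 0, for the norm N *)
Definition derivative_curve (N : (Rn -> R) -> \bar R)
    (phi phi' : R -> Rn -> R) : Prop := forall t, 0 <= t ->
  N (fun x => (phi s x - phi t x) / (s - t) - phi' t x)
    @[s --> within [set s | 0 <= s] t^'] --> 0%E.

Definition jointly_measurable (D : set R) (f : R -> Rn -> R) : Prop :=
  measurable_fun (D `*` [set: Rn]) (fun z : R * Rn => f z.1 z.2).

(* phi \in X_{delta,T}, with time derivatives phi_t, phi_tt and Laplacian Dphi.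
   The curves consist of classes of functions modulo null sets; those that are
   integrated over Q_T are given by jointly measurable representatives. *)
Record test_curve (delta T : R) (phi phi_t phi_tt Dphi : R -> Rn -> R)
    : Prop := {
  test_curve_C0H2 : continuous_curve (sobolev 2) H2norm phi ;
  test_curve_deriv : derivative_curve (Hnorm delta) phi phi_t ;
  test_curve_C0 : continuous_curve (Hspace delta) (Hnorm delta) phi ;
  test_curve_C1 : continuous_curve (Hspace delta) (Hnorm delta) phi_t ;
  test_curve_deriv2 : derivative_curve L2norm phi_t phi_tt ;
  test_curve_C2 : continuous_curve L2 L2norm phi_tt ;
  test_curve_supp : forall t, T < t -> \forall x \ae mu, phi t x = 0 ;
  test_curve_laplacian : forall t, 0 <= t -> is_laplacian (phi t) (Dphi t) ;
  test_curve_measurable : jointly_measurable `[0, +oo[ phi ;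
  test_curve_measurable2 : jointly_measurable `[0, +oo[ phi_tt ;
  test_curve_measurableD : jointly_measurable `[0, +oo[ Dphi }.

(* Q_T up to the null set {0, T} x R^n *)
Definition slab (T : R) : set (R * Rn) := `]0, T[ `*` setT.

(* Lphi and Lphi_t stand for (-Delta)^(sigma/2) phi, (-Delta)^(sigma/2) phi_t *)
Definition weak_identity (beta p b0 : R) (u0 u1 : Rn -> R) (T : R)
    (u phi phi_t phi_tt Dphi Lphi Lphi_t : R -> Rn -> R) : Prop :=
  \int[(lebesgue_measure \x mu)%E]_(z in slab T)
     (`|u z.1 z.2| `^ p * phi z.1 z.2)
  + \int[mu]_x (u1 x * phi 0 x)
  + b0 * \int[mu]_x (u0 x * Lphi 0 x)
  - \int[mu]_x (u0 x * phi_t 0 x)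
  =
  \int[(lebesgue_measure \x mu)%E]_(z in slab T) (u z.1 z.2 * phi_tt z.1 z.2)
  - \int[lebesgue_measure]_(t in `]0, T[)
      (b0 / (1 + t) `^ beta * \int[mu]_x (u t x * Lphi_t t x))
  - \int[(lebesgue_measure \x mu)%E]_(z in slab T) (u z.1 z.2 * Dphi z.1 z.2)
  + \int[lebesgue_measure]_(t in `]0, T[)
      (b0 * beta / (1 + t) `^ (beta + 1) * \int[mu]_x (u t x * Lphi t x)).

(* L^q((0,T), L^r(R^n)) for finite q and r *)
Definition Lbochner (T q r : R) : set (R -> Rn -> R) := [set u |
  jointly_measurable `]0, T[ u /\
  (\int[lebesgue_measure]_(t in `]0%R, T[)
     ('N[mu]_r%:E[EFin \o u t] `^ q) < +oo)%E].

Definition weak_solution (sigma beta p b0 : R) (u0 u1 : Rn -> R) (T : R)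
    (u : R -> Rn -> R) : Prop :=
  [/\ Lbochner T 1 2 u, Lbochner T p (2 * p) u &
      forall phi phi_t phi_tt Dphi Lphi Lphi_t : R -> Rn -> R,
        test_curve sigma T phi phi_t phi_tt Dphi ->
        (forall t, 0 <= t -> is_fraclap (sigma / 2) (phi t) (Lphi t)) ->
        (forall t, 0 <= t -> is_fraclap (sigma / 2) (phi_t t) (Lphi_t t)) ->
        weak_identity beta p b0 u0 u1 T u phi phi_t phi_tt Dphi Lphi Lphi_t].

Definition global_weak_solution (sigma beta p b0 : R) (u0 u1 : Rn -> R)
    (u : R -> Rn -> R) : Prop :=
  forall T, 0 < T -> weak_solution sigma beta p b0 u0 u1 T u.

End problem.

Section exponents.
Context {R : realType}.
Local Notation pospart x := (Num.max 0%R x).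

(* a / b, read as +oo when a > 0 = b *)
Definition quot_oo (a b : R) : \bar R := if b == 0 then +oo%E else (a / b)%:E.

Definition subcritical (n : nat) (sigma beta p : R) : Prop :=
  (1 - beta <= sigma /\
   (p%:E < Order.min (quot_oo (n%:R + 1)%R (pospart (n%:R - 1)%R))
                     (quot_oo n%:R%R (pospart (n%:R - sigma)%R)))%E) \/
  (sigma <= 1 - beta /\
   (p%:E < Order.min (quot_oo (n%:R * (1 - beta) + sigma)%R
                              (pospart (n%:R * (1 - beta) - sigma)%R))
                     (quot_oo n%:R%R (pospart (n%:R - sigma)%R)))%E).

Definition critical (n : nat) (sigma beta p : R) : Prop :=
  [/\ p = (n%:R + 1) / (n%:R - 1), 1 - beta <= sigma,
      2 * n%:R / (n%:R + 1) < sigma & (2 <= n)%N] \/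
  [/\ n%:R * (1 - beta) - sigma != 0,
      p = (n%:R * (1 - beta) + sigma) / (n%:R * (1 - beta) - sigma),
      n%:R * (1 + beta) < sigma & sigma <= 1 - beta].

End exponents.

(* Main.v *)
Require Import Defs.
From HB Require Import structures.
From mathcomp Require Import all_boot all_order all_algebra.
From mathcomp Require Import all_classical all_reals all_analysis.
From mathcomp Require Import measurable_realfun ring lra.
Import Order.TTheory GRing.Theory Num.Theory.
Import numFieldNormedType.Exports.

(** Let p' = p / (p - 1), and suppose that [u] is a global weak solution. The proof is
    the test function method, with a test function that is not compactly supported
    in space.

    The weak identity is tested with eta(t / L) b(lam x), where eta is a cut-off in
    time, b(x) = (1 + |x|^2)^(-(n + sigma) / 2), lam = 1 / (K L^gam) and K, L >= 1
    (the lemmas write [s] for sigma). The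
    exponent gam >= 1 is chosen such that 1 - beta <= sigma gam, n gam + 1 <= 2 p' and
    n < sigma p' ([scaling_exponent]); this is exactly what the subcritical and
    critical conditions on p provide. The fractional Laplacian is nonlocal, so that
    it does not preserve compact supports; but b decays at the same rate as the
    kernel, and therefore |(-Delta)^(sigma/2) b| <= C b pointwise ([flap_bracket_le]).
    By scaling, derivatives and fractional derivatives of the test function are
    bounded by powers of lam times the test function itself.

    On the right-hand side of the identity, [u] is multiplied by an expression of
    size eta^(1/p) b (C1 L^-2 on the shell t > L / 2, plus terms carrying K^-sigma;
    [adjoint_le]). Young's inequality absorbs half of the integral I of |u|^p against
    the test function. Only the shell term is treated with a free weight A, and this
    gives ([key_inequality])

      I + int u1 b(lam x) + b0 int u0 (-Delta)^(sigma/2) b(lam x)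
        <= A I_shell + I / 2 + B1 A^(1 - p') K^n + B2 K^(n - sigma p'),

    where B1 and B2 are independent of A, K and L.

    With K = 1 and A = 1/4 the integral I is bounded uniformly in L, whence |u|^p is
    integrable on the half space t > 0 ([integrable_power_density]). Therefore, for
    fixed K and A, the integral over the shell tends to 0 as L tends to infinity. The
    term with u0 vanishes in the limit because of the factor lam^sigma, and there
    remains int u1 <= B1 A^(1 - p') K^n + B2 K^(n - sigma p')
    ([initial_velocity_bound]). Letting first A and then K tend to infinity gives
    int u1 <= 0. The amplification K and the free weight A are what makes this work
    in the critical cases, where no negative power of L is left. *)

Local Open Scope classical_set_scope.
Local Open Scope ring_scope.
Set Implicit Arguments.
Unset Strict Implicit.
Unset Printing Implicit Defensive.

(** * Affine changes of variables for Lebesgue measure on R^n *)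

Section lebesgue_row_theory.
Context {R : realType}.
Implicit Types n : nat.
Local Notation leb := (@lebesgue_measure R).

(** By uniqueness of Lebesgue measure: the right-hand side is a measure in [A] with
    the right value on half-open intervals. *)
Lemma lebesgue_affine_pos (c a : R) : 0 < c -> forall A, measurable A ->
  leb A = (c%:E * leb ((fun t : R => (c * t + a)%R) @^-1` A))%E.
Proof.
move=> c0 A mA.
have mphi : measurable_fun setT ((fun t => c * t + a) : measurableTypeR R -> measurableTypeR R).
  by apply: measurable_funD => //; apply: measurable_funM.
pose cn := NngNum (ltW c0).
pose f : measurableTypeR R -> measurableTypeR R := fun t => c * t + a.
pose mf := isMeasurableFun.Build _ _ _ _ f mphi.
pose phi : {mfun measurableTypeR R >-> measurableTypeR R} := HB.pack f mf.
pose m' := mscale cn (pushforward leb phi).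
have -> : (c%:E * leb ((fun t => (c * t + a)%R) @^-1` A))%E = m' mphi A by [].
apply: lebesgue_measure_unique => // _ [[l r]] /= _ <-.
pose J : set R := `](l - a) / c, (r - a) / c]%classic.
transitivity (c%:E * leb J)%E; last first.
  congr (_ * lebesgue_measure _)%E.
  apply/seteqP; split => t; rewrite /J /preimage/= !in_itv/= ler_pdivlMr // ltr_pdivrMr //;
  by rewrite /f ltrBlDr lerBrDr ![t * c]mulrC.
rewrite /J !lebesgue_measure_itv/= !lte_fin ltr_pM2r ?invr_gt0// ltrD2r.
case: ifPn => _; last by rewrite mule0.
rewrite -EFinB -!EFinD -EFinM; congr EFin; field; lra.
Qed.

Lemma ge0_integral_affine1_pos (c a : R) (f : R -> \bar R) : 0 < c ->
  measurable_fun setT f -> (forall t, 0 <= f t)%E ->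
  (\int[leb]_t f t = c%:E * \int[leb]_t f (c * t + a)%R)%E.
Proof.
move=> c0 mf f0.
have mphi : measurable_fun setT ((fun t => c * t + a) : measurableTypeR R -> measurableTypeR R).
  by apply: measurable_funD => //; apply: measurable_funM.
pose cn := NngNum (ltW c0).
pose g : measurableTypeR R -> measurableTypeR R := fun t => c * t + a.
pose mg := isMeasurableFun.Build _ _ _ _ g mphi.
pose phi : {mfun measurableTypeR R >-> measurableTypeR R} := HB.pack g mg.
pose m := mscale cn (pushforward leb phi).
have -> : (\int[leb]_t f t = \int[m mphi]_t f t)%E.
  by apply: eq_measure_integral => A mA _; exact: lebesgue_affine_pos.
by rewrite ge0_integral_mscale//= ge0_integral_pushforward.
Qed.

Lemma ge0_integral_reflection1 (f : R -> \bar R) :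
  measurable_fun setT f -> (forall t, 0 <= f t)%E ->
  (\int[leb]_t f t = \int[leb]_t f (- t)%R)%E.
Proof.
move=> mf f0.
have mphi : measurable_fun setT (-%R : measurableTypeR R -> measurableTypeR R) by [].
rewrite -[RHS](ge0_integral_pushforward mphi leb measurableT)//.
by apply: eq_measure_integral => A mA _; rewrite -[LHS]lebesgue_measureN.
Qed.

Lemma ge0_integral_affine1 (c a : R) (f : R -> \bar R) : c != 0 ->
  measurable_fun setT f -> (forall t, 0 <= f t)%E ->
  (\int[leb]_t f t = `|c|%:E * \int[leb]_t f (c * t + a)%R)%E.
Proof.
rewrite neq_lt => /orP[c0|c0] mf f0; last first.
  by rewrite gtr0_norm// (@ge0_integral_affine1_pos c a).
rewrite ltr0_norm// (@ge0_integral_affine1_pos (- c) a) ?oppr_gt0//.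
congr (_ * _)%E.
rewrite ge0_integral_reflection1//.
  by apply: eq_integral => t _; rewrite mulrNN.
apply: measurableT_comp => //.
by apply: measurable_funD => //; apply: measurable_funM.
Qed.

Section step.
Variable n : nat.
Local Notation mu := (lebesgue_row R n).

Lemma ge0_integral_row_cons (f : 'rV[R]_n.+1 -> \bar R) :
  measurable_fun setT f -> (forall x, 0 <= f x)%E ->
  (\int[lebesgue_row R n.+1]_x f x = \int[leb]_t \int[mu]_y f (row_cons (t, y)))%E.
Proof.
move=> mf f0.
have mc : measurable_fun setT (@row_cons R n : measurableTypeR R * 'rV[R]_n -> 'rV[R]_n.+1).
  exact: measurable_row_cons.
transitivity (\int[leb \x mu]_z f (row_cons z))%E.
  by rewrite -[RHS](ge0_integral_pushforward mc _ measurableT).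
rewrite fubini_tonelli1//; first exact: measurableT_comp.
Qed.

End step.

Lemma measurable_affine n (c : R) (a : 'rV[R]_n) :
  measurable_fun setT (fun x : 'rV[R]_n => c *: x + a).
Proof.
apply: measurable_rowP => i.
under eq_fun do rewrite !mxE.
by apply: measurable_funD => //; apply: measurable_funM => //; exact: measurable_coor.
Qed.

(** By induction on the dimension: Tonelli splits off one coordinate, and the
    one-dimensional change of variables applies to it. *)
Lemma ge0_integral_affine n (c : R) (a : 'rV[R]_n) (f : 'rV[R]_n -> \bar R) :
  c != 0 -> measurable_fun setT f -> (forall x, 0 <= f x)%E ->
  (\int[lebesgue_row R n]_x f x =
   (`|c| ^+ n)%:E * \int[lebesgue_row R n]_x f (c *: x + a)%R)%E.
Proof.
move=> c0; elim: n a f => [|n IH] a f mf f0.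
  rewrite expr0 mul1e; apply: eq_integral => x _; congr f.
  by apply/rowP => -[].
have maf := measurableT_comp mf (@measurable_affine _ c a).
rewrite ge0_integral_row_cons// ge0_integral_row_cons//.
pose a' : 'rV[R]_n := \row_j a ord0 (lift ord0 j).
have mcons : measurable_fun setT (fun z : measurableTypeR R * 'rV[R]_n => f (row_cons z)).
  by apply: measurableT_comp => //; exact: measurable_row_cons.
have mF : measurable_fun setT (fun t : R => \int[lebesgue_row R n]_y f (row_cons (t, y)))%E.
  exact: (measurable_fun_fubini_tonelli_F (fun z : measurableTypeR R * 'rV[R]_n => f (row_cons z))).
rewrite (@ge0_integral_affine1 c (a ord0 ord0))//; last first.
  by move=> t; exact: integral_ge0.
rewrite exprS EFinM -muleA; congr (_ * _)%E.
have mF' : measurable_fun setT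
   (fun t : R => \int[lebesgue_row R n]_y f (c *: row_cons (t, y) + a)%R)%E.
  apply: (measurable_fun_fubini_tonelli_F (fun z : measurableTypeR R * 'rV[R]_n => f (c *: row_cons z + a))) => //.
  by apply: (measurableT_comp maf); exact: measurable_row_cons.
rewrite -ge0_integralZl//; last first.
  by move=> t _; apply: integral_ge0 => y _; exact: f0.
apply: eq_integral => t _.
rewrite (IH a')//; last first.
  by apply: (measurableT_comp mcons); exact: pair1_measurable.
congr (_ * _)%E; apply: eq_integral => y _; congr f.
apply/rowP => i; rewrite !mxE; case: (unliftP ord0 i) => [j|] -> //=.
by rewrite !mxE.
Qed.

End lebesgue_row_theory.

(** * Integration and measurability on R^n *)

Section integration_helpers.
Context d (T : measurableType d) (R : realType) (m : {measure set T -> \bar R}).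
Implicit Types f g : T -> R.

Lemma integrable_dom f g : measurable_fun setT f ->
  m.-integrable setT (EFin \o g) -> (forall x, `|f x| <= g x) ->
  m.-integrable setT (EFin \o f).
Proof.
move=> mf ig fg; apply: le_integrable ig => //.
  exact/measurable_EFinP.
by move=> x _ /=; rewrite lee_fin (le_trans (fg x))// ler_norm.
Qed.

Lemma integrable_lty_ge0 f : measurable_fun setT f -> (forall x, 0 <= f x) ->
  (\int[m]_x (f x)%:E < +oo)%E -> m.-integrable setT (EFin \o f).
Proof.
move=> mf f0 foo; apply/integrableP; split; first exact/measurable_EFinP.
by under eq_integral do rewrite /= ger0_norm//.
Qed.

Lemma RintegralE f : m.-integrable setT (EFin \o f) ->
  (\int[m]_x (f x)%:E)%E = (\int[m]_x f x)%:E.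
Proof. by move=> fi; rewrite /Rintegral fineK//; exact: integrable_fin_num. Qed.

Lemma ge0_integralZlR (k : R) f : 0 <= k -> measurable_fun setT f ->
  (forall x, 0 <= f x) ->
  (k%:E * \int[m]_x (f x)%:E = \int[m]_x (k * f x)%:E)%E.
Proof.
move=> k0 mf f0; rewrite -ge0_integralZl_EFin//.
- by move=> x _; rewrite lee_fin.
- exact/measurable_EFinP.
Qed.

Lemma Rintegral_cvg_dominated (f_ : nat -> T -> R) f g :
  (forall k, measurable_fun setT (f_ k)) ->
  (forall x, f_ ^~ x @ \oo --> f x) ->
  m.-integrable setT (EFin \o g) -> (forall k x, `|f_ k x| <= g x) ->
  (\int[m]_x f_ k x @[k --> \oo] --> \int[m]_x f x) /\
  m.-integrable setT (EFin \o f).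
Proof.
move=> mf ff ig fg.
have mflim : measurable_fun setT f.
  by apply: (@measurable_fun_cvg _ _ _ _ f_) => // x _; exact: ff.
have [|||||fi _ H] := @dominated_convergence _ T R m setT measurableT
   (fun k => EFin \o f_ k) (EFin \o f) (EFin \o g).
- by move=> k; exact/measurable_EFinP.
- exact/measurable_EFinP.
- by apply: aeW => x _; apply: cvg_EFin => //; [exact: nearW|exact: ff].
- exact: ig.
- by apply: aeW => x k _; rewrite /= lee_fin.
split => //.
have /= := H.
rewrite [X in _ --> X](RintegralE fi) => /fine_cvg; exact.
Qed.

End integration_helpers.

Section euclidean_measure.
Context {R : realType}.

Section affine_integrable.
Context {n : nat}.
Local Notation mu := (lebesgue_row R n).
Local Notation Rn := 'rV[R]_n.

Lemma integrable_affine (c : R) (a : Rn) (f : Rn -> R) : c != 0 ->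
  measurable_fun setT f -> mu.-integrable setT (EFin \o f) ->
  mu.-integrable setT (EFin \o (fun x => f (c *: x + a))).
Proof.
move=> c0 mf /integrableP[_ foo].
have maf := @measurable_affine R n c a.
apply/integrableP; split; first by apply/measurable_EFinP; exact: (measurableT_comp mf maf).
move: foo; rewrite (@ge0_integral_affine _ _ c a)//; last first.
  by apply: measurableT_comp => //; exact/measurable_EFinP.
move=> foo; rewrite ltey; apply/negP => /eqP E; move: foo; rewrite /= in E *.
by rewrite E mulry gtr0_sg ?mul1e ?ltxx// exprn_gt0// normr_gt0.
Qed.

Lemma Rintegral_affine (c : R) (a : Rn) (f : Rn -> R) : c != 0 ->
  measurable_fun setT f -> mu.-integrable setT (EFin \o f) ->
  \int[mu]_x f x = `|c| ^+ n * \int[mu]_x f (c *: x + a).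
Proof.
move=> c0 mf fi.
have fi' := integrable_affine a c0 mf fi.
apply: EFin_inj; rewrite EFinM -RintegralE// -RintegralE//.
have mf' : measurable_fun setT (EFin \o f) by exact/measurable_EFinP.
have -> : (\int[mu]_x (f x)%:E = \int[mu]_x (EFin \o f)^\+ x - \int[mu]_x (EFin \o f)^\- x)%E.
  exact: integralE.
have -> : (\int[mu]_x (f (c *: x + a))%:E =
    \int[mu]_x (EFin \o f)^\+ (c *: x + a)%R - \int[mu]_x (EFin \o f)^\- (c *: x + a)%R)%E.
  rewrite [LHS]integralE; congr (_ - _)%E; apply: eq_integral => x _.
    by rewrite !funeposE.
  by rewrite !funenegE.
rewrite (@ge0_integral_affine _ _ c a)//; last exact: measurable_funepos.
rewrite (@ge0_integral_affine _ _ c a (fun x => ((EFin \o f)^\- x)%E))//; last exact: measurable_funeneg.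
rewrite [RHS]muleBr//; apply: fin_num_adde_defr.
have := integrable_pos_fin_num measurableT fi'.
by under eq_integral do rewrite funeposE/= -(funeposE (EFin \o f)).
Qed.

Lemma integrable_shift (a : Rn) (f : Rn -> R) :
  measurable_fun setT f -> mu.-integrable setT (EFin \o f) ->
  mu.-integrable setT (EFin \o (fun x => f (x + a))).
Proof.
move=> mf fi; have := integrable_affine a (oner_neq0 R) mf fi.
by rewrite (_ : (fun x => f (1 *: x + a)) = (fun x => f (x + a)))//; apply/funext => x; rewrite scale1r.
Qed.

Lemma Rintegral_shift (a : Rn) (f : Rn -> R) :
  measurable_fun setT f -> mu.-integrable setT (EFin \o f) ->
  \int[mu]_x f (x + a) = \int[mu]_x f x.
Proof.
move=> mf fi; rewrite [RHS](Rintegral_affine a (oner_neq0 R))// normr1 expr1n mul1r.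
by apply: eq_Rintegral => x _; rewrite scale1r.
Qed.

Lemma Rintegral_opp (f : Rn -> R) :
  measurable_fun setT f -> mu.-integrable setT (EFin \o f) ->
  \int[mu]_x f (- x) = \int[mu]_x f x.
Proof.
move=> mf fi; rewrite [RHS](@Rintegral_affine (-1) 0)// ?oppr_eq0 ?oner_neq0//.
rewrite normrN normr1 expr1n mul1r.
by apply: eq_Rintegral => x _; rewrite scaleN1r addr0.
Qed.

End affine_integrable.

Lemma measurable_box n (a b : 'I_n -> R) :
  measurable [set x : 'rV[R]_n | forall i, a i <= x ord0 i <= b i].
Proof.
rewrite (_ : [set _ | _] = \bigcap_(i in [set: 'I_n]) ((fun x : 'rV[R]_n => x ord0 i) @^-1` `[a i, b i])).
  apply: fin_bigcap_measurable => // i _; rewrite -[X in measurable X]setTI.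
  exact: measurable_coor.
by apply/seteqP; split => [x h i _/=|x h i]; have := h i; rewrite ?in_itv//=; apply.
Qed.

Lemma lebesgue_box_fin n (M : R) :
  (lebesgue_row R n [set x | forall i, - M <= x ord0 i <= M]%R < +oo)%E.
Proof.
elim: n => [|n IH].
  by rewrite (le_lt_trans (@probability_le1 _ _ R (dirac (0 : 'rV[R]_0)) _ _)) ?ltry//; exact: measurable_box.
rewrite /= /row_measure_step /pushforward.
rewrite (_ : _ @^-1` _ = `[- M, M]%classic `*` [set x : 'rV[R]_n | forall i, - M <= x ord0 i <= M]); last first.
  apply/seteqP; split => [[t y] /= h|[t y] /= [ht hy] i].
    split; first by have := h ord0; rewrite mxE unlift_none /= in_itv.
    by move=> i; have := h (lift ord0 i); rewrite mxE liftK.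
  by rewrite mxE; case: (unliftP ord0 i) => [j|] _ //=; exact: hy.
rewrite product_measure1E//=; last exact: measurable_box.
rewrite lte_mul_pinfty// lebesgue_measure_itv/=.
by case: ifP.
Qed.

(** The sigma-algebra is generated by the coordinates, so an open set is written as
    a countable union of boxes with rational centres. *)
Lemma open_measurable_row n (U : set 'rV[R]_n) : open U -> measurable U.
Proof.
move=> oU.
(* Boxes with rational centre and half-width 1 / (k + 1). *)
pose B (q : 'rV[rat]_n * nat) := [set x : 'rV[R]_n |
   forall i, ratr (q.1 ord0 i) - q.2.+1%:R^-1 <= x ord0 i <= ratr (q.1 ord0 i) + q.2.+1%:R^-1].
rewrite (_ : U = \bigcup_(q : 'rV[rat]_n * nat) (if `[< B q `<=` U >] then B q else set0)).
  apply: countable_bigcupT_measurable => // q.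
  by case: ifP => _ //; exact: measurable_box.
apply/seteqP; split => [x Ux|x [q _]]; last by case: asboolP => // h /h.
move: oU; rewrite openE => /(_ x Ux) /nbhs_ballP[e /= e0 eU].
pose k := Num.truncn (2 / e); pose v : R := k.+1%:R^-1.
have ve : v < e / 2.
  by rewrite /v invf_plt ?posrE ?divr_gt0 ?ltr0n// invf_div Num.Theory.truncnS_gt.
have v0 : 0 < v by rewrite invr_gt0 ltr0n.
have hq i : exists q : rat, ratr q \in `](x ord0 i - v), (x ord0 i + v)[.
  by apply: rat_in_itvoo; lra.
have [qf hqf] := choice hq.
have hB (y : 'rV[R]_n) : (forall i, ratr (qf i) - v <= y ord0 i <= ratr (qf i) + v) -> B (\row_i qf i, k) y.
  by move=> h i; have := h i; rewrite /= mxE.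
have hB' (y : 'rV[R]_n) : B (\row_i qf i, k) y -> (forall i, ratr (qf i) - v <= y ord0 i <= ratr (qf i) + v).
  by move=> h i; have := h i; rewrite /= mxE.
exists (\row_i qf i, k) => //.
case: asboolP => [_|].
  apply: hB => i; have := hqf i; rewrite in_itv/= => /andP[h1 h2].
  by apply/andP; split; lra.
case=> y /hB' hy; apply: eU; split => // i j; rewrite !ord1 /ball /=.
have := hy j; have := hqf j; rewrite in_itv/= => /andP[h1 h2] /andP[h3 h4].
by rewrite ltr_norml; apply/andP; split; lra.
Qed.

Lemma continuous_measurable_row n (f : 'rV[R]_n -> R) :
  continuous f -> measurable_fun setT f.
Proof.
move=> cf; apply: (measurability _ (RGenOInfty.measurableE R)).
move=> _ [_ [a ->] <-]; rewrite setTI; apply: open_measurable_row.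
by move/continuousP : cf; apply; exact: interval_open.
Qed.

End euclidean_measure.

(** * The Euclidean norm, real powers and homogeneous functions *)

Section sqnorm.
Context {R : realType} {n : nat}.
Local Notation Rn := 'rV[R]_n.
Implicit Types x y z : Rn.

(** The square of the Euclidean norm: unlike the norm itself, it is a polynomial in
    the coordinates. *)
Definition sqn x : R := \sum_i x ord0 i ^+ 2.

Lemma sqn_ge0 x : 0 <= sqn x.
Proof. by apply: sumr_ge0 => i _; exact: sqr_ge0. Qed.

Lemma sqn_coord x i : x ord0 i ^+ 2 <= sqn x.
Proof.
rewrite /sqn (bigD1 i)//= lerDl; apply: sumr_ge0 => j _; exact: sqr_ge0.
Qed.

Lemma sqnZ c x : sqn (c *: x) = c ^+ 2 * sqn x.
Proof. by rewrite /sqn mulr_sumr; apply: eq_bigr => i _; rewrite mxE exprMn. Qed.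

Lemma sqnN x : sqn (- x) = sqn x.
Proof. by rewrite -scaleN1r sqnZ sqrrN expr1n mul1r. Qed.

Lemma sqn_eq0 x : (sqn x == 0) = (x == 0).
Proof.
apply/idP/eqP => [/eqP s0|->]; last by rewrite /sqn big1// => i _; rewrite mxE expr0n.
apply/rowP => i; rewrite mxE; apply/eqP; rewrite -sqrf_eq0 eq_le sqr_ge0 andbT.
by rewrite -s0 sqn_coord.
Qed.

Lemma sqn0 : sqn 0 = 0.
Proof. by apply/eqP; rewrite sqn_eq0. Qed.

Lemma sqn_gt0 x : (0 < sqn x) = (x != 0).
Proof. by rewrite lt_def sqn_ge0 andbT sqn_eq0. Qed.

Lemma sqnD_le x y : sqn (x + y) <= 2 * sqn x + 2 * sqn y.
Proof.
rewrite /sqn !mulr_sumr -big_split/=; apply: ler_sum => i _; rewrite mxE.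
set a := x _ _; set b := y _ _; have := sqr_ge0 (a - b); rewrite sqrrB sqrrD; lra.
Qed.

Lemma sqn_le x M : (forall i, `|x ord0 i| <= M) -> sqn x <= n%:R * M ^+ 2.
Proof.
move=> h; rewrite (_ : n%:R * _ = \sum_(i < n) M ^+ 2); last first.
  by rewrite sumr_const card_ord mulr_natl.
apply: ler_sum => i _; rewrite -[leLHS]real_normK ?num_real//.
by apply: lerXn2r; rewrite ?nnegrE// (le_trans _ (h i)).
Qed.

Lemma measurable_sqn : measurable_fun setT sqn.
Proof.
apply: measurable_sum => i; apply: measurable_funX; exact: measurable_coor.
Qed.

Lemma measurable_sqn_in (I : interval R) : measurable (sqn @^-1` [set` I]).
Proof. by rewrite -[X in measurable X]setTI; exact: measurable_sqn. Qed.

Lemma enormE x : enorm x = sqn x `^ 2^-1.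
Proof. by rewrite powR12_sqrt ?sqn_ge0. Qed.

Lemma enorm_powR x r : enorm x `^ r = sqn x `^ (r / 2).
Proof. by rewrite enormE -powRrM mulrC. Qed.

End sqnorm.

Section powR_lemmas.
Context {R : realType}.
Implicit Types x y r : R.

Lemma powRN_le x y r : 0 <= r -> 0 < x -> x <= y -> y `^ (- r) <= x `^ (- r).
Proof.
move=> r0 x0 xy; rewrite !powRN lef_pV2 ?posrE ?powR_gt0// ?(lt_le_trans x0)//.
by apply: ge0_ler_powR => //; rewrite nnegrE ?ltW// (lt_le_trans x0).
Qed.

Lemma one_powR r : 1 `^ r = 1 :> R.
Proof. by rewrite powR1. Qed.

Lemma powR_lt1 x r : 0 <= x -> x < 1 -> 0 < r -> x `^ r < 1.
Proof.
move=> x0 x1 r0; rewrite -(one_powR r).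
by apply: gt0_ltr_powR => //; rewrite nnegrE.
Qed.

Lemma powRN_lt1 x r : 1 < x -> 0 < r -> x `^ (- r) < 1.
Proof.
move=> x1 r0; have x0 : 0 < x by exact: lt_trans x1.
rewrite powRN invf_lt1 ?powR_gt0// -{1}(one_powR r).
by apply: gt0_ltr_powR => //; rewrite nnegrE// ltW.
Qed.

Lemma measurable_powR_comp d (T : measurableType d) (f : T -> R) r :
  measurable_fun setT f -> measurable_fun setT (fun t => f t `^ r).
Proof. by move=> mf; exact: (measurableT_comp (measurable_powR _) mf). Qed.

(** Locates a point in a dyadic annulus; the ratio is 4 because this is applied to a
    squared norm, under dilations by 2. *)
Lemma exp_between (t : R) : 1 <= t -> exists k : nat, 4 ^+ k <= t <= 4 * 4 ^+ k.
Proof.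
move=> t1; have ex : exists k : nat, t <= 4 ^+ k.
  exists (Num.truncn t).+1; apply: (le_trans (ltW (Num.Theory.truncnS_gt t))).
  by rewrite -natrX ler_nat ltnW// ltn_expl.
case: (ex_minnP ex) => -[|k] tk min.
  by exists 0; rewrite expr0 t1 mulr1 (le_trans tk)// expr0 ler1n.
exists k; rewrite -exprS tk andbT leNgt; apply/negP => /ltW /min.
by rewrite ltnn.
Qed.

End powR_lemmas.

Section homogeneous.
Context {R : realType} {n : nat}.
Local Notation Rn := 'rV[R]_n.
Local Notation mu := (lebesgue_row R n).

(** A substitute for polar coordinates. The dilates of [A] by the powers of [c] cover
    the support of [h]; by homogeneity, the integral of [f] over the k-th one is
    [theta ^+ k] times the integral over [A], and the geometric series converges. *)
Lemma homogeneous_integrable (f h : Rn -> R) (A : set Rn) (c theta : R) :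
  measurable_fun setT f -> measurable_fun setT h -> measurable A -> 0 < c ->
  0 <= theta -> theta < 1 ->
  (forall x, 0 <= f x) -> (forall x, 0 <= h x) ->
  (forall x, c ^+ n * f (c *: x) = theta * f x) ->
  (\int[mu]_x (f x * \1_A x)%:E < +oo)%E ->
  (forall x, h x != 0 -> h x <= f x /\ exists k, A (c ^- k *: x)) ->
  mu.-integrable setT (EFin \o h).
Proof.
move=> mf mh mA c0 th0 th1 f0 h0 hom intA cov.
apply: integrable_lty_ge0 => //.
have c0' k : c ^+ k != 0 by rewrite expf_neq0// gt_eqF.
have mind k : measurable_fun setT (fun x : Rn => \1_A (c ^- k *: x) : R).
  have -> : (fun x : Rn => \1_A (c ^- k *: x) : R) = (\1_A : Rn -> R) \o (fun x : Rn => c ^- k *: x + 0).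
    by apply/funext => x /=; rewrite addr0.
  by apply: measurableT_comp; [exact: measurable_indic|exact: measurable_affine].
pose g k x := f x * \1_A (c ^- k *: x).
have mg k : measurable_fun setT (g k) by exact: measurable_funM.
have g0 k x : 0 <= g k x by rewrite mulr_ge0.
(* The homogeneity of [f], iterated. *)
have homk k x : (c ^+ k) ^+ n * f (c ^+ k *: x) = theta ^+ k * f x.
  elim: k x => [|k IH] x; first by rewrite !expr0 expr1n scale1r.
  rewrite exprS exprMn -scalerA mulrAC -mulrA.
  by rewrite [f _ * _]mulrC mulrA [c ^+ n * _]mulrC -mulrA hom mulrCA IH mulrA -exprS.
pose I0 := fine (\int[mu]_x (f x * \1_A x)%:E).
have I0E : (\int[mu]_x (f x * \1_A x)%:E = I0%:E)%E.
  by rewrite fineK// ge0_fin_numE// integral_ge0// => x _; rewrite lee_fin mulr_ge0.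
have I00 : 0 <= I0 by rewrite fine_ge0// integral_ge0// => x _; rewrite lee_fin mulr_ge0.
have intg k : (\int[mu]_x (g k x)%:E = (theta ^+ k * I0)%:E)%E.
  have mgE : measurable_fun setT (EFin \o g k) by exact/measurable_EFinP.
  have g0E x : (0 <= (EFin \o g k) x)%E by rewrite lee_fin.
  rewrite (@ge0_integral_affine _ _ (c ^+ k) 0 (EFin \o g k) (c0' k) mgE g0E).
  rewrite EFinM -I0E (@ge0_integralZlR _ _ _ _ _ (fun x : Rn => g k (c ^+ k *: x + 0))) ?exprn_ge0//; last first.
    exact: (measurableT_comp (mg k) (@measurable_affine _ _ (c ^+ k) 0)).
  rewrite ge0_integralZlR ?exprn_ge0//; last 2 first.
  - by apply: measurable_funM => //; exact: measurable_indic.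
  - by move=> x; rewrite mulr_ge0.
  apply: eq_integral => x _; rewrite addr0; congr EFin.
  rewrite /g scalerA mulVf// scale1r gtr0_norm ?exprn_gt0// mulrA homk.
  by rewrite mulrA.
apply: (@le_lt_trans _ _ (I0 / (1 - theta))%:E); last exact: ltry.
apply: (@le_trans _ _ (\int[mu]_x (\sum_(0 <= k <oo) (g k x)%:E))%E).
  apply: ge0_le_integral => //.
  - by move=> x _; rewrite lee_fin.
  - exact/measurable_EFinP.
  - apply: ge0_emeasurable_sum => //; first by move=> k x _ _; rewrite lee_fin.
    by move=> k _; exact/measurable_EFinP.
  move=> x _; have [->|hx] := eqVneq (h x) 0.
    by apply: nneseries_ge0 => k _ _; rewrite lee_fin.
  have [hf [k Ak]] := cov x hx.
  apply: (le_trans _ (nneseries_lim_ge k.+1 _)) => //.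
    rewrite big_nat_recr//= (@le_trans _ _ (g k x)%:E)//.
      by rewrite lee_fin /g indicE mem_set// mulr1.
    by rewrite leeDr// sume_ge0// => i _; rewrite lee_fin.
  by move=> i _ _; rewrite lee_fin.
rewrite integral_nneseries//; last 2 first.
- by move=> k; exact/measurable_EFinP.
- by move=> k x _; rewrite lee_fin.
under eq_eseriesr do rewrite intg.
apply: lime_le.
  by apply: is_cvg_nneseries => k _ _; rewrite lee_fin mulr_ge0// exprn_ge0.
apply: nearW => N; rewrite sumEFin lee_fin -mulr_suml mulrC ler_wpM2l//.
rewrite -[leRHS]mul1r ler_pdivlMr ?subr_gt0//.
have -> : (\sum_(0 <= i < N) theta ^+ i) * (1 - theta) = 1 - theta ^+ N.
  by rewrite -[RHS]opprB subrX1 -mulNr opprB mulrC big_mkord.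
by rewrite gerBl exprn_ge0.
Qed.

End homogeneous.

(** * The kernel |z|^-(n+s) and the bracket (1+|z|^2)^(-(n+s)/2) *)

Section kernel.
Context {R : realType} {n : nat}.
Local Notation Rn := 'rV[R]_n.
Local Notation mu := (lebesgue_row R n).

Lemma integrable_bounded_box (f : Rn -> R) (C M : R) : 0 <= M ->
  measurable_fun setT f -> (forall x, `|f x| <= C) ->
  (forall x, f x != 0 -> sqn x <= M ^+ 2) -> mu.-integrable setT (EFin \o f).
Proof.
move=> M0 mf fC fM.
pose B : set Rn := [set x | forall i, - M <= x ord0 i <= M].
have mB : measurable B by exact: measurable_box.
have C0 : 0 <= C by exact: le_trans (fC 0).
have mI : measurable_fun setT (\1_B : Rn -> R) by exact: measurable_indic.
apply: (@integrable_dom _ _ _ _ _ (fun x => C * \1_B x)) => //.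
  apply: integrable_lty_ge0 => //.
  - exact: measurable_funM.
  - by move=> x; rewrite mulr_ge0.
  rewrite -ge0_integralZlR// integral_indic// setIT lte_mul_pinfty//.
  exact: lebesgue_box_fin.
move=> x; have [->|fx] := eqVneq (f x) 0; first by rewrite normr0 mulr_ge0.
rewrite indicE mem_set ?mulr1// => i.
rewrite -ler_norml -(@ler_pXn2r _ 2) ?nnegrE// real_normK ?num_real//.
exact: le_trans (sqn_coord x i) (fM x fx).
Qed.

(** The case of an annulus, on which a bounded function has a finite integral. *)
Lemma dyadic_integrable (f h : Rn -> R) (a b C c theta : R) :
  measurable_fun setT f -> measurable_fun setT h -> 0 < c ->
  0 <= theta -> theta < 1 ->
  (forall x, 0 <= f x) -> (forall x, 0 <= h x) ->
  (forall x, c ^+ n * f (c *: x) = theta * f x) ->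
  (forall x, a <= sqn x <= b -> f x <= C) ->
  (forall x, h x != 0 -> h x <= f x /\ exists k, a <= (c ^- k) ^+ 2 * sqn x <= b) ->
  mu.-integrable setT (EFin \o h).
Proof.
move=> mf mh c0 th0 th1 f0 h0 hom fC cov.
pose A := [set x : Rn | a <= sqn x <= b].
have mA : measurable A.
  rewrite (_ : A = sqn @^-1` `[a, b]); first exact: measurable_sqn_in.
  by apply/funext => z; rewrite /A /= in_itv.
apply: (@homogeneous_integrable _ _ f h A c theta) => //; last first.
  by move=> x /cov[hf [k hk]]; split => //; exists k; rewrite /A/= sqnZ.
have mfA : measurable_fun setT (fun x => f x * \1_A x).
  by apply: measurable_funM => //; exact: measurable_indic.
have fA0 x : 0 <= f x * \1_A x by rewrite mulr_ge0.
pose B := Num.max b 0.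
have B0 : 0 <= B by rewrite le_max lexx orbT.
have fi : mu.-integrable setT (EFin \o (fun x => f x * \1_A x)).
  apply: (@integrable_bounded_box _ (Num.max C 0) (Num.sqrt B)) => //.
  - move=> x; rewrite ger0_norm// indicE; case: (boolP (x \in _)); last by rewrite mulr0 le_max lexx orbT.
    by rewrite inE mulr1 => /fC; rewrite le_max => ->.
  - move=> x; rewrite indicE; case: (boolP (x \in _)); rewrite ?mulr0 ?eqxx// inE/= => /andP[_ xb] _.
    by rewrite sqr_sqrtr// le_max xb.
by move/integrableP : fi => [_]; under eq_integral do rewrite /= ger0_norm//.
Qed.

Variable s : R.
Hypotheses (s0 : 0 < s) (s2 : s < 2).

(** Half the order of decay n + s, since the powers below are powers of |z|^2. *)
Definition rexp : R := (n%:R + s) / 2.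
Local Notation r := rexp.
Implicit Types x y z : Rn.
Definition kern (z : Rn) : R := sqn z `^ (- r).
(** It decays exactly like [kern] at infinity, without the singularity. This is why
    its fractional Laplacian, which cannot decay faster than [kern], is bounded by a
    multiple of the function itself. *)
Definition bracket (z : Rn) : R := (1 + sqn z) `^ (- r).
(** Up to a constant, a second difference times [kern] is at most this function: the
    minimum combines the bound by the sup norm and the bound by second derivatives. *)
Definition kmin (z : Rn) : R := Num.min 1 (sqn z) * kern z.

Lemma rexp_gt0 : 0 < r.
Proof. by rewrite /r divr_gt0// ltr_wpDl. Qed.

Lemma kern_ge0 z : 0 <= kern z. Proof. exact: powR_ge0. Qed.

Lemma kernN z : kern (- z) = kern z. Proof. by rewrite /kern sqnN. Qed.

Lemma measurable_kern : measurable_fun setT kern.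
Proof. apply: measurable_powR_comp; exact: measurable_sqn. Qed.

Lemma kern0 : kern 0 = 0.
Proof. by rewrite /kern sqn0 powR0// oppr_eq0 gt_eqF// rexp_gt0. Qed.

Lemma kernZ c z : 0 < c -> c ^+ n * kern (c *: z) = c `^ (- s) * kern z.
Proof.
move=> c0; rewrite /kern sqnZ powRM ?sqr_ge0 ?sqn_ge0// mulrA; congr (_ * _).
rewrite -!powR_mulrn ?ltW// -powRrM -powRD; last by rewrite (gt_eqF c0) implybT.
by congr (_ `^ _); rewrite /r; field.
Qed.

Lemma bracket_gt0 z : 0 < bracket z.
Proof. by rewrite powR_gt0// ltr_wpDr ?sqn_ge0. Qed.

Lemma bracket_ge0 z : 0 <= bracket z. Proof. exact/ltW/bracket_gt0. Qed.

Lemma bracket_le1 z : bracket z <= 1.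
Proof.
rewrite -(one_powR (- r)); apply: powRN_le => //; first exact/ltW/rexp_gt0.
by rewrite lerDl sqn_ge0.
Qed.

Lemma bracketN z : bracket (- z) = bracket z.
Proof. by rewrite /bracket sqnN. Qed.

Lemma measurable_bracket : measurable_fun setT bracket.
Proof.
apply: measurable_powR_comp; apply: measurable_funD => //; exact: measurable_sqn.
Qed.

Lemma bracket_le_kern z : z != 0 -> bracket z <= kern z.
Proof.
move=> z0; apply: powRN_le; first exact/ltW/rexp_gt0.
  by rewrite sqn_gt0.
by rewrite lerDr.
Qed.

Lemma bracket_le (M : R) x y : 0 < M -> 1 + sqn x <= M * (1 + sqn y) ->
  bracket y <= M `^ r * bracket x.
Proof.
move=> M0 h; have x0 : 0 < 1 + sqn x by rewrite ltr_wpDr ?sqn_ge0.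
have y0 : 0 < 1 + sqn y by rewrite ltr_wpDr ?sqn_ge0.
rewrite /bracket !powRN ler_pdivlMr ?powR_gt0// mulrC ler_pdivrMr ?powR_gt0//.
rewrite -powRM ?(ltW M0) ?(ltW y0)//.
apply: ge0_ler_powR => //; first exact/ltW/rexp_gt0.
- by rewrite nnegrE ltW.
- by rewrite nnegrE mulr_ge0// ltW.
Qed.

Lemma bracket_shift (M : R) x y : (forall i, `|y ord0 i| <= M) ->
  bracket (x + y) <= (2 + 2 * n%:R * M ^+ 2) `^ r * bracket x.
Proof.
move=> hM; apply: bracket_le; first by apply: ltr_wpDr => //; apply: mulr_ge0; [rewrite mulr_ge0|exact: sqr_ge0].
have -> : x = (x + y) - y by rewrite addrK.
apply: le_trans (lerD (lexx 1) (sqnD_le _ _)) _; rewrite sqnN addrK.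
have := sqn_le hM; have := sqn_ge0 (x + y); have := sqr_ge0 M; have : 0 <= n%:R :> R by [].
move: (sqn (x + y)) (sqn y) (M ^+ 2) (n%:R : R) => a b m k k0 m0 a0 h.
have : 0 <= k * m * a by rewrite !mulr_ge0.
lra.
Qed.

(** Either |y| or |x - y| is at least |x| / 2, so that one of the two factors is
    comparable to [bracket x]. *)
Lemma bracket_conv x y :
  bracket y * bracket (x - y) <= 4 `^ r * bracket x * (bracket y + bracket (x - y)).
Proof.
have h : 1 + sqn x <= 4 * (1 + sqn y) \/ 1 + sqn x <= 4 * (1 + sqn (x - y)).
  have := sqnD_le (x - y) y; rewrite subrK.
  have := sqn_ge0 y; have := sqn_ge0 (x - y).
  move: (sqn x) (sqn y) (sqn (x - y)) => a b c c0 b0 abc.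
  by have [bc|bc] := leP b c; [right|left]; lra.
have r4 : 0 <= 4 `^ r :> R by exact: powR_ge0.
have [[bx b1] b2] := (bracket_ge0 x, bracket_ge0 y, bracket_ge0 (x - y)).
have p1 : 0 <= 4 `^ r * bracket x * bracket y by rewrite !mulr_ge0.
have p2 : 0 <= 4 `^ r * bracket x * bracket (x - y) by rewrite !mulr_ge0.
case: h => h0; have h := bracket_le (ltr0Sn R 3) h0; rewrite mulrDr.
- have := ler_wpM2r b2 h; lra.
- have := ler_wpM2l b1 h; rewrite [_ * (_ * _)]mulrC; lra.
Qed.

Lemma measurable_unit_ball : measurable [set z : Rn | sqn z <= 1].
Proof.
rewrite (_ : [set _ | _] = sqn @^-1` `]-oo, 1]); first exact: measurable_sqn_in.
by apply/funext => z; rewrite /= in_itv.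
Qed.

(** Converges because s > 0. *)
Lemma integrable_tail :
  mu.-integrable setT (EFin \o (fun z => \1_[set z | 1 <= sqn z] z * kern z)).
Proof.
have mA : measurable [set z : Rn | 1 <= sqn z].
  rewrite (_ : [set _ | _] = sqn @^-1` `[1, +oo[); first exact: measurable_sqn_in.
  by apply/funext => z; rewrite /= in_itv/= andbT.
apply: (@dyadic_integrable kern _ 1 4 1 2 (2 `^ (- s))).
- exact: measurable_kern.
- by apply: measurable_funM; [exact: measurable_indic|exact: measurable_kern].
- by [].
- exact: powR_ge0.
- by apply: powRN_lt1 => //; rewrite ltr1n.
- exact: kern_ge0.
- by move=> x; rewrite mulr_ge0// kern_ge0.
- by move=> x; exact: kernZ.
- move=> x /andP[x1 _]; rewrite -(one_powR (- r)); apply: powRN_le => //; exact/ltW/rexp_gt0.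
- move=> x; rewrite indicE; case: (boolP (x \in _)); rewrite ?mul0r ?eqxx// inE/= => x1 _.
  rewrite mul1r; split => //; have [k /andP[k1 k2]] := exp_between x1.
  exists k; rewrite exprVn -exprM mulnC exprM -natrX.
  by rewrite ler_pdivlMl ?ler_pdivrMl ?exprn_gt0// mulr1 k1 mulrC.
Qed.

(** Converges because s < 2: the order of the singularity is n + s - 2 < n. *)
Lemma integrable_core :
  mu.-integrable setT (EFin \o (fun z => \1_[set z | sqn z <= 1] z * (sqn z * kern z))).
Proof.
have mA := measurable_unit_ball.
have msk : measurable_fun setT (fun z : Rn => sqn z * kern z).
  by apply: measurable_funM; [exact: measurable_sqn|exact: measurable_kern].
have sk0 z : 0 <= sqn z * kern z by rewrite mulr_ge0 ?sqn_ge0 ?kern_ge0.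
apply: (@dyadic_integrable (fun z => sqn z * kern z) _ 4^-1 1 (4 `^ r) 2^-1 (2^-1 `^ (2 - s))).
- by [].
- by apply: measurable_funM => //; exact: measurable_indic.
- by [].
- exact: powR_ge0.
- by apply: powR_lt1; rewrite ?subr_gt0 ?invr_ge0// invf_lt1// ltr1n.
- by [].
- by move=> x; rewrite mulr_ge0.
- move=> x; rewrite mulrCA kernZ// sqnZ powRD ?invr_eq0 ?pnatr_eq0 ?implybT//.
  by rewrite powR_mulrn//; ring.
- move=> x /andP[x4 x1]; rewrite -[leRHS]mul1r ler_pM ?sqn_ge0 ?kern_ge0//.
  have -> : 4 `^ r = 4^-1 `^ (- r) :> R by rewrite -[in RHS]powR_inv1// -powRrM mulrNN mul1r.
  by apply: powRN_le => //; exact/ltW/rexp_gt0.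
- move=> x; rewrite indicE; case: (boolP (x \in _)); rewrite ?mul0r ?eqxx// inE/= => x1 h.
  rewrite mul1r; split => //.
  have sx : 0 < sqn x.
    by rewrite sqn_gt0; apply: contraNN h => /eqP ->; rewrite sqn0 !mul0r mulr0.
  have [k /andP[k1 k2]] : exists k, 4 ^+ k <= (sqn x)^-1 <= 4 * 4 ^+ k.
    by apply: exp_between; rewrite invf_ge1.
  exists k; have -> : (2^-1 ^- k) ^+ 2 = 4 ^+ k :> R.
    by rewrite -exprVn invrK -exprM mulnC exprM -natrX.
  move: k1; rewrite -(ler_pM2r sx) mulVf ?gt_eqF// => ->.
  move: k2; rewrite -(ler_pM2r sx) mulVf ?gt_eqF// -mulrA => k2.
  by rewrite andbT; move: (4 ^+ k * sqn x) k2 => w; lra.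
Qed.

Lemma kmin_ge0 z : 0 <= kmin z.
Proof. by rewrite mulr_ge0 ?kern_ge0// le_min ler01 sqn_ge0. Qed.

Lemma measurable_kmin : measurable_fun setT kmin.
Proof.
apply: measurable_funM; last exact: measurable_kern.
by apply: measurable_minr => //; exact: measurable_sqn.
Qed.

Lemma integrable_kmin : mu.-integrable setT (EFin \o kmin).
Proof.
pose g z := \1_[set z | 1 <= sqn z] z * kern z +
  \1_[set z | sqn z <= 1] z * (sqn z * kern z).
have ig : mu.-integrable setT (EFin \o g).
  exact: (integrableD measurableT integrable_tail integrable_core).
apply: (integrable_dom measurable_kmin ig) => z.
rewrite /g ger0_norm ?kmin_ge0//.
rewrite /kmin !indicE; case: (leP 1 (sqn z)) => z1.
  rewrite [in X in X + _]mem_set// lerDl.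
  by rewrite !mulr_ge0 ?sqn_ge0 ?kern_ge0.
rewrite [in X in _ + X]mem_set ?mul1r; last exact: ltW.
by rewrite lerDr mulr_ge0 ?kern_ge0.
Qed.

Lemma integrable_bracket : mu.-integrable setT (EFin \o bracket).
Proof.
have mB := measurable_unit_ball.
have iB : mu.-integrable setT (EFin \o (\1_[set z : Rn | sqn z <= 1] : Rn -> R)).
  apply: (@integrable_bounded_box _ 1 1) => //.
  - move=> x; rewrite indicE; case: (_ \in _); rewrite ?normr1// normr0//.
  - move=> x; rewrite indicE; case: (boolP (x \in _)); rewrite ?eqxx// inE/= expr1n//.
pose g z := \1_[set z | 1 <= sqn z] z * kern z + \1_[set z | sqn z <= 1] z.
have ig : mu.-integrable setT (EFin \o g).
  exact: (integrableD measurableT integrable_tail iB).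
apply: (integrable_dom measurable_bracket ig) => z.
rewrite /g ger0_norm ?bracket_ge0//.
rewrite !indicE; case: (leP (sqn z) 1) => z1.
  rewrite [in X in _ + X]mem_set// (le_trans (bracket_le1 z))// lerDr.
  by rewrite mulr_ge0 ?kern_ge0.
rewrite [in X in X + _]mem_set ?mul1r; last exact: ltW.
rewrite (le_trans (bracket_le_kern _)) ?lerDl//.
by rewrite -sqn_gt0 (lt_trans _ z1).
Qed.

Lemma integrable_bracket_scale (rho : R) : 0 < rho ->
  mu.-integrable setT (EFin \o (fun z => bracket (rho^-1 *: z))).
Proof.
move=> rho0.
have r0 : rho^-1 != 0 by rewrite invr_eq0 gt_eqF.
have := integrable_affine 0 r0 measurable_bracket integrable_bracket.
by under eq_fun do rewrite addr0.
Qed.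

Lemma Rintegral_bracket_scale (rho : R) : 0 < rho ->
  \int[mu]_z bracket (rho^-1 *: z) = rho ^+ n * \int[mu]_z bracket z.
Proof.
move=> rho0; have r0 : rho^-1 != 0 by rewrite invr_eq0 gt_eqF.
rewrite [in RHS](Rintegral_affine 0 r0 measurable_bracket integrable_bracket).
rewrite gtr0_norm ?invr_gt0// mulrA -exprMn divff ?gt_eqF// expr1n mul1r.
by under [in RHS]eq_Rintegral do rewrite addr0.
Qed.

(** The self-convolution of [bracket] decays like [bracket]. *)
Lemma Rintegral_bracket_conv x :
  \int[mu]_y (bracket y * bracket (x - y)) <=
  2 * 4 `^ r * (\int[mu]_y bracket y) * bracket x.
Proof.
have ms : measurable_fun setT (fun y : Rn => bracket (x - y)).
  have -> : (fun y : Rn => bracket (x - y)) = bracket \o (fun y => -1 *: y + x).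
    by apply/funext => y /=; rewrite scaleN1r addrC.
  by apply: measurableT_comp; [exact: measurable_bracket|exact: measurable_affine].
have is_ : mu.-integrable setT (EFin \o (fun y : Rn => bracket (x - y))).
  have := @integrable_affine _ _ (-1) x _ _ measurable_bracket integrable_bracket.
  rewrite oppr_eq0 oner_neq0 => /(_ isT).
  by under eq_fun do rewrite scaleN1r addrC.
have iS : mu.-integrable setT (EFin \o (fun y : Rn => bracket y + bracket (x - y))).
  exact: (integrableD measurableT integrable_bracket is_).
have iP : mu.-integrable setT (EFin \o (fun y : Rn => bracket y * bracket (x - y))).
  apply: (integrable_dom _ integrable_bracket).
    by apply: measurable_funM => //; exact: measurable_bracket.
  move=> y; rewrite normrM !ger0_norm ?bracket_ge0//.
  by rewrite ler_piMr ?bracket_ge0 ?bracket_le1.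
apply: (@le_trans _ _ (\int[mu]_y (4 `^ r * bracket x * (bracket y + bracket (x - y))))).
  apply: le_Rintegral => //.
    exact: (integrableZl measurableT (4 `^ r * bracket x) iS).
  by move=> y _; exact: bracket_conv.
rewrite RintegralZl// RintegralD//; last exact: integrable_bracket.
have -> : \int[mu]_y bracket (x - y) = \int[mu]_y bracket y.
  rewrite [RHS](@Rintegral_affine _ _ (-1) x) ?oppr_eq0 ?oner_neq0//; last 2 first.
  - exact: measurable_bracket.
  - exact: integrable_bracket.
  rewrite normrN normr1 expr1n mul1r.
  by apply: eq_Rintegral => y _; rewrite scaleN1r addrC.
by rewrite le_eqVlt; apply/orP; left; apply/eqP; ring.
Qed.

End kernel.

(** * Partial derivatives: difference estimates and integration by parts *)

Section directional.
Context {R : realType}.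

Lemma scale_one (h : R) : h *: (1 : R) = h.
Proof. exact: mulr1. Qed.

(** A directional derivative only depends on the restriction to a line; this moves
    derivatives between R^n and the real line. *)
Lemma is_derive_transfer (V1 V2 : normedModType R) (f : V1 -> R) (g : V2 -> R)
    (a v : V1) (b w : V2) (d : R) :
  (forall h : R, f (h *: v + a) = g (h *: w + b)) ->
  is_derive a v f d -> is_derive b w g d.
Proof.
move=> fg [fd fE].
have f0 : f a = g b by have := fg 0; rewrite !scale0r !add0r.
have E : (fun h => h^-1 *: ((g \o shift b) (h *: w) - g b)) =
         (fun h => h^-1 *: ((f \o shift a) (h *: v) - f a)).
  by apply/funext => h /=; rewrite -fg f0.
by split; [rewrite /derivable E|rewrite /derive E].
Qed.

Lemma is_derive_cvg_seq (V : normedModType R) (f : V -> R) (a v : V) (d : R)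
    (h : R^nat) : (forall k, 0 < h k) -> h @ \oo --> 0 ->
  is_derive a v f d -> (f (h k *: v + a) - f a) / h k @[k --> \oo] --> d.
Proof.
move=> h0 hcvg [fd <-].
have C : h^-1 *: ((f \o shift a) (h *: v) - f a) @[h --> 0^'] --> 'D_v f a by exact: fd.
have /cvg_at_rightP/(_ h (conj h0 hcvg)) := cvg_dnbhs_at_right C.
by apply: cvg_trans; apply: near_eq_cvg; apply: nearW => k; rewrite /= mulrC.
Qed.

End directional.

Section partials.
Context {R : realType} {n : nat}.
Local Notation Rn := 'rV[R]_n.
Local Notation mu := (lebesgue_row R n).
Local Notation e := (delta_mx ord0).
Implicit Types (f g : Rn -> R) (x y z w : Rn) (i j : 'I_n) (t M : R).

Definition has_partial i f (df : Rn -> R) : Prop :=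
  forall x, is_derive x (e i : Rn) f (df x).

Lemma has_partial_shift i f df y : has_partial i f df ->
  has_partial i (fun x => f (x + y)) (fun x => df (x + y)).
Proof.
by move=> H x; apply: (is_derive_transfer _ (H (x + y))) => h; rewrite addrA.
Qed.

Lemma has_partialB i f df g dg : has_partial i f df -> has_partial i g dg ->
  has_partial i (fun x => f x - g x) (fun x => df x - dg x).
Proof. by move=> Hf Hg x; exact: is_deriveB. Qed.

Lemma lipschitz_dir i f df y t M : has_partial i f df ->
  (forall s, `|s| <= `|t| -> `|df (y + s *: e i)| <= M) ->
  `|f (y + t *: e i) - f y| <= M * `|t|.
Proof.
move=> H hM.
pose g (s : R) := f (y + s *: e i).
have gd (s : R) : is_derive s (1 : R) g (df (y + s *: e i)).
  apply: (is_derive_transfer _ (H (y + s *: e i))) => h.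
  by rewrite scale_one /g scalerDl addrCA.
have gc (a b : R) : {within `[a, b], continuous g}.
  by apply: derivable_within_continuous => s _; have [] := gd s.
have -> : f y = g 0 by rewrite /g scale0r addr0.
have [t0|t0] := leP 0 t.
  have [c] := MVT_segment t0 (fun s _ => gd s) (gc _ _).
  rewrite in_itv/= => /andP[c0 ct]; rewrite subr0 /g => ->.
  by rewrite normrM ler_wpM2r// hM// !ger0_norm.
have [c] := MVT_segment (ltW t0) (fun s _ => gd s) (gc _ _).
rewrite in_itv/= => /andP[ct c0]; rewrite distrC sub0r /g => ->.
rewrite normrM normrN ler_wpM2r// hM// !ler0_norm ?lerN2// ltW//.
Qed.

(** Moves from [y] to [y + z] one coordinate at a time, so that the mean value theorem
    is only used on lines parallel to the axes and partial derivatives suffice. *)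
Lemma lipschitz_partial f (df : 'I_n -> Rn -> R) y z M :
  (forall i, has_partial i f (df i)) ->
  (forall i w, (forall j, `|w ord0 j - y ord0 j| <= `|z ord0 j|) -> `|df i w| <= M) ->
  `|f (y + z) - f y| <= M * \sum_j `|z ord0 j|.
Proof.
move=> H hM.
(* Agrees with [z] in the first [k] coordinates. *)
pose zk (k : nat) : Rn := \row_j if (j < k)%N then z ord0 j else 0.
suff S k : (k <= n)%N -> `|f (y + zk k) - f y| <= M * \sum_(j < n | (j < k)%N) `|z ord0 j|.
  have := S n (leqnn n); rewrite (_ : zk n = z); last first.
    by apply/rowP => j; rewrite mxE ltn_ord.
  by under eq_bigl do rewrite ltn_ord.
elim: k => [_|k IH kn].
  rewrite big1// mulr0 (_ : zk 0 = 0) ?addr0 ?subrr ?normr0//.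
  by apply/rowP => j; rewrite !mxE.
pose i := Ordinal kn.
have zS : zk k.+1 = zk k + z ord0 i *: e i.
  apply/rowP => j; rewrite !mxE eqxx/= ltnS leq_eqVlt.
  have [->|ji] := eqVneq j i; first by rewrite /= ltnn eqxx mulr1 add0r.
  rewrite mulr0 addr0.
  by have /negbTE -> : (j : nat) != k by apply: contraNneq ji => jk; apply/eqP/val_inj.
rewrite (bigD1 i) ?ltnSn//= mulrDr zS.
have -> : \sum_(j < n | (j < k.+1)%N && (j != i)) `|z ord0 j| = \sum_(j < n | (j < k)%N) `|z ord0 j|.
  apply: eq_bigl => j; rewrite ltnS leq_eqVlt -val_eqE /=.
  by case: (eqVneq (j : nat) k) => [->|_]; rewrite /= ?ltnn ?andbT.
rewrite addrA.
have -> : f (y + zk k + z ord0 i *: e i) - f y =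
    (f (y + zk k + z ord0 i *: e i) - f (y + zk k)) + (f (y + zk k) - f y).
  by rewrite addrA subrK.
rewrite (le_trans (ler_normD _ _))// lerD//; last first.
  by apply: IH; exact: ltnW.
apply: lipschitz_dir (H i) _ => s sz; apply: hM => j; rewrite !mxE eqxx/=.
have addBK (a b c : R) : a + b + c - a = b + c by ring.
rewrite addBK.
have [->|ji] := eqVneq j i; first by rewrite /= ltnn add0r mulr1.
by rewrite mulr0 addr0; case: ifP; rewrite ?normr0.
Qed.

(** The second difference of [f] is the increment by [z] of [f y - f (y - z)], whose
    partial derivatives are in turn increments of those of [f]: two applications of
    [lipschitz_partial]. The factor 3 bounds the three displacements involved. *)
Lemma second_difference f (df : 'I_n -> Rn -> R) (ddf : 'I_n -> 'I_n -> Rn -> R) x z M :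
  (forall i, has_partial i f (df i)) ->
  (forall i j, has_partial j (df i) (ddf i j)) ->
  (forall i j w, (forall k, `|w ord0 k - x ord0 k| <= 3 * `|z ord0 k|) -> `|ddf i j w| <= M) ->
  `|f (x + z) + f (x - z) - 2 * f x| <= M * (\sum_j `|z ord0 j|) ^+ 2.
Proof.
move=> Hf Hdf hM.
pose g y := f y - f (y - z).
have Hg i : has_partial i g (fun y => df i y - df i (y - z)).
  by apply: has_partialB => //; exact: has_partial_shift.
have -> : f (x + z) + f (x - z) - 2 * f x = g (x + z) - g x.
  by rewrite /g addrK; ring.
rewrite expr2 mulrA; apply: lipschitz_partial Hg _ => i y hy.
rewrite -{1}(subrK z y); apply: lipschitz_partial (Hdf i) _ => j w hw.
apply: hM => k; have := hy k; have := hw k; rewrite !mxE.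
move: (w _ _) (y _ _) (z _ _) (x _ _) => a b c d h1 h2.
have -> : a - d = (a - (b - c)) + (b - d) - c by ring.
rewrite (le_trans (ler_normB _ _))//.
have := ler_normD (a - (b - c)) (b - d).
lra.
Qed.

Lemma sum_norm_sqn z : (\sum_j `|z ord0 j|) ^+ 2 <= n%:R ^+ 2 * sqn z.
Proof.
have h : \sum_j `|z ord0 j| <= n%:R * Num.sqrt (sqn z).
  rewrite (_ : n%:R * _ = \sum_(i < n) Num.sqrt (sqn z)); last first.
    by rewrite sumr_const card_ord mulr_natl.
  apply: ler_sum => i _; rewrite -sqrtr_sqr.
  by apply: ler_wsqrtr; exact: sqn_coord.
rewrite -[in leRHS](sqr_sqrtr (sqn_ge0 z)) -exprMn.
by apply: lerXn2r; rewrite ?nnegrE// ?sumr_ge0// mulr_ge0 ?sqrtr_ge0.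
Qed.

Lemma second_difference_sqn f df ddf x z M : 0 <= M ->
  (forall i, has_partial i f (df i)) ->
  (forall i j, has_partial j (df i) (ddf i j)) ->
  (forall i j w, (forall k, `|w ord0 k - x ord0 k| <= 3 * `|z ord0 k|) -> `|ddf i j w| <= M) ->
  `|f (x + z) + f (x - z) - 2 * f x| <= M * n%:R ^+ 2 * sqn z.
Proof.
move=> M0 H1 H2 H3; apply: le_trans (second_difference H1 H2 H3) _.
by rewrite -mulrA ler_wpM2l// sum_norm_sqn.
Qed.

(** Translation invariance moves forward difference quotients of [f] to backward
    ones of [g]; by dominated convergence this passes to the limit of step 0. *)
Lemma integral_by_parts i f df g dg :
  measurable_fun setT f -> measurable_fun setT g ->
  mu.-integrable setT (EFin \o f) -> mu.-integrable setT (EFin \o g) ->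
  has_partial i f df -> has_partial i g dg ->
  (exists M, forall x, `|df x| <= M) -> (exists M, forall x, `|dg x| <= M) ->
  (exists M, forall x, `|f x| <= M) ->
  \int[mu]_x (df x * g x) = - \int[mu]_x (f x * dg x).
Proof.
move=> mf mg fi gi Hf Hg [M1 dfM1] [M2 dgM2] [M3 fM3].
pose M := Num.max M1 (Num.max M2 M3).
have dfM x : `|df x| <= M by rewrite le_max dfM1.
have dgM x : `|dg x| <= M by rewrite !le_max dgM2 orbT.
have fM x : `|f x| <= M by rewrite !le_max fM3 !orbT.
have M0 : 0 <= M by exact: le_trans (fM 0).
pose h (k : nat) : R := k.+1%:R^-1.
have h0 k : 0 < h k by rewrite invr_gt0.
have hcvg : h @ \oo --> (0 : R) by exact: cvg_harmonic.
pose q k x := (f (x + h k *: e i) - f x) / h k.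
pose r k x := (g (x - h k *: e i) - g x) / h k.
have msh (a : Rn) (u : Rn -> R) : measurable_fun setT u -> measurable_fun setT (fun x => u (x + a)).
  move=> mu_; have -> : (fun x => u (x + a)) = u \o (fun x => 1 *: x + a).
    by apply/funext => x /=; rewrite scale1r.
  by apply: measurableT_comp => //; exact: measurable_affine.
have mq k : measurable_fun setT (q k).
  by apply: measurable_funM => //; apply: measurable_funB => //; exact: msh.
have mr k : measurable_fun setT (r k).
  by apply: measurable_funM => //; apply: measurable_funB => //; exact: msh.
have qM k x : `|q k x| <= M.
  rewrite normrM normfV (ger0_norm (ltW (h0 k))) ler_pdivrMr//.
  by rewrite -[in leRHS](ger0_norm (ltW (h0 k))); exact: lipschitz_dir Hf _.
have rM k x : `|r k x| <= M.
  rewrite normrM normfV (ger0_norm (ltW (h0 k))) ler_pdivrMr// -scaleNr.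
  rewrite -[in leRHS](ger0_norm (ltW (h0 k))) -[in leRHS]normrN.
  exact: lipschitz_dir Hg _.
have Mgi : mu.-integrable setT (EFin \o (fun x => M * `|g x|)).
  exact: (integrableZl measurableT M (integrable_norm gi)).
have Mfi : mu.-integrable setT (EFin \o (fun x => M * `|f x|)).
  exact: (integrableZl measurableT M (integrable_norm fi)).
have [C1 I1] : \int[mu]_x (q k x * g x) @[k --> \oo] --> \int[mu]_x (df x * g x) /\
    mu.-integrable setT (EFin \o (fun x => df x * g x)).
  apply: (Rintegral_cvg_dominated (g := fun x => M * `|g x|)) => //.
  - by move=> k; exact: measurable_funM.
  - move=> x; apply: cvgMl; rewrite /q.
    have := is_derive_cvg_seq h0 hcvg (Hf x).
    rewrite (_ : (fun k => _) = q^~ x)//; apply/funext => k.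
    by rewrite /q [x + _]addrC.
  - by move=> k x; rewrite normrM ler_wpM2r.
have [C2 I2] : \int[mu]_x (f x * r k x) @[k --> \oo] --> \int[mu]_x (f x * - dg x) /\
    mu.-integrable setT (EFin \o (fun x => f x * - dg x)).
  apply: (Rintegral_cvg_dominated (g := fun x => M * `|f x|)) => //.
  - by move=> k; exact: measurable_funM.
  - move=> x; apply: cvgMr; rewrite /r.
    pose G (t : R) := g (x + t *: e i).
    have HG : is_derive (0 : R) (1 : R) (G \o -%R) (- dg x).
      rewrite -mulrN1; apply: is_derive1_comp; rewrite oppr0.
      apply: (is_derive_transfer _ (Hg x)) => t.
      by rewrite scale_one /G addr0 addrC.
    have := is_derive_cvg_seq h0 hcvg HG.
    rewrite (_ : (fun k => _) = r^~ x)//; apply/funext => k.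
    by rewrite /r /G /= scale_one addr0 oppr0 scale0r addr0 scaleNr.
  - by move=> k x; rewrite normrM mulrC ler_wpM2r.
have E k : \int[mu]_x (q k x * g x) = \int[mu]_x (f x * r k x).
  have i1 : mu.-integrable setT (EFin \o (fun x => f x * g x)).
    apply: (integrable_dom _ Mgi); first exact: measurable_funM.
    by move=> x; rewrite normrM ler_wpM2r.
  have i2 : mu.-integrable setT (EFin \o (fun x => f (x + h k *: e i) * g x)).
    apply: (integrable_dom _ Mgi); first by apply: measurable_funM => //; exact: msh.
    by move=> x; rewrite normrM ler_wpM2r.
  have m2 : measurable_fun setT (fun x => f (x + h k *: e i) * g x).
    by apply: measurable_funM => //; exact: msh.
  have E2 : \int[mu]_x (f x * g (x - h k *: e i)) = \int[mu]_x (f (x + h k *: e i) * g x).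
    rewrite -(Rintegral_shift (- (h k *: e i)) m2 i2).
    by apply: eq_Rintegral => x _; rewrite subrK.
  have i3 : mu.-integrable setT (EFin \o (fun x => f x * g (x - h k *: e i))).
    have := integrable_shift (- (h k *: e i)) m2 i2.
    by under eq_fun do rewrite subrK.
  transitivity ((h k)^-1 * (\int[mu]_x (f (x + h k *: e i) * g x) - \int[mu]_x (f x * g x))).
    rewrite -RintegralB// -RintegralZl//; last exact: (integrableB measurableT i2 i1).
    by apply: eq_Rintegral => x _; rewrite /q; ring.
  rewrite -E2 -RintegralB// -RintegralZl//; last exact: (integrableB measurableT i3 i1).
  by apply: eq_Rintegral => x _; rewrite /r; ring.
have -> : (- \int[mu]_x (f x * dg x)) = \int[mu]_x (f x * - dg x).
  have I2' : mu.-integrable setT (EFin \o (fun x => f x * dg x)).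
    have := integrableZl measurableT (-1) I2.
    apply: eq_integrable => // x _ /=; rewrite -EFinM; congr EFin; ring.
  rewrite -mulN1r -RintegralZl//.
  by apply: eq_Rintegral => x _; ring.
have C1' : \int[mu]_x (f x * r k x) @[k --> \oo] --> \int[mu]_x (df x * g x).
  by rewrite (_ : (fun k => _) = (fun k => \int[mu]_x (q k x * g x)))//; apply/funext => k.
by apply: (cvg_unique _ C1' C2).
Qed.

End partials.

(** * Decay of test functions and derivatives of the bracket *)

Section test_functions.
Context {R : realType} {n : nat}.
Local Notation Rn := 'rV[R]_n.
Variable s : R.
Hypotheses (s0 : 0 < s) (s2 : s < 2).
Local Notation bracket := (@bracket R n s).
Local Notation r := (@rexp R n s).

Lemma smooth_has_partial (f : Rn -> R) l i : smooth f ->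
  has_partial i (partial l f) (partial (i :: l) f).
Proof. by move=> /(_ l)[_ H] x; exact: derivableP. Qed.

Lemma measurable_partial (f : Rn -> R) l : smooth f ->
  measurable_fun setT (partial l f).
Proof. by move=> /(_ l)[H _]; exact: continuous_measurable_row. Qed.

(** The complement of the closed support is open, so all derivatives vanish there. *)
Lemma partial_out_support (f : Rn -> R) l x :
  ~ closure [set x | f x != 0] x -> partial l f x = 0.
Proof.
have oC : open (~` closure [set x : Rn | f x != 0]) by exact/closed_openC/closed_closure.
elim: l x => [|i l IH] x Kx /=.
  by apply/eqP/negPn/negP => fx; apply: Kx; exact: subset_closure.
rewrite (near_eq_derive _ (g := cst 0)); first by rewrite derive_cst.
by move: oC; rewrite openE => /(_ x Kx); apply: filterS => y Ky /=; exact: IH.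
Qed.

Lemma test_function_bracket (f : Rn -> R) l : test_function f ->
  exists C, forall x, `|partial l f x| <= C * bracket x.
Proof.
move=> [sf cf]; set K := closure _ in cf.
have [cl _] := sf l.
have [M1 [_ HM1]] : bounded_set (partial l f @` K).
  by apply: compact_bounded; apply: continuous_compact => //; exact: continuous_subspaceT.
have [M2 [_ HM2]] := compact_bounded cf.
pose A := `|M1| + 1; pose B := `|M2| + 1.
have HA x : K x -> `|partial l f x| <= A.
  by move=> Kx; apply: (HM1 A); [rewrite ltr_pwDr// ler_norm|exists x].
have HB x : K x -> sqn x <= n%:R * B ^+ 2.
  move=> Kx; apply: sqn_le => i.
  have xB : `|x| <= B by apply: (HM2 B) => //; rewrite ltr_pwDr// ler_norm.
  apply: le_trans xB; rewrite /Num.norm/= mx_normrE.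
  by apply: (le_bigmax _ (fun ij : 'I_1 * 'I_n => `|x ij.1 ij.2|) (ord0, i)).
have A0 : 0 <= A by rewrite addr_ge0.
exists (A * (1 + n%:R * B ^+ 2) `^ r) => x.
have [Kx|Kx] := pselect (K x); last first.
  by rewrite partial_out_support// normr0 !mulr_ge0 ?powR_ge0 ?bracket_ge0.
apply: le_trans (HA x Kx) _; rewrite -mulrA -[leLHS]mulr1 ler_wpM2l//.
have E : (1 + n%:R * B ^+ 2) `^ r * (1 + n%:R * B ^+ 2) `^ (- r) = 1.
  by rewrite powRN divff// gt_eqF// powR_gt0// ltr_wpDr// mulr_ge0// sqr_ge0.
rewrite -[leLHS]E ler_wpM2l ?powR_ge0//; apply: powRN_le; first exact/ltW/rexp_gt0.
  by rewrite ltr_wpDr ?sqn_ge0.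
by rewrite lerD2l HB.
Qed.

(** Decay of order n + 2 is enough, as n + s < n + 2. *)
Lemma schwartz_bracket (f : Rn -> R) l : schwartz f ->
  exists C, forall x, `|partial l f x| <= C * bracket x.
Proof.
move=> [_ /(_ n.+2 l)[C HC]]; exists C => x; have := HC x.
have e0 : 0 <= enorm x by exact: sqrtr_ge0.
have p0 : 0 < (1 + enorm x) ^+ n.+2 by rewrite exprn_gt0// ltr_wpDr.
have C0 : 0 <= C by apply: le_trans (HC 0); rewrite mulr_ge0// exprn_ge0// addr_ge0// sqrtr_ge0.
rewrite mulrC -ler_pdivlMr// => /le_trans; apply.
rewrite ler_wpM2l// /bracket powRN lef_pV2 ?posrE ?powR_gt0// ?ltr_wpDr ?sqn_ge0//.
apply: (@le_trans _ _ (((1 + enorm x) ^+ 2) `^ r)).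
  apply: ge0_ler_powR => //; first exact/ltW/rexp_gt0.
  - by rewrite nnegrE addr_ge0// sqn_ge0.
  - by rewrite nnegrE sqr_ge0.
  rewrite sqrrD expr1n mul1r -[sqn x]sqr_sqrtr ?sqn_ge0// -/(enorm x) -/(sqn x).
  by rewrite -[enorm x *+ 2]mulr_natr; have := mulr_ge0 e0 (ler0n R 2); rewrite /enorm /sqn; lra.
rewrite -powR_mulrn ?addr_ge0// -powRrM -powR_mulrn ?addr_ge0//.
apply: ler_powR; first by rewrite lerDl.
by rewrite /rexp -[n.+2]addn2 natrD; have := s2; lra.
Qed.

End test_functions.

Section bracket_calculus.
Context {R : realType} {n : nat}.
Local Notation Rn := 'rV[R]_n.
Local Notation e := (delta_mx ord0).

Lemma is_derive_quadratic (A B C : R) :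
  is_derive (0 : R) (1 : R) (fun h => A + B * h + C * h ^+ 2) B.
Proof.
have := is_deriveD (is_deriveD (is_derive_cst A (0 : R) (1 : R))
   (is_deriveZ B (is_derive_id (0 : R) (1 : R))))
   (is_deriveZ C (is_deriveX 2 (is_derive_id (0 : R) (1 : R)))).
rewrite expr1 mulr0 scale0r scaler0 addr0 add0r.
by rewrite (_ : B *: (1 : R) = B)//; exact: mulr1.
Qed.

Variable lam : R.
Implicit Types (x y z : Rn) (i j : 'I_n) (a : R).
(** The powers of 1 + lam^2 |x|^2 form, up to coordinate factors, a family closed under
    differentiation. *)
Definition jap (a : R) (x : Rn) : R := (1 + lam ^+ 2 * sqn x) `^ a.

Lemma jap_base_gt0 (x : Rn) : 0 < 1 + lam ^+ 2 * sqn x.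
Proof. by rewrite ltr_wpDr// mulr_ge0 ?sqr_ge0 ?sqn_ge0. Qed.

Lemma jap_gt0 a x : 0 < jap a x. Proof. exact/powR_gt0/jap_base_gt0. Qed.

Lemma sqn_line (x : Rn) i h : sqn (h *: e i + x) = sqn x + 2 * x ord0 i * h + h ^+ 2.
Proof.
rewrite /sqn (bigD1 i)//= [in RHS](bigD1 i)//= !mxE !eqxx mulr1.
rewrite (eq_bigr (fun j => x ord0 j ^+ 2)); last first.
  by move=> j ji; rewrite !mxE eqxx (negbTE ji) mulr0 add0r.
ring.
Qed.

Lemma has_partial_jap a i :
  has_partial i (jap a) (fun x => 2 * a * lam ^+ 2 * (x ord0 i * jap (a - 1) x)).
Proof.
move=> x.
pose p (h : R) := (1 + lam ^+ 2 * sqn x) + (lam ^+ 2 * (2 * x ord0 i)) * h + lam ^+ 2 * h ^+ 2.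
have pd : is_derive (0 : R) (1 : R) p (lam ^+ 2 * (2 * x ord0 i)) by exact: is_derive_quadratic.
have p0 : p 0 = 1 + lam ^+ 2 * sqn x by rewrite /p expr0n/= !mulr0 !addr0.
have pp : 0 < p 0 by rewrite p0 jap_base_gt0.
have D := is_derive1_comp (is_derive1_powR a pp) pd.
have -> : 2 * a * lam ^+ 2 * (x ord0 i * jap (a - 1) x) =
   a * p 0 `^ (a - 1) * (lam ^+ 2 * (2 * x ord0 i)) by rewrite p0 /jap; ring.
apply: (is_derive_transfer _ D) => h.
rewrite scale_one addr0 /jap /= sqn_line /p; congr (_ `^ _); ring.
Qed.

Lemma has_partial_coord i j : has_partial j (fun x : Rn => x ord0 i) (fun=> (i == j)%:R).
Proof.
move=> x; apply: (is_derive_transfer _ (is_derive_quadratic (x ord0 i) (i == j)%:R 0)) => h.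
by rewrite scale_one addr0 !mxE eqxx/= mul0r addr0 addrC mulrC.
Qed.

Lemma has_partial_djap a i j :
  has_partial j (fun x => 2 * a * lam ^+ 2 * (x ord0 i * jap (a - 1) x))
   (fun x => 2 * a * lam ^+ 2 * (x ord0 i * (2 * (a - 1) * lam ^+ 2 * (x ord0 j * jap (a - 1 - 1) x)) +
      jap (a - 1) x * (i == j)%:R)).
Proof.
move=> x; have := is_deriveZ (2 * a * lam ^+ 2)
  (is_deriveM (has_partial_coord i j x) (has_partial_jap (a - 1) j x)).
by [].
Qed.

Lemma japB1 a x : jap (a - 1) x * (1 + lam ^+ 2 * sqn x) = jap a x.
Proof.
rewrite /jap -[X in _ * X]powRr1 ?(ltW (jap_base_gt0 x))//.
by rewrite -powRD ?subrK// (gt_eqF (jap_base_gt0 x)) implybT.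
Qed.

Lemma japB1_le a x : jap (a - 1) x <= jap a x.
Proof.
rewrite -(japB1 a) ler_peMr ?(ltW (jap_gt0 _ _))// lerDl.
by rewrite mulr_ge0 ?sqr_ge0 ?sqn_ge0.
Qed.

Lemma coord_mul_le (x : Rn) i j : lam ^+ 2 * `|x ord0 i * x ord0 j| <= 1 + lam ^+ 2 * sqn x.
Proof.
apply: (@le_trans _ _ (lam ^+ 2 * sqn x)); last by rewrite lerDr.
rewrite ler_wpM2l ?sqr_ge0//.
have := sqn_coord x i; have := sqn_coord x j.
move: (x ord0 i) (x ord0 j) (sqn x) => a b c h1 h2.
rewrite ler_norml; have := sqr_ge0 (a - b); have := sqr_ge0 (a + b).
rewrite sqrrD sqrrB; lra.
Qed.

Lemma norm_coord_le (x : Rn) i : `|lam * x ord0 i| <= 1 + lam ^+ 2 * sqn x.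
Proof.
have h : (lam * x ord0 i) ^+ 2 <= lam ^+ 2 * sqn x.
  by rewrite exprMn ler_wpM2l ?sqr_ge0// sqn_coord.
apply: (@le_trans _ _ (1 + (lam * x ord0 i) ^+ 2)); last by rewrite lerD2l.
move: (lam * _) => t; rewrite ler_norml.
have := sqr_ge0 (t - 1); have := sqr_ge0 (t + 1); have := sqr_ge0 t.
rewrite sqrrD sqrrB; lra.
Qed.

Lemma djap_le a i x :
  `|2 * a * lam ^+ 2 * (x ord0 i * jap (a - 1) x)| <= 2 * `|a| * `|lam| * jap a x.
Proof.
have -> : 2 * a * lam ^+ 2 * (x ord0 i * jap (a - 1) x) =
   2 * a * lam * ((lam * x ord0 i) * jap (a - 1) x) by ring.
rewrite normrM !normrM [`|2|]ger0_norm// (ger0_norm (ltW (jap_gt0 _ _))).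
rewrite ler_wpM2l ?mulr_ge0// -(japB1 a) mulrC ler_wpM2l ?(ltW (jap_gt0 _ _))//.
by rewrite -normrM norm_coord_le.
Qed.

(** Two derivatives produce a factor lam^4 x_i x_j and lower the exponent by 2; since
    lam^2 |x_i x_j| <= 1 + lam^2 |x|^2, this amounts to a factor lam^2. *)
Lemma ddjap_le a i j x :
  `|2 * a * lam ^+ 2 * (x ord0 i * (2 * (a - 1) * lam ^+ 2 * (x ord0 j * jap (a - 1 - 1) x)) +
      jap (a - 1) x * (i == j)%:R)| <=
  2 * `|a| * (2 * `|a - 1| + 1) * lam ^+ 2 * jap a x.
Proof.
have -> : 2 * a * lam ^+ 2 * (x ord0 i * (2 * (a - 1) * lam ^+ 2 * (x ord0 j * jap (a - 1 - 1) x)) +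
      jap (a - 1) x * (i == j)%:R) = 2 * a * lam ^+ 2 *
   (2 * (a - 1) * (lam ^+ 2 * (x ord0 i * x ord0 j)) * jap (a - 1 - 1) x + jap (a - 1) x * (i == j)%:R) by ring.
have h1 := japB1_le a x; have h2 := japB1 (a - 1) x; have h3 := coord_mul_le x i j.
have [j0 j1 j2] := And3 (jap_gt0 a x) (jap_gt0 (a - 1) x) (jap_gt0 (a - 1 - 1) x).
have L0 := sqr_ge0 lam.
move: (lam ^+ 2) L0 h1 h2 h3 j0 j1 j2 => L L0.
move: (x ord0 i * x ord0 j) (1 + L * sqn x) (jap a x) (jap (a - 1) x) (jap (a - 1 - 1) x).
move=> c B J J1 J2 h1 h2 h3 j0 j1 j2.
rewrite 3!normrM [`|2|]ger0_norm// (ger0_norm L0).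
have -> : 2 * `|a| * (2 * `|a - 1| + 1) * L * J =
   2 * `|a| * L * ((2 * `|a - 1| + 1) * J) by ring.
rewrite ler_wpM2l ?mulr_ge0//.
rewrite (le_trans (ler_normD _ _))// [leRHS]mulrDl mul1r lerD//; last first.
  rewrite normrM (gtr0_norm j1); apply: le_trans h1; rewrite ler_piMr ?(ltW j1)//.
  by rewrite normr_nat lern1 leq_b1.
rewrite 4!normrM [`|2|]ger0_norm// (ger0_norm L0) (gtr0_norm j2).
rewrite -2!mulrA -[leRHS]mulrA ler_wpM2l// ler_wpM2l//.
by apply: le_trans h1; rewrite -h2 mulrC ler_wpM2l// (ltW j2).
Qed.

End bracket_calculus.

(** * The fractional Laplacian in second-difference form *)

Section product_helpers.
Context d1 d2 (T1 : measurableType d1) (T2 : measurableType d2) (R : realType).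
Variables (m1 : {sigma_finite_measure set T1 -> \bar R})
  (m2 : {sigma_finite_measure set T2 -> \bar R}).

Lemma integrable_tensor (f : T1 -> R) (g : T2 -> R) :
  measurable_fun setT f -> measurable_fun setT g ->
  m1.-integrable setT (EFin \o f) -> m2.-integrable setT (EFin \o g) ->
  (m1 \x m2)%E.-integrable setT (EFin \o (fun z => f z.1 * g z.2)).
Proof.
move=> mf mg fi gi.
have mfg : measurable_fun setT (fun z : T1 * T2 => f z.1 * g z.2).
  by apply: measurable_funM; apply: measurableT_comp.
apply/integrable12ltyP; first exact/measurable_EFinP.
have gn := integrable_norm gi; have fn := integrable_norm fi.
have -> : (\int[m1]_x \int[m2]_y `|(EFin \o (fun z => f z.1 * g z.2)%R) (x, y)|)%E =
   (\int[m1]_x ((\int[m2]_y `|g y|)%R * `|f x|)%:E)%E.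
  apply: eq_integral => x _; rewrite mulrC EFinM -RintegralE//.
  rewrite ge0_integralZlR//; last exact: measurableT_comp.
  by apply: eq_integral => y _ /=; rewrite normrM.
rewrite -ge0_integralZlR ?Rintegral_ge0//; last exact: measurableT_comp.
by rewrite (RintegralE fn) -EFinM ltry.
Qed.

Lemma Rfubini (F : T1 * T2 -> R) :
  (m1 \x m2)%E.-integrable setT (EFin \o F) ->
  (forall x, m2.-integrable setT (EFin \o (fun y => F (x, y)))) ->
  (forall y, m1.-integrable setT (EFin \o (fun x => F (x, y)))) ->
  \int[m1]_x \int[m2]_y F (x, y) = \int[m2]_y \int[m1]_x F (x, y).
Proof.
move=> iF i1 i2; congr fine.
transitivity (\int[m1]_x \int[m2]_y (EFin \o F) (x, y))%E.
  by apply: eq_integral => x _; rewrite -RintegralE.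
rewrite Fubini//; apply: eq_integral => y _.
by rewrite -(RintegralE (i2 y)).
Qed.

(** Tonelli gives measurability of the integrals of the positive and negative parts;
    where one of them is infinite, [fine] makes the value 0. *)
Lemma measurable_Rintegral_section (F : T1 * T2 -> R) :
  measurable_fun setT F ->
  measurable_fun setT (fun x => \int[m2]_y F (x, y)).
Proof.
move=> mF; apply: measurableT_comp; first exact: fine_measurable.
have -> : (fun x => \int[m2]_y (F (x, y))%:E)%E =
  (fun x => \int[m2]_y ((EFin \o F)^\+ (x, y)) - \int[m2]_y ((EFin \o F)^\- (x, y)))%E.
  apply/funext => x; rewrite [LHS]integralE; congr (_ - _)%E; apply: eq_integral => y _.
    by rewrite !funeposE.
  by rewrite !funenegE.
have mFE : measurable_fun setT (EFin \o F) by exact/measurable_EFinP.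
apply: emeasurable_funB.
  by apply: (measurable_fun_fubini_tonelli_F ((EFin \o F)^\+)%E) => //; exact: measurable_funepos.
by apply: (measurable_fun_fubini_tonelli_F ((EFin \o F)^\-)%E) => //; exact: measurable_funeneg.
Qed.

End product_helpers.

Section fractional_laplacian.
Context {R : realType} {n : nat}.
Local Notation Rn := 'rV[R]_n.
Local Notation mu := (lebesgue_row R n).
Variable s : R.
Hypotheses (s0 : 0 < s) (s2 : s < 2).
Local Notation kern := (@kern R n s).
Local Notation kmin := (@kmin R n s).
Implicit Types (f g : Rn -> R) (x y z : Rn) (M c : R).

(** A class that contains both Schwartz functions and the spatial profile, and on
    which the integral defining [flap] converges absolutely. *)
Definition regular f : Prop := [/\ measurable_fun setT f,
  mu.-integrable setT (EFin \o f) &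
  exists M, (forall x, `|f x| <= M) /\
    (forall x z, `|f (x + z) + f (x - z) - 2 * f x| <= M * sqn z)].

(** The integrand of the fractional Laplacian after averaging over z and -z. The
    second difference is O(|z|^2), so that no principal value is needed. *)
Definition sdiff f x z : R := (2 * f x - f (x + z) - f (x - z)) / 2 * kern z.

Definition flap f x : R := @fraclap_cst R n (s / 2) * \int[mu]_z sdiff f x z.

Lemma measurable_rowD d (T : measurableType d) (u v : T -> Rn) :
  measurable_fun setT u -> measurable_fun setT v ->
  measurable_fun setT (fun t => u t + v t).
Proof.
move=> mu_ mv; apply: measurable_rowP => i.
under eq_fun do rewrite mxE.
by apply: measurable_funD; apply: (measurableT_comp (measurable_coor i)).
Qed.

Lemma measurable_rowN d (T : measurableType d) (u : T -> Rn) :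
  measurable_fun setT u -> measurable_fun setT (fun t => - u t).
Proof.
move=> mu_; apply: measurable_rowP => i.
under eq_fun do rewrite mxE.
by apply: measurable_funN; apply: (measurableT_comp (measurable_coor i)).
Qed.

Lemma measurable_sdiff2 f : measurable_fun setT f ->
  measurable_fun setT (fun z : Rn * Rn => sdiff f z.1 z.2).
Proof.
move=> mf; apply: measurable_funM; last first.
  by apply: (measurableT_comp (@measurable_kern _ _ s)).
apply: measurable_funM => //; apply: measurable_funB; first apply: measurable_funB.
- by apply: measurable_funM => //; apply: measurableT_comp.
- by apply: (measurableT_comp mf); apply: measurable_rowD.
- apply: (measurableT_comp mf); apply: measurable_rowD => //.
  exact: measurable_rowN.
Qed.

Lemma measurable_sdiff f x : measurable_fun setT f -> measurable_fun setT (sdiff f x).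
Proof.
move=> mf; have := measurableT_comp (measurable_sdiff2 mf) (pair1_measurable x).
exact.
Qed.

Lemma sdiff_le f M : (forall x, `|f x| <= M) ->
  (forall x z, `|f (x + z) + f (x - z) - 2 * f x| <= M * sqn z) ->
  forall x z, `|sdiff f x z| <= 2 * M * kmin z.
Proof.
move=> fM fz x z; rewrite /sdiff /kmin normrM (ger0_norm (kern_ge0 _ _)) mulrA.
rewrite ler_wpM2r ?kern_ge0//.
have M0 : 0 <= M by exact: le_trans (fM 0).
have := fz x z; have := fM x; have := fM (x + z); have := fM (x - z).
move: (f x) (f _) (f _) (sqn z) (sqn_ge0 z) => a b c t t0.
rewrite !ler_norml => /andP[h1 h2] /andP[h3 h4] /andP[h5 h6] /andP[h7 h8].
have Mt : 0 <= M * t by rewrite mulr_ge0.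
by case: (leP 1 t) => t1; apply/andP; split; lra.
Qed.

Lemma integrable_sdiff f x : regular f -> mu.-integrable setT (EFin \o sdiff f x).
Proof.
move=> [mf fi [M [fM fz]]].
apply: (integrable_dom (g := fun z => 2 * M * kmin z)).
- exact: measurable_sdiff.
- exact: (integrableZl measurableT (2 * M) (integrable_kmin s0 s2)).
- exact: sdiff_le.
Qed.

Lemma measurable_flap f : measurable_fun setT f -> measurable_fun setT (flap f).
Proof.
move=> mf; apply: measurable_funM => //.
exact: (measurable_Rintegral_section _ (measurable_sdiff2 mf)).
Qed.

Lemma flap_bounded f : regular f -> exists M, forall x, `|flap f x| <= M.
Proof.
move=> Hf; have [mf fi [M [fM fz]]] := Hf.
exists (`|@fraclap_cst R n (s / 2)| * (\int[mu]_z (2 * M * kmin z))) => x.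
rewrite normrM ler_wpM2l//.
apply: le_trans (le_normr_Rintegral _ _) _ => //; first exact: integrable_sdiff.
apply: le_Rintegral => //.
- exact: (integrable_norm (integrable_sdiff x Hf)).
- exact: (integrableZl measurableT (2 * M) (integrable_kmin s0 s2)).
- by move=> z _; exact: sdiff_le.
Qed.

Lemma measurable_enorm_gt (eps : R) : measurable [set z : Rn | eps < enorm z].
Proof.
have menorm : measurable_fun setT (@enorm R n).
  rewrite (_ : @enorm R n = fun x => sqn x `^ 2^-1); last by apply/funext => y; exact: enormE.
  by apply: measurable_powR_comp; exact: measurable_sqn.
rewrite (_ : [set _ | _] = @enorm R n @^-1` `]eps, +oo[).
  by rewrite -[X in measurable X]setTI; exact: menorm.
by apply/seteqP; split => z /=; rewrite in_itv/= andbT.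
Qed.

(** Outside a ball around the singularity, f x - f (x - z) may be replaced by its
    average over z and -z, which is a second difference. *)
Lemma truncated_symmetric f x (eps : R) : regular f -> 0 < eps ->
  \int[mu]_(y in [set y | eps < enorm (x - y)])
    ((f x - f y) / enorm (x - y) `^ (n%:R + 2 * (s / 2))) =
  \int[mu]_z (\1_[set z | eps < enorm z] z * sdiff f x z).
Proof.
move=> Hf eps0; have [mf fi [M [fM fz]]] := Hf.
have M0 : 0 <= M by exact: le_trans (fM 0).
have mD := measurable_enorm_gt eps.
pose a z := \1_[set z | eps < enorm z] z * ((f x - f (x - z)) * kern z).
have mxz : measurable_fun setT (fun z => f (x - z)).
  apply: (measurableT_comp mf); apply: measurable_rowD => //; exact: measurable_rowN.
have ma : measurable_fun setT a.
  apply: measurable_funM; first exact: measurable_indic.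
  apply: measurable_funM; last exact: measurable_kern.
  exact: measurable_funB.
pose m := Num.min 1 (eps ^+ 2).
have m0 : 0 < m by rewrite lt_min ltr01 exprn_gt0.
have ia : mu.-integrable setT (EFin \o a).
  apply: (integrable_dom (g := fun z => 2 * M / m * kmin z)) => //.
    exact: (integrableZl measurableT (2 * M / m) (integrable_kmin s0 s2)).
  move=> z; rewrite /a indicE; case: (boolP (z \in _)) => zD; last first.
    by rewrite mul0r normr0 mulr_ge0 ?kmin_ge0// divr_ge0 ?mulr_ge0// ltW.
  rewrite mul1r normrM (ger0_norm (kern_ge0 _ _)) /kmin mulrA ler_wpM2r ?kern_ge0//.
  have mz : m <= Num.min 1 (sqn z).
    rewrite /m le_min ge_min lexx/= ge_min; apply/orP; right.
    move: zD; rewrite inE/= => /ltW ez; have -> : sqn z = enorm z ^+ 2 by rewrite sqr_sqrtr ?sqn_ge0.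
    by apply: lerXn2r => //; rewrite nnegrE; [exact: ltW|exact: le_trans (ltW eps0) ez].
  rewrite (le_trans (ler_normB _ _))// (le_trans (lerD (fM _) (fM _)))//.
  rewrite -mulrA -mulr2n -[M *+ 2]mulr_natl ler_peMr ?mulr_ge0//.
  by rewrite ler_pdivlMl// mulr1.
have ma' : measurable_fun setT (fun z => a (- z)).
  by apply: (measurableT_comp ma); exact: measurable_rowN.
have ia' : mu.-integrable setT (EFin \o (fun z => a (- z))).
  have := @integrable_affine _ _ (-1) 0 _ _ ma ia; rewrite oppr_eq0 oner_neq0 => /(_ isT).
  by under eq_fun do rewrite scaleN1r addr0.
have -> : \int[mu]_(y in [set y | eps < enorm (x - y)])
    ((f x - f y) / enorm (x - y) `^ (n%:R + 2 * (s / 2))) = \int[mu]_y (a (-1 *: y + x)).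
  rewrite Rintegral_mkcond; apply: eq_Rintegral => y _.
  rewrite patchE scaleN1r [- y + x]addrC /a indicE subKr; case: ifPn => [/set_mem/= h|/negP h].
    rewrite mem_set// mul1r.
    by congr (_ * _); rewrite enorm_powR -powRN; congr (_ `^ _); rewrite /rexp; field.
  by rewrite memNset ?mul0r//= => h'; apply: h; exact: mem_set.
have := @Rintegral_affine _ _ (-1) x _ _ ma ia.
rewrite oppr_eq0 oner_neq0 normrN normr1 expr1n mul1r => /(_ isT) <-.
have E : \int[mu]_z a z = 2^-1 * (\int[mu]_z a z + \int[mu]_z a (- z)).
  by rewrite (Rintegral_opp ma ia); field.
rewrite E -RintegralD// -RintegralZl//; last exact: (integrableD measurableT ia ia').
apply: eq_Rintegral => z _; rewrite /a !indicE kernN /sdiff opprK.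
have -> : (- z \in [set z | eps < enorm z]) = (z \in [set z | eps < enorm z]).
  by apply/idP/idP; rewrite !inE/= /enorm -/(sqn _) -/(sqn _) sqnN.
by field.
Qed.

(** Hence the principal value is an absolutely convergent integral: the truncated
    integrands are dominated by an integrable multiple of [kmin]. *)
Lemma fraclap_schwartzE f x : regular f -> fraclap_schwartz (s / 2) f x = flap f x.
Proof.
move=> Hf; have [mf fi [M [fM fz]]] := Hf; congr (_ * _); apply/cvg_lim => //.
apply/cvg_at_rightP => u [u0 ucvg].
under eq_fun do rewrite truncated_symmetric//.
have mD := measurable_enorm_gt.
have [||||H _] := @Rintegral_cvg_dominated _ _ _ mu
  (fun k z => \1_[set z | u k < enorm z] z * sdiff f x z) (sdiff f x) (fun z => 2 * M * kmin z);
  last exact: H.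
- move=> k; apply: measurable_funM; first exact: measurable_indic.
  exact: measurable_sdiff.
- move=> z; have [->|z0] := eqVneq z 0.
    rewrite /sdiff (kern0 s0) mulr0.
    by under eq_fun do rewrite mulr0; exact: cvg_cst.
  have ez : 0 < enorm z by rewrite /enorm sqrtr_gt0 -/(sqn z) sqn_gt0.
  apply: cvg_near_cst.
  have /cvgrPdist_lt/(_ _ ez) := ucvg.
  apply: filterS => k /=; rewrite sub0r normrN gtr0_norm// => uk.
  by rewrite indicE mem_set// mul1r.
- exact: (integrableZl measurableT (2 * M) (integrable_kmin s0 s2)).
- move=> k z; rewrite normrM; apply: le_trans (sdiff_le fM fz x z).
  by rewrite ler_piMl// indicE normr_nat lern1 leq_b1.
Qed.

(** Fubini reduces this to the symmetry, for fixed z, of the second difference with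
    step z, which is translation invariance of the integral. It extends the operator
    by duality from Schwartz functions to the spatial profile. *)
Lemma flap_symmetric f g : regular f -> regular g ->
  \int[mu]_x (flap f x * g x) = \int[mu]_x (f x * flap g x).
Proof.
move=> Hf Hg.
have [mf fi [M [fM fz]]] := Hf; have [mg gi [N [gN gz]]] := Hg.
have M0 : 0 <= M by exact: le_trans (fM 0).
have N0 : 0 <= N by exact: le_trans (gN 0).
have ik : mu.-integrable setT (EFin \o kmin) by exact: integrable_kmin.
have key (u v : Rn -> R) (A : R) : measurable_fun setT u -> mu.-integrable setT (EFin \o v) ->
    measurable_fun setT v -> (forall x z, `|sdiff u x z| <= A * kmin z) -> regular u ->
    (exists B, forall x, `|v x| <= B) ->
    \int[mu]_x (flap u x * v x) =
     @fraclap_cst R n (s / 2) * \int[mu]_z \int[mu]_x (sdiff u x z * v x).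
  move=> mu_ iv mv uA Hu [B vB].
  have mF : measurable_fun setT (fun w : Rn * Rn => sdiff u w.1 w.2 * v w.1).
    by apply: measurable_funM; [exact: measurable_sdiff2|exact: measurableT_comp].
  have B0 : 0 <= B by exact: le_trans (vB 0).
  have iF : (mu \x mu)%E.-integrable setT (EFin \o (fun w : Rn * Rn => sdiff u w.1 w.2 * v w.1)).
    have mv' : measurable_fun setT (fun x => `|v x|) by exact: measurableT_comp.
    have mk' : measurable_fun setT (fun z => A * kmin z).
      by apply: measurable_funM => //; exact: measurable_kmin.
    have iT := integrable_tensor mv' mk' (integrable_norm iv) (integrableZl measurableT A ik).
    by apply: (integrable_dom mF iT) => w; rewrite normrM mulrC ler_wpM2l.
  have i1 x : mu.-integrable setT (EFin \o (fun z => sdiff u x z * v x)).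
    have := integrableZl measurableT (v x) (integrable_sdiff x Hu).
    by apply: eq_integrable => // z _; rewrite /= -EFinM mulrC.
  have i2 z : mu.-integrable setT (EFin \o (fun x => sdiff u x z * v x)).
    apply: (integrable_dom (g := fun x => A * kmin z * `|v x|)).
    - exact: (measurableT_comp mF (pair2_measurable z)).
    - exact: (integrableZl measurableT (A * kmin z) (integrable_norm iv)).
    - by move=> x; rewrite normrM ler_wpM2r.
  rewrite -(Rfubini iF i1 i2)/= -RintegralZl//; last first.
    have := integrable_fubini_F iF.
    apply: eq_integrable => // x _; rewrite /fubini_F /=.
    by rewrite -RintegralE.
  apply: eq_Rintegral => x _; rewrite /flap -mulrA; congr (_ * _).
  by rewrite -RintegralZr//; exact: integrable_sdiff.
under [RHS]eq_Rintegral do rewrite mulrC.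
rewrite (key f g (2 * M))//; [|exact: sdiff_le|by exists N].
rewrite (key g f (2 * N))//; [|exact: sdiff_le|by exists M].
congr (_ * _); apply: eq_Rintegral => z _.
have mul_i (u v : Rn -> R) (B : R) : measurable_fun setT u -> measurable_fun setT v -> (forall x, `|u x| <= B) ->
    mu.-integrable setT (EFin \o v) -> mu.-integrable setT (EFin \o (fun x => u x * v x)).
  move=> mu_ mv uB iv; apply: (integrable_dom (g := fun x => B * `|v x|)).
  - exact: measurable_funM.
  - exact: (integrableZl measurableT B (integrable_norm iv)).
  - by move=> x; rewrite normrM ler_wpM2r.
have msh (u : Rn -> R) a : measurable_fun setT u -> measurable_fun setT (fun x : Rn => u (x + a)).
  by move=> mu_; apply: (measurableT_comp mu_); exact: measurable_rowD.
have sh (u v : Rn -> R) (B : R) (a : Rn) : measurable_fun setT u -> measurable_fun setT v -> (forall x, `|u x| <= B) ->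
   mu.-integrable setT (EFin \o v) ->
   \int[mu]_x (u (x + a) * v x) = \int[mu]_x (u x * v (x - a)).
  move=> mu_ mv uB iv.
  have m1 : measurable_fun setT (fun x => u x * v (x - a)) by apply: measurable_funM => //; exact: msh.
  have i1 : mu.-integrable setT (EFin \o (fun x => u x * v (x - a))).
    by apply: mul_i uB _ => //; [exact: msh|exact: integrable_shift].
  rewrite -[RHS](Rintegral_shift a m1 i1).
  by apply: eq_Rintegral => x _; rewrite addrK.
have ex (u v : Rn -> R) (B : R) : measurable_fun setT u -> measurable_fun setT v -> (forall x, `|u x| <= B) ->
   mu.-integrable setT (EFin \o v) ->
   \int[mu]_x (sdiff u x z * v x) = kern z / 2 * (2 * \int[mu]_x (u x * v x) -
     \int[mu]_x (u (x + z) * v x) - \int[mu]_x (u (x - z) * v x)).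
  move=> mu_ mv uB iv.
  have i0 := mul_i u v B mu_ mv uB iv.
  have i1 : mu.-integrable setT (EFin \o (fun x => u (x + z) * v x)).
    by apply: (mul_i _ _ B) => //; exact: msh.
  have i2 : mu.-integrable setT (EFin \o (fun x => u (x - z) * v x)).
    by apply: (mul_i _ _ B) => //; exact: msh.
  have i3 := integrableZl measurableT 2 i0.
  have i4 := integrableB measurableT i3 i1.
  rewrite -(RintegralZl 2)// -RintegralB// -RintegralB// -RintegralZl//; last first.
    exact: (integrableB measurableT i4 i2).
  by apply: eq_Rintegral => x _; rewrite /sdiff; field.
rewrite (ex f g M)// (ex g f N)//; congr (_ * _).
rewrite (sh f g M z)// (sh f g M (- z))// opprK.
have C (u v : Rn -> R) : \int[mu]_x (u x * v x) = \int[mu]_x (v x * u x).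
  by apply: eq_Rintegral => x _; rewrite mulrC.
by rewrite (C f g) (C f (fun x => g (x - z))) (C f (fun x => g (x + z))); ring.
Qed.

End fractional_laplacian.

(** * The spatial profile and its fractional Laplacian *)

Section bump.
Context {R : realType} {n : nat}.
Local Notation Rn := 'rV[R]_n.
Local Notation mu := (lebesgue_row R n).
Variable s : R.
Hypotheses (s0 : 0 < s) (s2 : s < 2).
Local Notation kern := (@kern R n s).
Local Notation kmin := (@kmin R n s).
Local Notation bracket := (@bracket R n s).
Local Notation flap := (@flap R n s).
Local Notation regular := (@regular R n).
Local Notation sdiff := (@sdiff R n s).
Local Notation r := (@rexp R n s).
Implicit Types (f g : Rn -> R) (x y z : Rn) (lam : R).

Definition bump lam x : R := bracket (lam *: x).

Definition dbump lam i x : R := 2 * (- r) * lam ^+ 2 * (x ord0 i * jap lam (- r - 1) x).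

Definition ddbump lam i j x : R := 2 * (- r) * lam ^+ 2 *
  (x ord0 i * (2 * (- r - 1) * lam ^+ 2 * (x ord0 j * jap lam (- r - 1 - 1) x)) +
      jap lam (- r - 1) x * (i == j)%:R).

Definition bump_cst : R := 2 * `|- r| * (2 * `|- r - 1| + 1).

Lemma bump_cst_ge0 : 0 <= bump_cst.
Proof. by rewrite !mulr_ge0// addr_ge0// mulr_ge0. Qed.

Lemma bumpE lam : bump lam = jap lam (- r).
Proof. by apply/funext => x; rewrite /bump /bracket sqnZ. Qed.

Lemma bump_gt0 lam x : 0 < bump lam x. Proof. exact: bracket_gt0. Qed.
Lemma bump_ge0 lam x : 0 <= bump lam x. Proof. exact/ltW/bump_gt0. Qed.
Lemma bump_le1 lam x : bump lam x <= 1. Proof. exact: bracket_le1. Qed.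

Lemma measurable_bump lam : measurable_fun setT (bump lam).
Proof.
have := measurableT_comp (@measurable_bracket R n s) (@measurable_affine R n lam 0).
by under eq_fun do rewrite /= addr0.
Qed.

Lemma has_partial_bump lam i : has_partial i (bump lam) (dbump lam i).
Proof. by rewrite bumpE; exact: has_partial_jap. Qed.

Lemma has_partial_dbump lam i j : has_partial j (dbump lam i) (ddbump lam i j).
Proof. exact: has_partial_djap. Qed.

Lemma dbump_le lam i x : `|dbump lam i x| <= 2 * `|- r| * `|lam| * bump lam x.
Proof. by rewrite bumpE; exact: djap_le. Qed.

Lemma ddbump_le lam i j x : `|ddbump lam i j x| <= bump_cst * lam ^+ 2 * bump lam x.
Proof. by rewrite bumpE; exact: ddjap_le. Qed.

Lemma measurable_jap lam a : measurable_fun setT (@jap R n lam a).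
Proof.
apply: measurable_powR_comp; apply: measurable_funD => //.
by apply: measurable_funM => //; exact: measurable_sqn.
Qed.

Lemma measurable_dbump lam i : measurable_fun setT (dbump lam i).
Proof.
apply: measurable_funM => //; apply: measurable_funM; first exact: measurable_coor.
exact: measurable_jap.
Qed.

Lemma measurable_ddbump lam i j : measurable_fun setT (ddbump lam i j).
Proof.
apply: measurable_funM => //; apply: measurable_funD.
  apply: measurable_funM; first exact: measurable_coor.
  apply: measurable_funM => //; apply: measurable_funM; first exact: measurable_coor.
  exact: measurable_jap.
by apply: measurable_funM => //; exact: measurable_jap.
Qed.

Lemma integrable_bump lam : 0 < lam -> mu.-integrable setT (EFin \o bump lam).
Proof.
move=> lam0; have l0 : 0 < lam^-1 by rewrite invr_gt0.
have := integrable_bracket_scale s0 l0.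
by rewrite invrK.
Qed.

Lemma Rintegral_bump lam : 0 < lam ->
  \int[mu]_x bump lam x = lam^-1 ^+ n * \int[mu]_x bracket x.
Proof.
move=> lam0; have l0 : 0 < lam^-1 by rewrite invr_gt0.
rewrite -(Rintegral_bracket_scale s0 l0).
by rewrite invrK.
Qed.

Lemma regular_bump lam : 0 < lam -> regular (bump lam).
Proof.
move=> lam0; split; [exact: measurable_bump|exact: integrable_bump|].
pose M := bump_cst * lam ^+ 2.
have M0 : 0 <= M by rewrite mulr_ge0 ?bump_cst_ge0 ?sqr_ge0.
exists (Num.max 1 (M * n%:R ^+ 2)); split => [x|x z].
  by rewrite ger0_norm ?bump_ge0// le_max bump_le1.
apply: (@le_trans _ _ (M * n%:R ^+ 2 * sqn z)); last first.
  by rewrite ler_wpM2r ?sqn_ge0// le_max lexx orbT.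
apply: (second_difference_sqn M0 (has_partial_bump lam) (has_partial_dbump lam)) => i j w _.
by rewrite (le_trans (ddbump_le _ _ _ _))// ler_piMr ?bump_le1//.
Qed.

Lemma regular_schwartz f : schwartz f -> regular f.
Proof.
move=> sf; have [sm _] := sf.
have [C HC] := schwartz_bracket s0 s2 [::] sf.
have mf : measurable_fun setT f by exact: (measurable_partial [::] sm).
have ib : mu.-integrable setT (EFin \o bracket) by exact: integrable_bracket.
split => //.
  exact: (integrable_dom mf (integrableZl measurableT C ib)).
have C0 : 0 <= C.
  rewrite -(pmulr_lge0 _ (bracket_gt0 s (0 : Rn))); exact: le_trans (HC 0).
have hD i j := schwartz_bracket s0 s2 [:: j; i] sf.
have [D' HD'] := choice (fun ij : 'I_n * 'I_n => hD ij.1 ij.2).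
have {D' HD'} [D HD] : exists D : 'I_n -> 'I_n -> R,
    forall i j x, `|partial [:: j; i] f x| <= D i j * bracket x.
  by exists (fun i j => D' (i, j)) => i j; exact: (HD' (i, j)).
have D0 i j : 0 <= D i j.
  rewrite -(pmulr_lge0 _ (bracket_gt0 s (0 : Rn))); exact: le_trans (HD i j 0).
pose M := \sum_i \sum_j D i j.
have M0 : 0 <= M by apply: sumr_ge0 => i _; apply: sumr_ge0.
have MD i j : D i j <= M.
  rewrite /M (bigD1 i)//= (bigD1 j)//= -addrA lerDl addr_ge0// ?sumr_ge0// => k _.
  by apply: sumr_ge0.
exists (Num.max C (M * n%:R ^+ 2)); split => [x|x z].
  apply: (@le_trans _ _ C); last by rewrite le_max lexx.
  by rewrite (le_trans (HC x))// ler_piMr ?bracket_le1//.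
apply: (@le_trans _ _ (M * n%:R ^+ 2 * sqn z)); last first.
  by rewrite ler_wpM2r ?sqn_ge0// le_max lexx orbT.
apply: (@second_difference_sqn _ _ f (fun i => partial [:: i] f) (fun i j => partial [:: j; i] f)) => //.
- by move=> i; exact: (smooth_has_partial [::] i sm).
- by move=> i j; exact: (smooth_has_partial [:: i] j sm).
- move=> i j w _; rewrite (le_trans (HD i j w))// (le_trans _ (MD i j))//.
  by rewrite ler_piMr ?bracket_le1//.
Qed.

(** For |z| <= 1 the second difference of [bracket] at x is bounded by the second
    derivatives near x, which are O([bracket x]). For |z| >= 1 the kernel is bounded
    by a multiple of [bracket z], and what is left is [bracket x] times the mass of
    the kernel plus self-convolutions of [bracket]. *)
Lemma flap_bracket_le : exists C, 0 <= C /\ forall x, `|flap bracket x| <= C * bracket x.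
Proof.
have Hb : regular bracket.
  have := regular_bump ltr01; rewrite (_ : bump 1 = bracket)//.
  by apply/funext => x; rewrite /bump scale1r.
have ib : mu.-integrable setT (EFin \o bracket) by exact: integrable_bracket.
have ik : mu.-integrable setT (EFin \o kmin) by exact: integrable_kmin.
pose K := (2 + 2 * n%:R * 3 ^+ 2) `^ r.
have K0 : 0 <= K by exact: powR_ge0.
pose A := Num.max 1 (bump_cst * K * n%:R ^+ 2).
have A0 : 0 <= A by rewrite le_max ler01.
have A1 : 1 <= A by rewrite le_max lexx.
have bz z : 1 <= sqn z -> kern z <= 2 `^ r * bracket z.
  move=> z1; rewrite /bracket /kern.
  have -> : (1 + sqn z) `^ (- r) = 2 `^ (- r) * ((1 + sqn z) / 2) `^ (- r).
    rewrite -powRM//; last by rewrite divr_ge0// addr_ge0// sqn_ge0.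
    by congr (_ `^ _); field.
  have E : 2 `^ r * 2 `^ (- r) = 1 :> R by rewrite powRN divff// gt_eqF// powR_gt0.
  rewrite mulrA E mul1r.
  apply: powRN_le; first exact/ltW/rexp_gt0.
    by rewrite divr_gt0// ltr_wpDr// sqn_ge0.
  by rewrite ler_pdivrMr//; lra.
pose cB x z := bracket z * bracket (x - z) + bracket z * bracket (x + z).
have pt x z : `|sdiff bracket x z| <= A * bracket x * kmin z + 2 `^ r * cB x z.
  rewrite /sdiff normrM (ger0_norm (kern_ge0 _ _)).
  have [b0 [b1 [b2 b3]]] : 0 <= bracket x /\ 0 <= bracket (x + z) /\ 0 <= bracket (x - z) /\ 0 <= bracket z.
    by rewrite !bracket_ge0.
  have r2 : 0 <= 2 `^ r :> R by exact: powR_ge0.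
  have k0 := kern_ge0 s z.
  (* Far from 0 the kernel is replaced by [bracket z]; near 0, Taylor's formula is used. *)
  case: (leP 1 (sqn z)) => z1.
    rewrite /kmin min_l// mul1r.
    apply: (@le_trans _ _ (bracket x * kern z + (bracket (x - z) + bracket (x + z)) * kern z)).
      rewrite -mulrDl ler_wpM2r// ler_norml; apply/andP; split; lra.
    apply: lerD; first by rewrite ler_wpM2r// ler_peMl.
    have -> : 2 `^ r * cB x z = (bracket (x - z) + bracket (x + z)) * (2 `^ r * bracket z).
      by rewrite /cB; ring.
    by rewrite ler_wpM2l ?addr_ge0// bz.
  apply: (@le_trans _ _ (A * bracket x * kmin z)); last by rewrite lerDl mulr_ge0// addr_ge0// mulr_ge0.
  rewrite /kmin (min_r (ltW z1)) [leRHS]mulrA ler_wpM2r//.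
  have zi i : `|z ord0 i| <= 1.
    rewrite -(@ler_pXn2r _ 2) ?nnegrE// expr1n real_normK ?num_real//.
    exact: le_trans (sqn_coord z i) (ltW z1).
  have H : `|bracket (x + z) + bracket (x - z) - 2 * bracket x| <=
      (bump_cst * K * bracket x) * n%:R ^+ 2 * sqn z.
    have b1E : bump 1 = bracket by apply/funext => y; rewrite /bump scale1r.
    rewrite -{1 2 3}b1E.
    apply: second_difference_sqn (has_partial_bump 1) (has_partial_dbump 1) _.
      by rewrite !mulr_ge0 ?bump_cst_ge0.
    move=> i j w hw; rewrite (le_trans (ddbump_le _ _ _ _))// expr1n mulr1 b1E -mulrA.
    rewrite ler_wpM2l ?bump_cst_ge0//.
    have -> : w = x + (w - x) by rewrite addrC subrK.
    apply: bracket_shift => // k; rewrite !mxE (le_trans (hw k))//.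
    by have := zi k; lra.
  have A2 : bump_cst * K * n%:R ^+ 2 <= A by rewrite le_max lexx orbT.
  have : bump_cst * K * bracket x * n%:R ^+ 2 * sqn z <= A * bracket x * sqn z.
    have -> : bump_cst * K * bracket x * n%:R ^+ 2 * sqn z =
      (bump_cst * K * n%:R ^+ 2) * (bracket x * sqn z) by ring.
    by rewrite -[leRHS]mulrA ler_wpM2r// mulr_ge0// sqn_ge0.
  have : 0 <= A * bracket x * sqn z by rewrite !mulr_ge0// sqn_ge0.
  move: H; rewrite !ler_norml => /andP[h1 h2] h3 h4; apply/andP; split; lra.
pose J := \int[mu]_y bracket y.
have mbb (x : Rn) (c : R) : measurable_fun setT (fun z => bracket z * bracket (c *: z + x)).
  apply: measurable_funM; first exact: measurable_bracket.
  exact: (measurableT_comp (@measurable_bracket R n s) (@measurable_affine R n c x)).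
have ibb (x : Rn) (c : R) : mu.-integrable setT (EFin \o (fun z => bracket z * bracket (c *: z + x))).
  apply: (integrable_dom (mbb x c) ib) => z.
  by rewrite ger0_norm ?mulr_ge0 ?bracket_ge0// ler_piMr ?bracket_ge0 ?bracket_le1.
have ibm (x : Rn) : mu.-integrable setT (EFin \o (fun z => bracket z * bracket (x - z))).
  by have := ibb x (-1); under eq_fun do rewrite scaleN1r addrC.
have ibp (x : Rn) : mu.-integrable setT (EFin \o (fun z => bracket z * bracket (x + z))).
  by have := ibb x 1; under eq_fun do rewrite scale1r addrC.
have icB (x : Rn) : mu.-integrable setT (EFin \o cB x).
  exact: (integrableD measurableT (ibm x) (ibp x)).
have intcB x : \int[mu]_z cB x z <= 2 * (2 * 4 `^ r * J * bracket x).
  rewrite /cB RintegralD// mulr_natl mulr2n lerD//.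
    exact: Rintegral_bracket_conv.
  rewrite -Rintegral_opp//.
    under eq_Rintegral do rewrite bracketN.
    exact: Rintegral_bracket_conv.
  by have := mbb x 1; under eq_fun do rewrite scale1r addrC.
have J0 : 0 <= J by apply: Rintegral_ge0 => z _; exact: bracket_ge0.
have Km0 : 0 <= \int[mu]_z kmin z by apply: Rintegral_ge0 => z _; exact: kmin_ge0.
exists (`|@fraclap_cst R n (s / 2)| * (A * (\int[mu]_z kmin z) + 2 `^ r * (2 * (2 * 4 `^ r * J)))).
split.
  by rewrite mulr_ge0// addr_ge0// mulr_ge0 ?powR_ge0// !mulr_ge0 ?powR_ge0.
move=> x; rewrite /flap normrM -[leRHS]mulrA ler_wpM2l//.
apply: le_trans (le_normr_Rintegral _ _) _ => //; first exact: integrable_sdiff.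
have i1 := integrableZl measurableT (A * bracket x) ik.
have i2 := integrableZl measurableT (2 `^ r) (icB x).
apply: (@le_trans _ _ (\int[mu]_z (A * bracket x * kmin z + 2 `^ r * cB x z))).
  apply: le_Rintegral => //.
    exact: (integrable_norm (integrable_sdiff s0 s2 x Hb)).
  exact: (integrableD measurableT i1 i2).
rewrite RintegralD// RintegralZl// RintegralZl// mulrDl lerD//.
  by rewrite mulrAC.
by rewrite -[leRHS]mulrA ler_wpM2l ?powR_ge0// (le_trans (intcB x))// !mulrA.
Qed.

(** The kernel is homogeneous of degree -(n + s). *)
Lemma flap_scale f lam x : 0 < lam -> regular f ->
  flap (fun y => f (lam *: y)) x = lam `^ s * flap f (lam *: x).
Proof.
move=> lam0 Hf; have [mf _ _] := Hf.
rewrite /flap mulrCA; congr (_ * _).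
have l0 : lam != 0 by rewrite gt_eqF.
have mh : measurable_fun setT (sdiff f (lam *: x)) by exact: measurable_sdiff.
have ih : mu.-integrable setT (EFin \o sdiff f (lam *: x)) by exact: integrable_sdiff.
rewrite (Rintegral_affine 0 l0 mh ih) gtr0_norm// mulrA -RintegralZl//; last first.
  exact: (integrable_affine 0 l0 mh ih).
apply: eq_Rintegral => z _; rewrite addr0 /sdiff scalerDr scalerBr.
have S : lam `^ s * lam `^ (- s) = 1 by rewrite powRN divff// gt_eqF// powR_gt0.
have K := kernZ s z lam0.
set X := (_ / 2).
have -> : lam `^ s * lam ^+ n * (X * kern (lam *: z)) =
  X * (lam `^ s * (lam ^+ n * kern (lam *: z))) by ring.
by rewrite K mulrA S mul1r.
Qed.

Lemma flap_bump_le : exists C, 0 <= C /\ forall lam x, 0 < lam ->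
  `|flap (bump lam) x| <= C * lam `^ s * bump lam x.
Proof.
have [C [C0 HC]] := flap_bracket_le; exists C; split => // lam x lam0.
have Hb : regular bracket.
  have := regular_bump ltr01; rewrite (_ : bump 1 = bracket)//.
  by apply/funext => y; rewrite /bump scale1r.
rewrite (@flap_scale bracket)// normrM (ger0_norm (powR_ge0 _ _)).
by rewrite [C * _]mulrC -[leRHS]mulrA ler_wpM2l ?powR_ge0.
Qed.

End bump.

(** * Separated functions c(t) b(x) as test curves *)

Section dominated.
Context {R : realType} {n : nat}.
Local Notation Rn := 'rV[R]_n.
Local Notation mu := (lebesgue_row R n).
Variables (s lam : R).
Hypotheses (s0 : 0 < s) (s2 : s < 2) (lam0 : 0 < lam).
Local Notation bump := (@bump R n s lam).
Local Notation dbump := (@dbump R n s lam).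
Local Notation ddbump := (@ddbump R n s lam).
Local Notation flap := (@flap R n s).
Implicit Types (f g u v psi : Rn -> R) (c : R) (l : seq 'I_n).

(** The slices of the test function and everything applied to them lie in this class;
    it is contained in L^1 and L^2. *)
Definition dominated f : Prop :=
  measurable_fun setT f /\ exists C, forall x, `|f x| <= C * bump x.

Lemma dominatedZ c f : dominated f -> dominated (fun x => c * f x).
Proof.
move=> [mf [C HC]]; split; first exact: measurable_funM.
by exists (`|c| * C) => x; rewrite normrM -mulrA ler_wpM2l.
Qed.

Lemma dominated_cst_ge0 f C : (forall x, `|f x| <= C * bump x) -> 0 <= C.
Proof. by move=> /(_ 0) /(le_trans (normr_ge0 _)); rewrite pmulr_lge0// bump_gt0. Qed.

Lemma dominated_integrable f : dominated f -> mu.-integrable setT (EFin \o f).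
Proof.
move=> [mf [C HC]]; apply: (integrable_dom mf _ HC).
exact: (integrableZl measurableT C (integrable_bump s0 lam0)).
Qed.

Lemma dominated_integrableM f g : dominated f -> measurable_fun setT g ->
  (exists M, forall x, `|g x| <= M) ->
  mu.-integrable setT (EFin \o (fun x => f x * g x)).
Proof.
move=> df mg [M HM]; have fi := dominated_integrable df.
apply: (integrable_dom (g := fun x => M * `|f x|)).
- by apply: measurable_funM => //; case: df.
- exact: (integrableZl measurableT M (integrable_norm fi)).
- by move=> x; rewrite normrM mulrC ler_wpM2r.
Qed.

Definition bump_L2 : R := Num.sqrt (\int[mu]_x (bump x ^+ 2)).

Lemma integrable_bump2 : mu.-integrable setT (EFin \o (fun x => bump x ^+ 2)).
Proof.
apply: (integrable_dom _ (integrable_bump s0 lam0)).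
  by apply: measurable_funX; exact: measurable_bump.
move=> x; rewrite ger0_norm ?sqr_ge0// expr2 ler_piMr ?bump_ge0 ?bump_le1//.
Qed.

Lemma L2norm_le f C : measurable_fun setT f -> (forall x, `|f x| <= C * bump x) ->
  (L2norm f <= (C * bump_L2)%:E)%E.
Proof.
move=> mf HC; have C0 := dominated_cst_ge0 HC.
have I0 : 0 <= \int[mu]_x (bump x ^+ 2) by apply: Rintegral_ge0 => x _; exact: sqr_ge0.
rewrite /L2norm unlock.
have h : (\int[mu]_x (`|(EFin \o f) x| `^ 2) <= (C ^+ 2 * \int[mu]_x (bump x ^+ 2))%:E)%E.
  rewrite EFinM -RintegralE ?ge0_integralZlR ?sqr_ge0//; last exact: integrable_bump2.
  - apply: ge0_le_integral => //.
    + by move=> x _; exact: poweR_ge0.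
    + apply: (measurableT_comp (measurable_poweR _)) => //; apply: measurableT_comp => //.
      exact/measurable_EFinP.
    + apply/measurable_EFinP; apply: measurable_funM => //.
      by apply: measurable_funX; exact: measurable_bump.
    + move=> x _ /=; rewrite lee_fin powR_mulrn// -exprMn.
      apply: lerXn2r => //; rewrite nnegrE// mulr_ge0// bump_ge0//.
  - by apply: measurable_funX; exact: measurable_bump.
  - by move=> x; exact: sqr_ge0.
have -> : C * bump_L2 = (C ^+ 2 * \int[mu]_x (bump x ^+ 2)) `^ 2^-1.
  by rewrite powR12_sqrt ?mulr_ge0 ?sqr_ge0// sqrtrM ?sqr_ge0// sqrtr_sqr ger0_norm.
rewrite -poweR_EFin; apply: gt0_ler_poweR => //.
  by rewrite in_itv/= leey andbT integral_ge0// => x _; exact: poweR_ge0.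
by rewrite in_itv/= leey andbT lee_fin mulr_ge0 ?sqr_ge0.
Qed.

Lemma dominated_L2 f : dominated f -> L2 f.
Proof.
move=> [mf [C HC]]; rewrite /L2 /=; apply/andP; split; first by rewrite inE.
by rewrite inE/= /finite_norm (le_lt_trans (L2norm_le mf HC))// ltry.
Qed.

Lemma dominated_bump : dominated bump.
Proof.
by split; [exact: measurable_bump|exists 1 => x; rewrite mul1r ger0_norm// bump_ge0].
Qed.

Lemma dominated_dbump i : dominated (dbump i).
Proof.
by split; [exact: measurable_dbump|exists (2 * `|- @rexp R n s| * `|lam|) => x; exact: dbump_le].
Qed.

Lemma dominated_ddbump i j : dominated (ddbump i j).
Proof.
by split; [exact: measurable_ddbump|exists (@bump_cst R n s * lam ^+ 2) => x; exact: ddbump_le].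
Qed.

Lemma dominated_flap_bump : dominated (flap bump).
Proof.
split; first by apply: measurable_flap; exact: measurable_bump.
have [C [C0 HC]] := @flap_bump_le R n s s0 s2.
by exists (C * lam `^ s) => x; exact: HC.
Qed.

Lemma test_function_bounded psi l : test_function psi ->
  measurable_fun setT (partial l psi) /\ exists M, forall x, `|partial l psi x| <= M.
Proof.
move=> tp; have [C HC] := test_function_bracket s0 l tp.
have [sm _] := tp; split; first exact: measurable_partial.
have C0 : 0 <= C.
  rewrite -(pmulr_lge0 _ (bracket_gt0 s (0 : Rn))); exact: le_trans (HC 0).
by exists C => x; rewrite (le_trans (HC x))// ler_piMr// bracket_le1.
Qed.

Lemma test_function_integrable psi l : test_function psi ->
  mu.-integrable setT (EFin \o partial l psi).
Proof.
move=> tp; have [C HC] := test_function_bracket s0 l tp.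
have [sm _] := tp; apply: (integrable_dom (measurable_partial l sm) _ HC).
have ib : mu.-integrable setT (EFin \o @bracket R n s) by exact: integrable_bracket.
exact: (integrableZl measurableT C ib).
Qed.

Lemma is_partialZ c l u v : dominated u -> dominated v ->
  is_partial l u v -> is_partial l (fun x => c * u x) (fun x => c * v x).
Proof.
move=> du dv [_ H]; split; first exact/dominated_L2/dominatedZ.
move=> psi tp; have [m0 b0] := test_function_bounded [::] tp.
have [ml bl] := test_function_bounded l tp.
transitivity (c * \int[mu]_x (v x * psi x)).
  rewrite -RintegralZl//; last exact: dominated_integrableM.
  by apply: eq_Rintegral => x _; rewrite mulrA.
rewrite H// mulrCA; congr (_ * _); rewrite -RintegralZl//; last exact: dominated_integrableM.
by apply: eq_Rintegral => x _; rewrite mulrA.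
Qed.

Lemma is_fraclapZ c u v : dominated u -> dominated v ->
  is_fraclap (s / 2) u v -> is_fraclap (s / 2) (fun x => c * u x) (fun x => c * v x).
Proof.
move=> du dv [_ H]; split; first exact/dominated_L2/dominatedZ.
move=> psi sp; have rp := regular_schwartz s0 s2 sp.
have [mp _ [M [pM _]]] := rp.
have E : fraclap_schwartz (s / 2) psi = flap psi.
  by apply/funext => x; exact: fraclap_schwartzE.
have ml := measurable_flap s mp; have bl := flap_bounded s0 s2 rp.
rewrite E; have := H psi sp; rewrite E => H'.
transitivity (c * \int[mu]_x (v x * psi x)).
  rewrite -RintegralZl//; last by apply: dominated_integrableM => //; exists M.
  by apply: eq_Rintegral => x _; rewrite mulrA.
rewrite H' -RintegralZl//; last exact: dominated_integrableM.
by apply: eq_Rintegral => x _; rewrite mulrA.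
Qed.

Lemma is_fraclap_bump : is_fraclap (s / 2) bump (flap bump).
Proof.
split; first exact/dominated_L2/dominated_flap_bump.
move=> psi sp; have rp := regular_schwartz s0 s2 sp.
rewrite flap_symmetric//; last exact: regular_bump.
by apply: eq_Rintegral => x _; rewrite fraclap_schwartzE.
Qed.

Lemma dominated_bounded f : dominated f -> exists M, forall x, `|f x| <= M.
Proof.
move=> [_ [C HC]]; exists C => x; rewrite (le_trans (HC x))//.
by rewrite ler_piMr ?bump_le1// (dominated_cst_ge0 HC).
Qed.

(** The decay of the profile and its derivatives makes up for their lack of compact
    support. *)
Lemma dominated_by_parts i f df psi l : dominated f -> dominated df ->
  has_partial i f df -> test_function psi ->
  \int[mu]_x (df x * partial l psi x) = - \int[mu]_x (f x * partial (i :: l) psi x).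
Proof.
move=> Hf Hdf D tp; have [sm _] := tp.
have [ml _] := test_function_bounded l tp; have [_ bl] := test_function_bounded (i :: l) tp.
apply: (integral_by_parts (i := i)) => //.
- by case: Hf.
- exact: dominated_integrable.
- exact: test_function_integrable.
- exact: smooth_has_partial.
- exact: dominated_bounded.
- exact: dominated_bounded.
Qed.

Lemma is_partial_bump1 i : is_partial [:: i] bump (dbump i).
Proof.
split; first exact/dominated_L2/dominated_dbump.
move=> psi tp; rewrite expr1 mulN1r.
exact: (dominated_by_parts [::] dominated_bump (dominated_dbump i) (has_partial_bump s lam i)).
Qed.

Lemma is_partial_bump2 i j : is_partial [:: i; j] bump (ddbump i j).
Proof.
split; first exact/dominated_L2/dominated_ddbump.
move=> psi tp; rewrite /= expr2 mulrNN !mul1r.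
have H := dominated_by_parts [::] (dominated_dbump i) (dominated_ddbump i j)
  (has_partial_dbump s lam i j) tp.
have H1 := dominated_by_parts [:: j] dominated_bump (dominated_dbump i)
  (has_partial_bump s lam i) tp.
by rewrite [LHS]H H1 opprK.
Qed.

Lemma sobolev_bump c k : (k <= 2)%N -> sobolev k (fun x => c * bump x).
Proof.
move=> k2; split; first exact/dominated_L2/dominatedZ/dominated_bump.
move=> [|i [|j [|? l]]] /=; last by move=> /leq_trans /(_ k2).
- move=> _; exists (fun x => c * bump x); split; first exact/dominated_L2/dominatedZ/dominated_bump.
  by move=> psi _; rewrite expr0 mul1r.
- move=> _; exists (fun x => c * dbump i x); apply: is_partialZ.
  + exact: dominated_bump.
  + exact: dominated_dbump.
  + exact: is_partial_bump1.
- move=> _; exists (fun x => c * ddbump i j x); apply: is_partialZ.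
  + exact: dominated_bump.
  + exact: dominated_ddbump.
  + exact: is_partial_bump2.
Qed.

Lemma is_fraclap_bumpZ c : is_fraclap (s / 2) (fun x => c * bump x) (fun x => c * flap bump x).
Proof.
apply: is_fraclapZ; [exact: dominated_bump|exact: dominated_flap_bump|exact: is_fraclap_bump].
Qed.

Lemma Hspace_bump c : Hspace s (fun x => c * bump x).
Proof.
have w : exists w, is_fraclap (s / 2) (fun x => c * bump x) w.
  by exists (fun x => c * flap bump x); exact: is_fraclap_bumpZ.
rewrite /Hspace /=; case: ifP => _.
  by split => //; exact/dominated_L2/dominatedZ/dominated_bump.
by case: ifP => _; [|split => //]; exact: sobolev_bump.
Qed.

(** The curves below stay on the line spanned by the profile. There, continuity and
    differentiability for any of the norms follow from this bound by the coefficient,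
    and an upper bound is easily obtained for norms defined as infima. *)
Definition homogeneous_norm (N : (Rn -> R) -> \bar R) : Prop :=
  exists K, forall c, (0 <= N (fun x => c * bump x)%R)%E /\
    (N (fun x => c * bump x)%R <= (`|c| * K)%:E)%E.

Lemma L2norm_ge0 f : (0 <= L2norm f)%E.
Proof. exact: Lnorm_ge0. Qed.

Lemma L2norm_dominatedZ f : dominated f -> exists K, forall c,
  (L2norm (fun x => c * f x)%R <= (`|c| * K)%:E)%E.
Proof.
move=> [mf [C HC]]; exists (C * bump_L2) => c; rewrite mulrA; apply: L2norm_le.
  exact: measurable_funM.
by move=> x; rewrite normrM -mulrA ler_wpM2l.
Qed.

Lemma homogeneous_L2norm : homogeneous_norm (@L2norm R n).
Proof.
have [K HK] := L2norm_dominatedZ dominated_bump.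
by exists K => c; split => //; exact: L2norm_ge0.
Qed.

Lemma homogeneousD N1 N2 : homogeneous_norm N1 -> homogeneous_norm N2 ->
  homogeneous_norm (fun f => N1 f + N2 f)%E.
Proof.
move=> [K1 H1] [K2 H2]; exists (K1 + K2) => c.
have [a1 b1] := H1 c; have [a2 b2] := H2 c.
by rewrite adde_ge0// mulrDr EFinD leeD.
Qed.

Lemma homogeneous_sum (N : 'I_n -> (Rn -> R) -> \bar R) :
  (forall i, homogeneous_norm (N i)) -> homogeneous_norm (fun f => \sum_i N i f)%E.
Proof.
move=> /choice[K HK]; exists (\sum_i K i) => c; split.
  by apply: sume_ge0 => i _; exact: (HK i c).1.
rewrite mulr_sumr -sumEFin; apply: lee_sum => i _; exact: (HK i c).2.
Qed.

(** One representative, scaled along with the coefficient, bounds the infimum. *)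
Lemma homogeneous_inf (P : (Rn -> R) -> (Rn -> R) -> Prop) w : dominated w ->
  (forall c, P (fun x => c * bump x) (fun x => c * w x)) ->
  homogeneous_norm (fun f => ereal_inf [set L2norm v | v in P f]).
Proof.
move=> dw HP; have [K HK] := L2norm_dominatedZ dw; exists K => c; split.
  by apply: le_ereal_inf_tmp => _ [v _ <-]; exact: L2norm_ge0.
by apply: ge_ereal_inf; exists (L2norm (fun x => c * w x)) => //; exists (fun x => c * w x).
Qed.

Lemma homogeneous_fraclap : homogeneous_norm (norm_fraclap (s / 2)).
Proof. exact: (homogeneous_inf dominated_flap_bump is_fraclap_bumpZ). Qed.

Lemma homogeneous_partial1 i : homogeneous_norm (norm_partial [:: i]).
Proof.
apply: (homogeneous_inf (dominated_dbump i)) => c.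
by apply: is_partialZ; [exact: dominated_bump|exact: dominated_dbump|exact: is_partial_bump1].
Qed.

Lemma homogeneous_partial2 i j : homogeneous_norm (norm_partial [:: i; j]).
Proof.
apply: (homogeneous_inf (dominated_ddbump i j)) => c.
by apply: is_partialZ; [exact: dominated_bump|exact: dominated_ddbump|exact: is_partial_bump2].
Qed.

Lemma homogeneous_gradient : homogeneous_norm (@norm_gradient R n).
Proof.
pose D := 2 * `|- @rexp R n s| * `|lam|; pose C := Num.sqrt n%:R * D.
have D0 : 0 <= D by rewrite !mulr_ge0.
exists (C * bump_L2) => c; split.
  by apply: le_ereal_inf_tmp => _ [v _ <-]; exact: L2norm_ge0.
apply: ge_ereal_inf.
exists (L2norm (fun x => enorm (\row_i (c * dbump i x)))); last first.
  rewrite mulrA; apply: L2norm_le.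
    have -> : (fun x => enorm (\row_i (c * dbump i x))) =
       (fun x => sqn (\row_i (c * dbump i x)) `^ 2^-1) by apply/funext => x; exact: enormE.
    apply: measurable_powR_comp; apply: (measurableT_comp (@measurable_sqn R n)).
    apply: measurable_rowP => i; under eq_fun do rewrite mxE.
    by apply: measurable_funM => //; exact: measurable_dbump.
  move=> x; rewrite ger0_norm ?sqrtr_ge0//.
  have M0 : 0 <= `|c| * (D * bump x) by rewrite !mulr_ge0 ?bump_ge0.
  have -> : `|c| * C * bump x = Num.sqrt (n%:R * (`|c| * (D * bump x)) ^+ 2).
    by rewrite sqrtrM// sqrtr_sqr (ger0_norm M0) /C; ring.
  apply: ler_wsqrtr; apply: sqn_le => i; rewrite mxE normrM ler_wpM2l//.
  exact: dbump_le.
exists (fun i x => c * dbump i x) => // i; apply: is_partialZ.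
- exact: dominated_bump.
- exact: dominated_dbump.
- exact: is_partial_bump1.
Qed.

Lemma homogeneous_Hnorm : homogeneous_norm (Hnorm s).
Proof.
rewrite /Hnorm; case: (s < 1).
  exact: (homogeneousD homogeneous_L2norm homogeneous_fraclap).
case: (s == 1).
  exact: (homogeneousD homogeneous_L2norm homogeneous_gradient).
exact: (homogeneousD (homogeneousD homogeneous_L2norm homogeneous_gradient) homogeneous_fraclap).
Qed.

Lemma homogeneous_H2norm : homogeneous_norm (@H2norm R n).
Proof.
apply: homogeneousD; first apply: homogeneousD.
- exact: homogeneous_L2norm.
- by apply: homogeneous_sum => i; exact: homogeneous_partial1.
- by apply: homogeneous_sum => i; apply: homogeneous_sum => j; exact: homogeneous_partial2.
Qed.

End dominated.

Section tensor_curve.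
Context {R : realType} {n : nat}.
Local Notation Rn := 'rV[R]_n.
Variables (s lam : R).
Hypotheses (s0 : 0 < s) (s2 : s < 2) (lam0 : 0 < lam).
Local Notation bump := (@bump R n s lam).
Local Notation ddbump := (@ddbump R n s lam).

Lemma homogeneous_norm_cvg0 (N : (Rn -> R) -> \bar R) (F : set_system R)
    {FF : Filter F} (c : R -> R) :
  homogeneous_norm s lam N -> c @ F --> 0 ->
  N (fun x => c t * bump x)%R @[t --> F] --> 0%E.
Proof.
move=> [K HK] cF.
have cK : (`|c t| * K)%:E @[t --> F] --> 0%E.
  apply: cvg_EFin; first exact: nearW.
  rewrite -(mul0r K); apply: cvgMl; rewrite -(normr0 R); exact: cvg_norm.
apply: (squeeze_cvge _ (cvg_cst _) cK).
by apply: nearW => t; have [-> ->] := HK (c t).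
Qed.

Lemma continuous_curve_tensor (S : set (Rn -> R)) N (eta : R -> R) :
  homogeneous_norm s lam N -> (forall c, S (fun x => c * bump x)) -> continuous eta ->
  continuous_curve S N (fun t x => eta t * bump x).
Proof.
move=> HN HS ceta t t0; split; first exact: HS.
have -> : (fun s => N ((fun x => eta s * bump x) \- (fun x => eta t * bump x))) =
    (fun s => N (fun x => (eta s - eta t) * bump x)).
  by apply/funext => u; congr N; apply/funext => x /=; rewrite mulrBl.
apply: (homogeneous_norm_cvg0 HN).
have C : (eta u - eta t) @[u --> t] --> 0.
  by rewrite -(subrr (eta t)); apply: cvgB; [exact: ceta|exact: cvg_cst].
move=> A /C; rewrite !nbhs_simpl /= => H.
by apply: filterS H => u Au _.
Qed.

Lemma derivative_curve_tensor N (eta eta' : R -> R) :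
  homogeneous_norm s lam N -> (forall t : R, is_derive t (1 : R) eta (eta' t)) ->
  derivative_curve N (fun t x => eta t * bump x) (fun t x => eta' t * bump x).
Proof.
move=> HN Heta t t0.
have -> : (fun s => N (fun x => (eta s * bump x - eta t * bump x) / (s - t) - eta' t * bump x)) =
    (fun s => N (fun x => ((eta s - eta t) / (s - t) - eta' t) * bump x)).
  by apply/funext => u; congr N; apply/funext => x /=; ring.
apply: (homogeneous_norm_cvg0 HN).
have [D E] := Heta t.
rewrite -(subrr (eta' t)); apply: cvgB; last exact: cvg_cst.
have C : h^-1 *: ((eta \o shift t) (h *: (1 : R)) - eta t) @[h --> 0^'] --> eta' t.
  by rewrite -E; exact: D.
move=> A /C; rewrite !nbhs_simpl /= => /nbhs_ballP[eps /= e0 He].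
apply/nbhs_ballP; exists eps => // u ut ut' _.
have := He (u - t); rewrite /= scale_one subrK mulrC.
apply; last by rewrite subr_eq0.
by move: ut; rewrite /ball /= sub0r normrN distrC.
Qed.

Lemma jointly_measurable_tensor D (eta : R -> R) (f : Rn -> R) :
  measurable_fun setT eta -> measurable_fun setT f ->
  jointly_measurable D (fun t x => eta t * f x).
Proof.
move=> me mf; apply: measurable_funTS.
apply: measurable_funM; [exact: (measurableT_comp me)|exact: (measurableT_comp mf)].
Qed.

(** The spatial profile is fixed, so the regularity of the curve is that of the
    scalar coefficient [eta]; the support condition only concerns time. *)
Lemma test_curve_tensor (T : R) (eta eta1 eta2 : R -> R) :
  (forall t : R, is_derive t (1 : R) eta (eta1 t)) ->
  (forall t : R, is_derive t (1 : R) eta1 (eta2 t)) -> continuous eta2 ->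
  (forall t, T < t -> eta t = 0) ->
  test_curve s T (fun t x => eta t * bump x) (fun t x => eta1 t * bump x)
    (fun t x => eta2 t * bump x) (fun t x => eta t * \sum_i ddbump i i x).
Proof.
move=> D1 D2 c2 eT.
have c0 : continuous eta.
  move=> t; apply: differentiable_continuous; apply/derivable1_diffP.
  by have [] := D1 t.
have c1 : continuous eta1.
  move=> t; apply: differentiable_continuous; apply/derivable1_diffP.
  by have [] := D2 t.
have m0 := continuous_measurable_fun c0.
have m2 := continuous_measurable_fun c2.
split.
- apply: continuous_curve_tensor => //; first exact: homogeneous_H2norm.
  by move=> c; exact: sobolev_bump.
- by apply: derivative_curve_tensor => //; exact: homogeneous_Hnorm.
- apply: continuous_curve_tensor => //; first exact: homogeneous_Hnorm.
  by move=> c; exact: Hspace_bump.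
- apply: continuous_curve_tensor => //; first exact: homogeneous_Hnorm.
  by move=> c; exact: Hspace_bump.
- by apply: derivative_curve_tensor => //; exact: homogeneous_L2norm.
- apply: continuous_curve_tensor => //; first exact: homogeneous_L2norm.
  by move=> c; apply: (dominated_L2 s0 lam0); apply: dominatedZ; exact: dominated_bump.
- by move=> t Tt; apply: aeW => x; rewrite eT// mul0r.
- move=> t t0; exists (fun i x => eta t * ddbump i i x); split.
    move=> i; apply: (is_partialZ s0 lam0).
    + exact: dominated_bump.
    + exact: dominated_ddbump.
    + exact: is_partial_bump2.
  by apply/funext => x; rewrite mulr_sumr.
- by apply: jointly_measurable_tensor => //; exact: measurable_bump.
- by apply: jointly_measurable_tensor => //; exact: measurable_bump.
- apply: jointly_measurable_tensor => //; apply: measurable_sum => i.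
  exact: measurable_ddbump.
Qed.

End tensor_curve.

(** * The cut-off in time *)

Section cutoff.
Context {R : realType}.
Implicit Types (t h y C : R) (k m : nat).

Lemma is_derive_quadratic_bound (f : R -> R) t d :
  (forall h, `|f (h + t) - f t - h * d| <= h ^+ 2) -> is_derive t (1 : R) f d.
Proof.
move=> H.
have C : h^-1 *: ((f \o shift t) (h *: (1 : R)) - f t) @[h --> 0^'] --> d.
  apply/cvgrPdist_le => eps eps0; near=> h.
  have h0 : h != 0 by near: h; exact: nbhs_dnbhs_neq.
  have he : `|h| <= eps by near: h; apply: dnbhs0_le.
  rewrite /= scale_one.
  have -> : d - h^-1 *: (f (h + t) - f t) = - (h^-1 * (f (h + t) - f t - h * d)).
    by rewrite /GRing.scale /=; field.
  rewrite normrN normrM normfV ler_pdivrMl ?normr_gt0//.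
  apply: le_trans (H h) _; rewrite -real_normK ?num_real// expr2.
  by rewrite ler_wpM2l.
by split; [apply/cvg_ex; exists d|exact: cvg_lim].
Unshelve. all: by end_near.
Qed.

(** Truncated powers: gluing by powers of order at least 3 is C^2, which is all that
    test curves ask for. *)
Definition pospow k t : R := Num.max 0 t ^+ k.

Lemma pospow_ge0 k t : 0 <= pospow k t.
Proof. by rewrite exprn_ge0// le_max lexx. Qed.

Lemma pospow_le0 k t : t <= 0 -> pospow k.+1 t = 0.
Proof. by move=> t0; rewrite /pospow max_l// expr0n. Qed.

Lemma pospow_ge0E k t : 0 <= t -> pospow k t = t ^+ k.
Proof. by move=> t0; rewrite /pospow max_r. Qed.

Lemma is_derive_pospow2 t : is_derive t (1 : R) (pospow 2) (2 * pospow 1 t).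
Proof.
apply: is_derive_quadratic_bound => h; rewrite /pospow expr1.
have [t0|t0] := leP 0 t; have [a0|a0] := leP 0 (h + t).
- have -> : (h + t) ^+ 2 - t ^+ 2 - h * (2 * t) = h ^+ 2 by ring.
  by rewrite ger0_norm ?sqr_ge0.
- rewrite expr0n/= ler_norml; apply/andP; split; nra.
- rewrite expr0n/= ler_norml; apply/andP; split; nra.
- by rewrite !expr0n/= !mulr0 !subr0 normr0 sqr_ge0.
Qed.

Lemma is_derive_pospow k t : is_derive t (1 : R) (pospow k.+2) (k.+2%:R * pospow k.+1 t).
Proof.
elim: k t => [|k IH] t; first exact: is_derive_pospow2.
have := is_deriveM (is_derive_id t (1 : R)) (IH t).
have -> : id * pospow k.+2 = pospow k.+3.
  apply/funext => v; change (v * pospow k.+2 v = pospow k.+3 v).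
  have [v0|v0] := leP 0 v; first by rewrite !pospow_ge0E// [RHS]exprS.
  by rewrite !pospow_le0 ?(ltW v0)// mulr0.
rewrite scale_one.
rewrite (_ : _ + _ = k.+3%:R * pospow k.+2 t)//.
have [t0|t0] := leP 0 t; last by rewrite !pospow_le0 ?ltW// !mulr0 scaler0 addr0.
rewrite !pospow_ge0E// /GRing.scale /= -[k.+3%:R]natr1 !exprS; ring.
Qed.

Lemma continuous_pospow k : continuous (pospow k).
Proof.
move=> t; have cm : Num.max 0 v @[v --> t] --> Num.max 0 t.
  by apply: (@continuous_max _ _ (cst (0 : R)) id); [exact: cvg_cst|exact: cvg_id].
exact: (cvg_comp _ _ cm (@exprn_continuous R k _)).
Qed.

Section profile.
Variable m : nat.

Let u t : R := 2 * t - 1.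
Let w t : R := 1 - pospow 3 (u t).

(** Equal to 1 for t <= 1/2 and to 0 for t >= 1. The inner cubic power makes it C^2; the
    outer power m + 4 makes its derivatives small where it is small. *)
Definition eta t : R := pospow m.+4 (w t).
Definition eta1 t : R := m.+4%:R * pospow m.+3 (w t) * (- 6 * pospow 2 (u t)).
Definition eta2 t : R := m.+4%:R * (m.+3%:R * pospow m.+2 (w t) * (- 6 * pospow 2 (u t)) *
  (- 6 * pospow 2 (u t)) + pospow m.+3 (w t) * (- 24 * pospow 1 (u t))).

Let du t : is_derive t (1 : R) u 2.
Proof.
have := is_deriveD (is_deriveZ 2 (is_derive_id t (1 : R))) (is_derive_cst (-1 : R) t (1 : R)).
by rewrite addr0 (_ : 2 *: (1 : R) = 2)//; exact: mulr1.
Qed.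

Let dw t : is_derive t (1 : R) w (- 6 * pospow 2 (u t)).
Proof.
have H := is_deriveB (is_derive_cst (1 : R) t (1 : R)) (is_derive1_comp (is_derive_pospow 1 (u t)) (du t)).
have E : 0 - 3 * pospow 2 (u t) * 2 = - 6 * pospow 2 (u t) by ring.
by rewrite -E.
Qed.

Lemma is_derive_eta t : is_derive t (1 : R) eta (eta1 t).
Proof. exact: (is_derive1_comp (is_derive_pospow m.+2 (w t)) (dw t)). Qed.

Lemma is_derive_eta1 t : is_derive t (1 : R) eta1 (eta2 t).
Proof.
have d1 := is_derive1_comp (is_derive_pospow m.+1 (w t)) (dw t).
have d2 := is_deriveZ (- 6) (is_derive1_comp (is_derive_pospow 0 (u t)) (du t)).
have := is_deriveZ m.+4%:R (is_deriveM d1 d2).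
rewrite (_ : _ *: _ = eta2 t); last first.
  change (m.+4%:R * (pospow m.+3 (w t) * (- 6 * (2 * pospow 1 (u t) * 2)) +
    (- 6 * pospow 2 (u t)) * (m.+3%:R * pospow m.+2 (w t) * (- 6 * pospow 2 (u t)))) = eta2 t).
  by rewrite /eta2; ring.
rewrite (_ : _ \*: _ = eta1)//; apply/funext => v.
by rewrite /eta1 -mulrA.
Qed.

Let cu : continuous u.
Proof. by move=> t; apply: cvgB; [apply: cvgMr; exact: cvg_id|exact: cvg_cst]. Qed.

Let cw : continuous w.
Proof.
move=> t; apply: cvgB; first exact: cvg_cst.
exact: (cvg_comp _ _ (@cu t) (@continuous_pospow 3 _)).
Qed.

Lemma continuous_eta2 : continuous eta2.
Proof.
have cc k (v : R -> R) : continuous v -> continuous (fun t => pospow k (v t)).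
  by move=> cv t; exact: (cvg_comp _ _ (cv t) (@continuous_pospow k _)).
have cM (f g : R -> R) : continuous f -> continuous g -> continuous (fun t => f t * g t).
  by move=> cf cg t; apply: cvgM; [exact: cf|exact: cg].
have cD (f g : R -> R) : continuous f -> continuous g -> continuous (fun t => f t + g t).
  by move=> cf cg t; apply: cvgD; [exact: cf|exact: cg].
have ccst (a : R) : continuous (fun _ : R => a) by move=> t; exact: cvg_cst.
have c6 : continuous (fun t => - 6 * pospow 2 (u t)) by apply: (cM) => //; exact: cc.
apply: (cM) => //; apply: (cD).
  by apply: (cM _ _ _ c6); apply: (cM _ _ _ c6); apply: (cM) => //; exact: cc.
by apply: (cM); [exact: cc|apply: (cM) => //; exact: cc].
Qed.

Lemma eta_ge0 t : 0 <= eta t. Proof. exact: pospow_ge0. Qed.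

Let maxw01 t : 0 <= Num.max 0 (w t) <= 1.
Proof.
rewrite le_max lexx/= ge_max ler01/= /w gerBl pospow_ge0//.
Qed.

Lemma eta_le1 t : eta t <= 1.
Proof. by have /andP[h1 h2] := maxw01 t; exact: exprn_ile1. Qed.

Lemma eta_small t : t <= 2^-1 -> [/\ eta t = 1, eta1 t = 0 & eta2 t = 0].
Proof.
move=> t2; have ut : u t <= 0 by rewrite /u; lra.
split.
- by rewrite /eta /w (pospow_le0 2 ut) subr0 /pospow max_r// expr1n.
- by rewrite /eta1 (pospow_le0 1 ut) !mulr0.
- by rewrite /eta2 (pospow_le0 1 ut) (pospow_le0 0 ut) !mulr0 addr0 mulr0.
Qed.

Lemma eta_large t : 1 <= t -> eta t = 0.
Proof.
move=> t1; rewrite /eta pospow_le0// /w subr_le0 pospow_ge0E /u; last by lra.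
by rewrite exprn_ege1//; lra.
Qed.

Let bound_u k t : w t > 0 -> pospow k (u t) <= 1.
Proof.
rewrite /w subr_gt0 /pospow => h; apply: exprn_ile1; first by rewrite le_max lexx.
by rewrite leNgt; apply/negP => h1; move: h; rewrite ltNge exprn_ege1// ltW.
Qed.

Definition eta_cst : R := m.+4%:R * (36 * m.+3%:R + 24).

Lemma eta_cst_ge0 : 0 <= eta_cst.
Proof. by rewrite mulr_ge0// addr_ge0// mulr_ge0. Qed.

(** Two derivatives leave the power m + 2 of the inner function, and m + 2 >= (m + 4) / p
    holds as soon as m + 4 >= 2 p / (p - 1). *)
Let key p t : 1 < p -> m.+4%:R >= 2 * p / (p - 1) ->
  pospow m.+2 (w t) <= eta t `^ p^-1.
Proof.
move=> p1 mp; have p0 : 0 < p by exact: lt_trans p1.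
have pp : 0 < p - 1 by rewrite subr_gt0.
have /andP[h0 h1] := maxw01 t.
rewrite /eta /pospow -!powR_mulrn// -powRrM.
have [->|W0] := eqVneq (Num.max 0 (w t)) 0.
  by rewrite !powR0// mulf_neq0// ?invr_neq0// gt_eqF.
apply: ger_powR; first by rewrite lt_def W0 h0.
rewrite ler_pdivrMr//; move: mp; rewrite ler_pdivrMr// -[m.+4]addn2 natrD.
rewrite -[in X in X -> _]subr_ge0 -[in X in _ -> X]subr_ge0 => mp.
by rewrite (_ : _ - _ = (m.+2%:R + 2%:R) * (p - 1) - 2 * p)//; ring.
Qed.

(** The estimate that makes Young's inequality applicable: a derivative of the cut-off
    costs only the power 1/p of the cut-off. *)
Lemma eta1_le p t : 1 < p -> m.+4%:R >= 2 * p / (p - 1) ->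
  `|eta1 t| <= eta_cst * eta t `^ p^-1.
Proof.
move=> p1 mp; have K := key t p1 mp; have /andP[h0 h1] := maxw01 t.
have [w0|w0] := leP (w t) 0.
  by rewrite /eta1 pospow_le0// mulr0 mul0r normr0 mulr_ge0 ?eta_cst_ge0 ?powR_ge0.
apply: (@le_trans _ _ (eta_cst * pospow m.+2 (w t))); last by rewrite ler_wpM2l ?eta_cst_ge0.
have b2 := bound_u 2 w0; have b0 := pospow_ge0 2 (u t).
have c1 : pospow m.+3 (w t) <= pospow m.+2 (w t).
  by rewrite /pospow exprS ler_piMl ?exprn_ge0.
have c0 := pospow_ge0 m.+3 (w t).
have n0 : 0 <= m.+3%:R :> R by [].
rewrite /eta1 /eta_cst.
move: (pospow 2 _) (pospow m.+3 _) (pospow m.+2 _) (m.+3%:R : R)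
  b0 b2 c0 c1 n0 (pospow_ge0 m.+2 (w t)) => a c W N b0 b2 c0 c1 n0 W0.
have -> : m.+4%:R * c * (- 6 * a) = - (m.+4%:R * (6 * (a * c))) by ring.
rewrite normrN ger0_norm ?mulr_ge0// -[leRHS]mulrA ler_wpM2l//.
apply: (@le_trans _ _ (6 * W)).
  by rewrite ler_wpM2l// (le_trans _ c1)// ler_piMl.
by rewrite ler_wpM2r//; lra.
Qed.

Lemma eta2_le p t : 1 < p -> m.+4%:R >= 2 * p / (p - 1) ->
  `|eta2 t| <= eta_cst * eta t `^ p^-1.
Proof.
move=> p1 mp; have K := key t p1 mp; have /andP[h0 h1] := maxw01 t.
have [w0|w0] := leP (w t) 0.
  by rewrite /eta2 (pospow_le0 m.+1 w0) (pospow_le0 m.+2 w0) mulr0 !mul0r addr0 mulr0 normr0 mulr_ge0 ?eta_cst_ge0 ?powR_ge0.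
apply: (@le_trans _ _ (eta_cst * pospow m.+2 (w t))); last by rewrite ler_wpM2l ?eta_cst_ge0.
have b2 := bound_u 2 w0; have b0 := pospow_ge0 2 (u t).
have b1 := bound_u 1 w0; have b3 := pospow_ge0 1 (u t).
have c1 : pospow m.+3 (w t) <= pospow m.+2 (w t).
  by rewrite /pospow exprS ler_piMl ?exprn_ge0.
have c0 := pospow_ge0 m.+3 (w t).
rewrite /eta2 /eta_cst normrM ger0_norm// -[leRHS]mulrA ler_wpM2l//.
rewrite (le_trans (ler_normD _ _))// [leRHS]mulrDl.
have n0 : 0 <= m.+3%:R :> R by [].
move: (pospow 2 _) (pospow 1 _) (pospow m.+3 _) (pospow m.+2 _) (m.+3%:R : R)
  b0 b1 b2 b3 c0 c1 n0 (pospow_ge0 m.+2 (w t)) => a b c W N b0 b1 b2 b3 c0 c1 n0 W0.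
apply: lerD.
  have -> : N * W * (- 6 * a) * (- 6 * a) = 36 * N * (a * a * W) by ring.
  have aa : a * a <= 1 by rewrite -[leRHS]mulr1 ler_pM.
  rewrite ger0_norm ?mulr_ge0// ler_wpM2l ?mulr_ge0//.
  by rewrite ler_piMl.
have -> : c * (- 24 * b) = - (24 * (b * c)) by ring.
rewrite normrN ger0_norm ?mulr_ge0// ler_wpM2l//.
by rewrite (le_trans _ c1)// ler_piMl.
Qed.

End profile.
End cutoff.

(** * Young's inequality, a time integral and iterated integrals *)

Section real_inequalities.
Context {R : realType}.
Implicit Types a b A p x : R.

(** If b <= A a^(p-1), the first term alone bounds a b; otherwise a is smaller than
    (b / A)^(1/(p-1)) and the second term does. *)
Lemma young_powR a b A p : 1 < p -> 0 <= a -> 0 <= b -> 0 < A ->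
  a * b <= A * a `^ p + A `^ (1 - p / (p - 1)) * b `^ (p / (p - 1)).
Proof.
move=> p1 a0 b0 A0; have p0 : 0 < p - 1 by rewrite subr_gt0.
have pp : 0 < p by exact: lt_trans p1.
(* The threshold at which A a^p equals a b. *)
have [h|h] := leP b (A * a `^ (p - 1)).
  apply: (@le_trans _ _ (A * a `^ p)); last by rewrite lerDl mulr_ge0 ?powR_ge0.
  apply: le_trans (ler_wpM2l a0 h) _.
  by rewrite mulrCA mulr_powRB1.
apply: (@le_trans _ _ (A `^ (1 - p / (p - 1)) * b `^ (p / (p - 1)))); last first.
  by rewrite lerDr mulr_ge0 ?powR_ge0 ?(ltW A0).
have qE : p / (p - 1) = 1 + (p - 1)^-1 by field; rewrite gt_eqF.
have b1 : 0 < b by apply: le_lt_trans h; rewrite mulr_ge0 ?powR_ge0 ?(ltW A0).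
have q0 : 0 < (p - 1)^-1 by rewrite invr_gt0.
rewrite qE opprD addrA subrr add0r.
rewrite [b `^ _]powRD; last by rewrite (gt_eqF b1) implybT.
rewrite powRr1// mulrCA [leLHS]mulrC ler_wpM2l//.
have : A `^ (- (p - 1)^-1) * (A * a `^ (p - 1)) `^ (p - 1)^-1 = a.
  rewrite powRM ?powR_ge0 ?(ltW A0)// mulrA -powRD; last by rewrite (gt_eqF A0) implybT.
  by rewrite addNr powRr0 mul1r -powRrM divff ?powRr1// gt_eqF.
move=> <-; rewrite ler_wpM2l ?powR_ge0//; apply: ge0_ler_powR (ltW h).
- exact: ltW.
- by rewrite nnegrE mulr_ge0 ?powR_ge0 ?(ltW A0).
- by rewrite nnegrE ltW.
Qed.

Lemma powR_small (B q eps : R) : 0 <= B -> 0 < q -> 0 < eps ->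
  exists2 x : R, 1 <= x & B * x `^ (- q) < eps.
Proof.
move=> B0 q0 e0; pose y := B / eps + 1.
have y1 : 1 <= y by rewrite lerDr divr_ge0// ltW.
have y0 : 0 < y by exact: lt_le_trans y1.
exists (y `^ q^-1).
  rewrite -(one_powR q^-1); apply: ge0_ler_powR => //; rewrite ?nnegrE ?invr_ge0 ?ltW//.
rewrite -powRrM mulrN mulVf ?gt_eqF// powR_inv1 ?ltW// ltr_pdivrMr//.
by rewrite mulrDr mulr1 mulrCA divff ?gt_eqF// mulr1 ltrDl.
Qed.

Lemma integral_powR_le (S delta : R) : 0 < S -> 0 < delta ->
  (\int[@lebesgue_measure R]_(t in `]0%R, S[) ((1 + t) `^ (delta - 1))%:E <=
    ((1 + S) `^ delta / delta)%:E)%E.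
Proof.
move=> S0 d0.
pose F t : R := delta^-1 * (1 + t) `^ delta.
have dF (t : R) : 0 <= t -> is_derive t (1 : R) F ((1 + t) `^ (delta - 1)).
  move=> t0; have t1 : 0 < 1 + t by rewrite ltr_pwDl.
  have d1 : is_derive t (1 : R) (fun t => 1 + t) 1.
    have := is_deriveD (is_derive_cst (1 : R) t (1 : R)) (is_derive_id t (1 : R)).
    by rewrite add0r.
  have := is_deriveZ delta^-1 (is_derive1_comp (is_derive1_powR delta t1) d1).
  by rewrite mulr1 /GRing.scale /= mulrA mulVf ?gt_eqF// mul1r.
have cF (t : R) : 0 <= t -> F x @[x --> t] --> F t.
  by move=> /dF[D _]; apply: differentiable_continuous; exact/derivable1_diffP.
have cf (a : R) : continuous_at a (fun x => (1 + x) `^ (delta - 1)) \/ a <= -1.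
  have [a1|a1] := leP a (- 1); [by right|left].
  have a0 : 0 < 1 + a by lra.
  apply: differentiable_continuous; apply/derivable1_diffP.
  have d1 : is_derive a (1 : R) (fun t => 1 + t) 1.
    have := is_deriveD (is_derive_cst (1 : R) a (1 : R)) (is_derive_id a (1 : R)).
    by rewrite add0r.
  by have [] := is_derive1_comp (is_derive1_powR (delta - 1) a0) d1.
have mf (D : set R) : measurable_fun D (fun t : R => (1 + t) `^ (delta - 1)).
  apply: measurable_funTS; apply: measurable_powR_comp.
  by apply: measurable_funD.
apply: (@le_trans _ _ (\int[@lebesgue_measure R]_(t in `[0%R, S]) ((1 + t) `^ (delta - 1))%:E)%E).
  apply: ge0_subset_integral => //.
  - by apply/measurable_EFinP; exact: mf.
  - by move=> t _; rewrite lee_fin powR_ge0.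
  - by apply: subset_itv; rewrite bnd_simp.
rewrite (@continuous_FTC2 _ _ F)//.
- rewrite -EFinB lee_fin /F mulrC gerBl mulr_ge0 ?powR_ge0// invr_ge0 ltW//.
- apply: continuous_in_subspaceT => t; rewrite inE/= in_itv/= => /andP[t0 _].
  by have [|] := cf t => //; lra.
- split.
  + by move=> t; rewrite in_itv/= => /andP[t0 _]; have [] := dF t (ltW t0).
  + by apply: cvg_at_right_filter; exact: cF.
  + by apply: cvg_at_left_filter; apply: cF; exact: ltW.
- move=> t; rewrite in_itv/= => /andP[t0 _]; rewrite derive1E.
  by have [_ ->] := dF t (ltW t0).
Qed.

End real_inequalities.

Section iterated.
Context d1 d2 (T1 : measurableType d1) (T2 : measurableType d2) (R : realType).
Variables (m1 : {sigma_finite_measure set T1 -> \bar R})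
  (m2 : {sigma_finite_measure set T2 -> \bar R}).

(** Fubini. The factor [theta] stands outside of the inner integral: it can be moved
    inside even at times where the section of [G] is not integrable if [theta]
    vanishes there, and at almost every other time the section is integrable. *)
Lemma iterated_integral (A : set T1) (theta : T1 -> R) (G : T1 * T2 -> R) :
  measurable A -> measurable_fun setT theta -> measurable_fun setT G ->
  (m1 \x m2)%E.-integrable (A `*` setT) (EFin \o (fun z => theta z.1 * G z)) ->
  \int[m1]_(t in A) (theta t * \int[m2]_x G (t, x)) =
  \int[(m1 \x m2)%E]_(z in A `*` setT) (theta z.1 * G z).
Proof.
move=> mA mth mG iG.
have mAT : measurable (A `*` [set: T2]) by exact: measurableX.
rewrite [LHS]Rintegral_mkcond [RHS]Rintegral_mkcond.
pose F := (fun z : T1 * T2 => theta z.1 * G z) \_ (A `*` setT).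
have iF : (m1 \x m2)%E.-integrable setT (EFin \o F).
  by rewrite /F -restrict_EFin; exact: (integrable_mkcond _ mAT).1 iG.
rewrite /Rintegral -(integral12_prod_meas1 iF); congr fine.
apply: ae_eq_integral => //.
- apply/measurable_EFinP; apply/(measurable_restrictT _ mA).
  apply: measurable_funTS; apply: measurable_funM => //.
  exact: measurable_Rintegral_section.
- exact: (measurable_fubini_F iF).
have := ae_integrable1 iF; apply: filterS => t it _.
rewrite -[fubini_F _ _ _]/(\int[m2]_y (F (t, y))%:E)%E /= patchE; case: ifPn => tA; last first.
  rewrite (eq_integral (cst 0)%E) ?integral0// => x _.
  by rewrite /F patchE memNset// => -[/= /mem_set]; rewrite (negbTE tA).
have E x : F (t, x) = theta t * G (t, x).
  by rewrite /F patchE mem_set//; split => //=; exact: set_mem.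
have -> : (\int[m2]_y (F (t, y))%:E = \int[m2]_y (theta t * G (t, y))%:E)%E.
  by apply: eq_integral => y _; rewrite E.
have [th0|th0] := eqVneq (theta t) 0.
  by rewrite th0 mul0r (eq_integral (cst 0)%E) ?integral0// => x _; rewrite mul0r.
have it' : m2.-integrable setT (EFin \o (fun x => G (t, x))).
  have := integrableZl measurableT (theta t)^-1 it.
  apply: eq_integrable => // x _; rewrite /= E -EFinM; congr EFin.
  by rewrite mulrA mulVf// mul1r.
rewrite EFinM -(RintegralE it') -integralZl//.
Qed.

End iterated.

(** * Integrability over slabs *)

Section spacetime.
Context {R : realType} {n : nat}.
Local Notation Rn := 'rV[R]_n.
Local Notation mu := (lebesgue_row R n).
Local Notation leb := (@lebesgue_measure R).
Local Notation mu2 := (leb \x mu)%E.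
Local Notation slab := (@slab R n).
Local Notation RRn := (measurableTypeR R * 'rV[R]_n)%type.

Lemma measurable_slab (T : R) : measurable (slab T : set RRn).
Proof. by apply: measurableX. Qed.

Lemma measurable_spatial (w : Rn -> R) : measurable_fun setT w ->
  measurable_fun setT (fun z : RRn => w z.2).
Proof. by move=> mw; exact: (measurableT_comp mw). Qed.

Lemma measurable_temporal (w : R -> R) : measurable_fun setT w ->
  measurable_fun setT (fun z : RRn => w z.1).
Proof. by move=> mw; exact: (measurableT_comp mw). Qed.

Section integrability.
Variables (s lam : R).
Hypotheses (s0 : 0 < s) (lam0 : 0 < lam).
Variable u : R -> Rn -> R.
Hypothesis mu_u : measurable_fun setT (fun z : RRn => u z.1 z.2).

(** Cauchy-Schwarz in space bounds the integral over a slice by the L^2 norm of [w] times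
    the q-th power of the L^(2q) norm of [u t], which is integrable in time. *)
Lemma Lbochner_integrable (T q : R) (w : Rn -> R) : 0 < q ->
  Lbochner T q (2 * q) u -> dominated s lam w ->
  mu2.-integrable (slab T) (EFin \o (fun z => `|u z.1 z.2| `^ q * w z.2)).
Proof.
move=> q0 [_ bo] dw; have [mw [C HC]] := dw.
pose F := (fun z : RRn => `|u z.1 z.2| `^ q * w z.2).
have mF : measurable_fun setT F.
  apply: measurable_funM; last exact: measurable_spatial.
  by apply: measurable_powR_comp; exact: measurableT_comp.
have mslab := measurable_slab T.
apply: (integrable_mkcond (EFin \o F) mslab).2; rewrite restrict_EFin.
have mFs : measurable_fun setT (EFin \o (F \_ (slab T))).
  by apply/measurable_EFinP; apply/(measurable_restrictT _ mslab); exact: measurable_funTS.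
apply/integrable12ltyP => //.
(* The q-th power of the L^(2q) norm of the slice. *)
pose N t := ((\int[mu]_x (`|u t x| `^ (2 * q))%:E) `^ 2^-1)%E.
have N0 t : (0 <= N t)%E by exact: poweR_ge0.
have mu2q : measurable_fun setT (fun z : RRn => (`|u z.1 z.2| `^ (2 * q))%:E).
  by apply/measurable_EFinP; apply: measurable_powR_comp; exact: measurableT_comp.
have mN : measurable_fun setT N.
  apply: (measurableT_comp (measurable_poweR _)).
  apply: (measurable_fun_fubini_tonelli_F (fun z : RRn => (`|u z.1 z.2| `^ (2 * q))%:E)) => //.
have NE t : ('N[mu]_(2 * q)%:E[EFin \o u t] `^ q = N t)%E.
  rewrite unlock /N -poweRrM; congr (_ `^ _)%E.
  by rewrite invfM -mulrA mulVf ?gt_eqF// mulr1.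
have ut t : measurable_fun setT (u t).
  exact: (measurableT_comp mu_u (pair1_measurable t)).
have W0 : (0 <= L2norm w)%E by exact: L2norm_ge0.
have Woo : (L2norm w < +oo)%E by rewrite (le_lt_trans (L2norm_le s0 lam0 mw HC))// ltry.
apply: (@le_lt_trans _ _ (\int[leb]_(t in `]0%R, T[) (N t * L2norm w))%E).
  rewrite [leRHS]integral_mkcond.
  apply: ge0_le_integral => //.
  - by move=> t _; exact: integral_ge0.
  - apply: (measurable_fun_fubini_tonelli_F (fun z => `|(EFin \o (F \_ (slab T))) z|%E)) => //.
    exact: measurableT_comp.
  - apply/(measurable_restrictT _ (measurable_itv _)); apply: measurable_funTS.
    exact: emeasurable_funM.
  - move=> t _; rewrite patchE; case: ifPn => tT; last first.
      rewrite (eq_integral (cst 0)%E) ?integral0// => x _.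
      rewrite /= patchE memNset => [|[/= tT' _]]; last by move: tT; rewrite mem_set.
      exact: (congr1 EFin (normr0 _)).
    have -> : (\int[mu]_x `|(EFin \o (F \_ (slab T))) (t, x)|)%E =
        ('N[mu]_1[EFin \o ((fun x => `|u t x| `^ q) \* w)%R])%E.
      rewrite Lnorm1; apply: eq_integral => x _ /=.
      by rewrite patchE mem_set//; split => //=; exact: set_mem.
    have -> : N t = ('N[mu]_2%:E[EFin \o (fun x => `|u t x| `^ q)%R])%E.
      rewrite unlock /N; congr (_ `^ _)%E; apply: eq_integral => x _ /=.
      by rewrite [`| _ `^ _|]ger0_norm ?powR_ge0// -powRrM mulrC.
    apply: hoelder => //.
    + by apply: measurable_powR_comp; exact: measurableT_comp.
    + by field.
have Noo : (\int[leb]_(t in `]0%R, T[) N t < +oo)%E.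
  by under eq_integral do rewrite -NE.
have NI0 : (0 <= \int[leb]_(t in `]0%R, T[) N t)%E by apply: integral_ge0 => t _; exact: N0.
rewrite ge0_integralZr//.
  by rewrite lte_mul_pinfty// ge0_fin_numE.
exact: measurable_funTS.
Qed.

End integrability.

End spacetime.

(** * The weak identity for the separated test function *)

Section identity.
Context {R : realType} {n : nat}.
Local Notation Rn := 'rV[R]_n.
Local Notation mu := (lebesgue_row R n).
Local Notation leb := (@lebesgue_measure R).
Local Notation mu2 := (leb \x mu)%E.
Local Notation slab := (@slab R n).
Local Notation RRn := (measurableTypeR R * 'rV[R]_n)%type.

(** A weak solution is only constrained at positive times. Its extension by zero is
    jointly measurable on the whole space-time and is still a solution; moreover
    integrals over slabs become integrals over space-time. *)
Definition positive_times (u : R -> Rn -> R) : R -> Rn -> R :=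
  fun t x => if 0 < t then u t x else 0.

Lemma positive_timesE u t : 0 < t -> positive_times u t = u t.
Proof. by move=> t0; apply/funext => x; rewrite /positive_times t0. Qed.

Lemma measurable_positive_times u :
  (forall T, 0 < T -> jointly_measurable `]0, T[ u) ->
  measurable_fun setT (fun z : RRn => positive_times u z.1 z.2).
Proof.
move=> H.
pose E k : set RRn := if k is k'.+1 then slab k'.+1%:R else `]-oo, 0%R] `*` setT.
have -> : setT = \bigcup_k E k.
  apply/seteqP; split=> // -[t x] _ /=.
  have [t0|t0] := leP t 0.
    by exists 0%N => //; split => //=; rewrite in_itv/= t0.
  exists (Num.truncn t).+1 => //; split => //=.
  by rewrite in_itv/= t0 Num.Theory.truncnS_gt.
apply/measurable_fun_bigcup.
  by move=> [|k]; [apply: measurableX|exact: measurable_slab].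
move=> [|k].
  apply: (eq_measurable_fun (fun _ : RRn => 0 : R)) => // -[t x].
  rewrite inE => -[/=]; rewrite in_itv/= => t0 _.
  by rewrite /positive_times ltNge t0.
apply: (eq_measurable_fun (fun z : RRn => u z.1 z.2)).
  move=> [t x]; rewrite inE => -[/=]; rewrite in_itv/= => /andP[t0 _] _.
  by rewrite positive_timesE.
exact: H.
Qed.

Lemma Lbochner_positive_times T q r u : Lbochner T q r u -> Lbochner T q r (positive_times u).
Proof.
move=> [mu_ bu]; split.
  apply: (eq_measurable_fun (fun z : RRn => u z.1 z.2)) mu_.
  move=> [t x]; rewrite inE => -[/=]; rewrite in_itv/= => /andP[t0 _] _.
  by rewrite positive_timesE.
apply: le_lt_trans bu; rewrite le_eqVlt; apply/orP; left; apply/eqP.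
by apply: eq_integral => t; rewrite inE/= in_itv/= => /andP[t0 _]; rewrite positive_timesE.
Qed.

Lemma weak_identity_positive_times beta p b0 u0 u1 T u f f1 f2 Df Lf Lf1 :
  weak_identity beta p b0 u0 u1 T u f f1 f2 Df Lf Lf1 ->
  weak_identity beta p b0 u0 u1 T (positive_times u) f f1 f2 Df Lf Lf1.
Proof.
rewrite /weak_identity => H.
have E (z : R * Rn) : z \in slab T -> positive_times u z.1 = u z.1.
  by rewrite inE => -[/=]; rewrite in_itv/= => /andP[t0 _] _; rewrite positive_timesE.
have E1 (t : R) : t \in `]0, T[%classic -> positive_times u t = u t.
  by rewrite inE/= in_itv/= => /andP[t0 _]; rewrite positive_timesE.
have -> : \int[mu2]_(z in slab T) (`|positive_times u z.1 z.2| `^ p * f z.1 z.2) =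
    \int[mu2]_(z in slab T) (`|u z.1 z.2| `^ p * f z.1 z.2).
  by apply: eq_Rintegral => z /E ->.
have -> : \int[mu2]_(z in slab T) (positive_times u z.1 z.2 * f2 z.1 z.2) =
    \int[mu2]_(z in slab T) (u z.1 z.2 * f2 z.1 z.2).
  by apply: eq_Rintegral => z /E ->.
have -> : \int[mu2]_(z in slab T) (positive_times u z.1 z.2 * Df z.1 z.2) =
    \int[mu2]_(z in slab T) (u z.1 z.2 * Df z.1 z.2).
  by apply: eq_Rintegral => z /E ->.
have EI (c : R -> R) (L : R -> Rn -> R) :
    \int[leb]_(t in `]0, T[) (c t * \int[mu]_x (positive_times u t x * L t x)) =
    \int[leb]_(t in `]0, T[) (c t * \int[mu]_x (u t x * L t x)).
  by apply: eq_Rintegral => t /E1 ->.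
by rewrite H !EI.
Qed.

Lemma global_weak_solution_positive_times sigma beta p b0 u0 u1 u :
  global_weak_solution sigma beta p b0 u0 u1 u ->
  global_weak_solution sigma beta p b0 u0 u1 (positive_times u).
Proof.
move=> H T T0; have [H1 H2 H3] := H T T0; split.
- exact: Lbochner_positive_times.
- exact: Lbochner_positive_times.
- by move=> *; apply: weak_identity_positive_times; apply: H3.
Qed.

Lemma powR_le_abs (x y a : R) : 1 <= x -> x <= y -> x `^ a <= y `^ `|a|.
Proof.
move=> x1 xy; apply: (@le_trans _ _ (x `^ `|a|)).
  by apply: ler_powR => //; exact: ler_norm.
by apply: ge0_ler_powR => //; rewrite nnegrE; lra.
Qed.

Section tested.
Variables (s lam beta p b0 S : R) (u0 u1 : Rn -> R) (u : R -> Rn -> R) (m : nat).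
Hypotheses (s0 : 0 < s) (s2 : s < 2) (lam0 : 0 < lam) (p1 : 1 < p) (S0 : 0 < S).
Hypothesis mu_u : measurable_fun setT (fun z : RRn => u z.1 z.2).
Hypothesis sol : weak_solution s beta p b0 u0 u1 S u.
Local Notation bump := (@bump R n s lam).
Local Notation ddbump := (@ddbump R n s lam).
Local Notation flap := (@flap R n s).

Definition time_cutoff t : R := eta m (S^-1 * t).
Definition time_cutoff1 t : R := S^-1 * eta1 m (S^-1 * t).
Definition time_cutoff2 t : R := S^-1 * (S^-1 * eta2 m (S^-1 * t)).

(** The adjoint of the linear operator of the equation, applied to the test function
    [time_cutoff t * bump x]. *)
Definition adjoint (z : RRn) : R :=
  time_cutoff2 z.1 * bump z.2
  - b0 / (1 + z.1) `^ beta * (time_cutoff1 z.1 * flap bump z.2)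
  - time_cutoff z.1 * (\sum_i ddbump i i z.2)
  + b0 * beta / (1 + z.1) `^ (beta + 1) * (time_cutoff z.1 * flap bump z.2).

Let scaled_deriv (f f' : R -> R) : (forall t : R, is_derive t (1 : R) f (f' t)) ->
  forall t : R, is_derive t (1 : R) (fun t => f (S^-1 * t)) (S^-1 * f' (S^-1 * t)).
Proof.
move=> df t.
have d1 : is_derive t (1 : R) (fun t => S^-1 * t) S^-1.
  by have := is_deriveZ S^-1 (is_derive_id t (1 : R)); rewrite /GRing.scale /= mulr1.
by have := is_derive1_comp (df (S^-1 * t)) d1; rewrite mulrC.
Qed.

Lemma is_derive_time_cutoff t : is_derive t (1 : R) time_cutoff (time_cutoff1 t).
Proof. exact: (scaled_deriv (is_derive_eta m)). Qed.

Lemma is_derive_time_cutoff1 t : is_derive t (1 : R) time_cutoff1 (time_cutoff2 t).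
Proof. exact: (is_deriveZ S^-1 (scaled_deriv (is_derive_eta1 m) t)). Qed.

Lemma continuous_time_cutoff2 : continuous time_cutoff2.
Proof.
move=> t; apply: cvgMr; apply: cvgMr.
apply: (cvg_comp (fun t : R => S^-1 * t) (eta2 m)); last exact: continuous_eta2.
by apply: cvgMr; exact: cvg_id.
Qed.

Let continuous_derive (f f' : R -> R) :
  (forall t : R, is_derive t (1 : R) f (f' t)) -> measurable_fun setT f.
Proof.
move=> df; apply: continuous_measurable_fun => t.
by apply: differentiable_continuous; apply/derivable1_diffP; have [] := df t.
Qed.

Lemma measurable_time_cutoff : measurable_fun setT time_cutoff.
Proof. exact: (continuous_derive is_derive_time_cutoff). Qed.

Lemma measurable_time_cutoff1 : measurable_fun setT time_cutoff1.
Proof. exact: (continuous_derive is_derive_time_cutoff1). Qed.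

Lemma measurable_time_cutoff2 : measurable_fun setT time_cutoff2.
Proof. exact: (continuous_measurable_fun continuous_time_cutoff2). Qed.

Lemma time_cutoff_large t : S <= t -> time_cutoff t = 0.
Proof.
by move=> St; apply: eta_large; rewrite mulrC ler_pdivlMr// mul1r.
Qed.

Lemma slab_integrable_weight (q : R) (c : R -> R) (w : Rn -> R) : 0 < q ->
  Lbochner S q (2 * q) u ->
  measurable_fun setT c -> dominated s lam w ->
  (exists M, forall t, 0 < t -> t < S -> `|c t| <= M) ->
  mu2.-integrable (slab S) (EFin \o (fun z : RRn => c z.1 * (`|u z.1 z.2| `^ q * w z.2))).
Proof.
move=> q0 Lu mc dw [M HM].
have i1 := Lbochner_integrable s0 lam0 mu_u q0 Lu dw.
have mw : measurable_fun setT w by case: dw.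
have := integrableZl (measurable_slab S) M (integrable_norm i1).
apply: le_integrable.
- exact: measurable_slab.
- apply/measurable_EFinP; apply: measurable_funTS; apply: measurable_funM.
    exact: measurable_temporal.
  apply: measurable_funM; last exact: measurable_spatial.
  by apply: measurable_powR_comp; exact: measurableT_comp.
- move=> [t x] [/=]; rewrite in_itv/= => /andP[t0 tS] _.
  rewrite lee_fin normrM [leRHS]normrM normr_id ler_wpM2r//.
  by rewrite (le_trans (HM t t0 tS))// ler_norm.
Qed.

Lemma slab_integrable_u (c : R -> R) (w : Rn -> R) :
  measurable_fun setT c -> dominated s lam w ->
  (exists M, forall t, 0 < t -> t < S -> `|c t| <= M) ->
  mu2.-integrable (slab S) (EFin \o (fun z : RRn => c z.1 * (u z.1 z.2 * w z.2))).
Proof.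
move=> mc dw HM; have [Lu _ _] := sol.
have [mw [C HC]] := dw.
have := @slab_integrable_weight 1 c w ltr01; rewrite mulr1 => /(_ Lu mc dw HM).
apply: le_integrable.
- exact: measurable_slab.
- apply/measurable_EFinP; apply: measurable_funTS; apply: measurable_funM.
    exact: measurable_temporal.
  by apply: measurable_funM => //; exact: measurable_spatial.
- move=> z _; rewrite lee_fin powRr1// !normrM normr_id//.
Qed.

Lemma onePtR_bounded a : exists M, forall t : R, 0 < t -> t < S -> `|(1 + t) `^ a| <= M.
Proof.
exists ((1 + S) `^ `|a|) => t t0 tS; rewrite ger0_norm ?powR_ge0//.
by apply: powR_le_abs; lra.
Qed.

Lemma boundedM (f g : R -> R) :
  (exists M, forall t : R, 0 < t -> t < S -> `|f t| <= M) ->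
  (exists M, forall t : R, 0 < t -> t < S -> `|g t| <= M) ->
  exists M, forall t : R, 0 < t -> t < S -> `|f t * g t| <= M.
Proof.
move=> [M HM] [N HN]; exists (M * N) => t t0 tS.
by rewrite normrM ler_pM ?HM ?HN.
Qed.

Hypothesis pm : m.+4%:R >= 2 * p / (p - 1).

Let profile_bounded (f : R -> R) (c : R) :
  (forall t, `|f t| <= eta_cst m * eta m t `^ p^-1) ->
  exists M, forall t : R, 0 < t -> t < S -> `|c * f (S^-1 * t)| <= M.
Proof.
move=> Hf; exists (`|c| * eta_cst m) => t _ _; rewrite normrM ler_wpM2l//.
rewrite (le_trans (Hf _))// ler_piMr ?eta_cst_ge0// -(one_powR p^-1).
apply: ge0_ler_powR; rewrite ?nnegrE ?eta_ge0 ?eta_le1// invr_ge0.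
by apply: ltW; apply: lt_trans p1.
Qed.

Lemma time_cutoff_bounded : exists M, forall t : R, 0 < t -> t < S -> `|time_cutoff t| <= M.
Proof. by exists 1 => t _ _; rewrite ger0_norm ?eta_ge0// eta_le1. Qed.

Lemma time_cutoff1_bounded : exists M, forall t : R, 0 < t -> t < S -> `|time_cutoff1 t| <= M.
Proof. by apply: profile_bounded => t; exact: eta1_le. Qed.

Lemma time_cutoff2_bounded : exists M, forall t : R, 0 < t -> t < S -> `|time_cutoff2 t| <= M.
Proof.
have [M HM] := profile_bounded (S^-1 * S^-1) (fun t => eta2_le t p1 pm).
by exists M => t t0 tS; have := HM t t0 tS; rewrite -mulrA.
Qed.

Lemma measurable_onePtR (c a : R) : measurable_fun setT (fun t : R => c / (1 + t) `^ a).
Proof.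
apply: measurable_funM => //.
rewrite [X in measurable_fun _ X](_ : _ = fun t : R => (1 + t) `^ (- a)).
  by apply: measurable_powR_comp; exact: measurable_funD.
by apply/funext => t; rewrite powRN.
Qed.

Lemma onePtR_div_bounded (c a : R) :
  exists M, forall t : R, 0 < t -> t < S -> `|c / (1 + t) `^ a| <= M.
Proof.
have [M HM] := onePtR_bounded (- a); exists (`|c| * M) => t t0 tS.
by rewrite normrM ler_wpM2l// -powRN HM.
Qed.

Lemma integrable_weight : mu2.-integrable (slab S)
  (EFin \o (fun z : RRn => `|u z.1 z.2| `^ p * (time_cutoff z.1 * bump z.2))).
Proof.
have [_ Lu _] := sol; have p0 : 0 < p by exact: lt_trans p1.
have := slab_integrable_weight p0 Lu measurable_time_cutoff (dominated_bump s lam) time_cutoff_bounded.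
by apply: eq_integrable => [|z _]; [exact: measurable_slab|rewrite /= mulrCA].
Qed.

Lemma laplacian_bump_le x :
  `|\sum_i ddbump i i x| <= n%:R * (@bump_cst R n s * lam ^+ 2) * bump x.
Proof.
rewrite (le_trans (ler_norm_sum _ _ _))//.
apply: (@le_trans _ _ (\sum_(i < n) (@bump_cst R n s * lam ^+ 2 * bump x))).
  by apply: ler_sum => i _; exact: ddbump_le.
by rewrite sumr_const card_ord -[leLHS]mulr_natl !mulrA.
Qed.

Lemma dominated_laplacian : dominated s lam (fun x => \sum_i ddbump i i x).
Proof.
split; first by apply: measurable_sum => i; exact: measurable_ddbump.
by exists (n%:R * (@bump_cst R n s * lam ^+ 2)) => x; exact: laplacian_bump_le.
Qed.

Let iT (c : R -> R) w : measurable_fun setT c -> dominated s lam w ->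
  (exists M, forall t : R, 0 < t -> t < S -> `|c t| <= M) ->
  mu2.-integrable (slab S) (EFin \o (fun z : RRn => u z.1 z.2 * (c z.1 * w z.2))).
Proof.
move=> mc dw HM; have := slab_integrable_u mc dw HM.
by apply: eq_integrable => [|z _]; [exact: measurable_slab|rewrite /= mulrCA].
Qed.

Let i1 := iT measurable_time_cutoff2 (dominated_bump s lam) time_cutoff2_bounded.
Let i3 := iT measurable_time_cutoff dominated_laplacian time_cutoff_bounded.

Let i2 : mu2.-integrable (slab S) (EFin \o (fun z : RRn => u z.1 z.2 *
  (b0 / (1 + z.1) `^ beta * (time_cutoff1 z.1 * flap bump z.2)))).
Proof.
have := iT (measurable_funM (measurable_onePtR b0 beta) measurable_time_cutoff1)
  (dominated_flap_bump s0 s2 lam0) (boundedM (onePtR_div_bounded b0 beta) time_cutoff1_bounded).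
by apply: eq_integrable => [|z _]; [exact: measurable_slab|rewrite /= -mulrA].
Qed.

Let i4 : mu2.-integrable (slab S) (EFin \o (fun z : RRn => u z.1 z.2 *
  (b0 * beta / (1 + z.1) `^ (beta + 1) * (time_cutoff z.1 * flap bump z.2)))).
Proof.
have := iT (measurable_funM (measurable_onePtR (b0 * beta) (beta + 1)) measurable_time_cutoff)
  (dominated_flap_bump s0 s2 lam0) (boundedM (onePtR_div_bounded (b0 * beta) (beta + 1)) time_cutoff_bounded).
by apply: eq_integrable => [|z _]; [exact: measurable_slab|rewrite /= -mulrA].
Qed.

Lemma integrable_adjoint :
  mu2.-integrable (slab S) (EFin \o (fun z : RRn => u z.1 z.2 * adjoint z)).
Proof.
have mS := @measurable_slab R n S.
have := integrableD mS (integrableB mS (integrableB mS i1 i2) i3) i4.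
apply: eq_integrable => // z _ /=; rewrite -!EFinB -EFinD; congr EFin.
by rewrite /adjoint !mulrDr !mulrN.
Qed.

Let iterated (c f : R -> R) : measurable_fun setT c -> measurable_fun setT f ->
  mu2.-integrable (slab S) (EFin \o (fun z : RRn => u z.1 z.2 *
    (c z.1 * (f z.1 * flap bump z.2)))) ->
  \int[leb]_(t in `]0, S[) (c t * \int[mu]_x (u t x * (f t * flap bump x))) =
  \int[mu2]_(z in slab S) (u z.1 z.2 * (c z.1 * (f z.1 * flap bump z.2))).
Proof.
move=> mc mf ii.
have mG : measurable_fun setT (fun z : RRn => u z.1 z.2 * (f z.1 * flap bump z.2)).
  apply: measurable_funM => //; apply: measurable_funM; first exact: measurable_temporal.
  have [mfl _] := @dominated_flap_bump R n s lam s0 s2 lam0.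
  exact: measurable_spatial.
have ii' : mu2.-integrable (slab S) (EFin \o (fun z : RRn =>
    c z.1 * (u z.1 z.2 * (f z.1 * flap bump z.2)))).
  by move: ii; apply: eq_integrable => [|z _]; [exact: measurable_slab|rewrite /= mulrCA].
have -> := @iterated_integral _ _ (measurableTypeR R) Rn R leb mu
  `]0, S[%classic c (fun z : RRn => u z.1 z.2 * (f z.1 * flap bump z.2))
  (measurable_itv `]0, S[) mc mG ii'.
by apply: eq_Rintegral => z _; rewrite mulrCA.
Qed.

(** The boundary term with the time derivative disappears, because the cut-off is
    constant near time 0. *)
Lemma tested_identity :
  \int[mu2]_(z in slab S) (`|u z.1 z.2| `^ p * (time_cutoff z.1 * bump z.2))
  + \int[mu]_x (u1 x * bump x) + b0 * \int[mu]_x (u0 x * flap bump x) =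
  \int[mu2]_(z in slab S) (u z.1 z.2 * adjoint z).
Proof.
have [_ _ H] := sol.
have tc : test_curve s S (fun t x => time_cutoff t * bump x) (fun t x => time_cutoff1 t * bump x)
    (fun t x => time_cutoff2 t * bump x) (fun t x => time_cutoff t * \sum_i ddbump i i x).
  exact: (test_curve_tensor s0 s2 lam0 is_derive_time_cutoff is_derive_time_cutoff1
    continuous_time_cutoff2 (fun t St => time_cutoff_large (ltW St))).
have := H _ _ _ _ (fun t x => time_cutoff t * flap bump x)
  (fun t x => time_cutoff1 t * flap bump x) tc
  (fun t _ => is_fraclap_bumpZ s0 s2 lam0 (time_cutoff t))
  (fun t _ => is_fraclap_bumpZ s0 s2 lam0 (time_cutoff1 t)).
rewrite /weak_identity.
have half : S^-1 * 0 <= 2^-1 :> R by rewrite mulr0.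
have [c0 c1 _] := eta_small m half.
have -> : \int[mu]_x (u1 x * (time_cutoff 0 * bump x)) = \int[mu]_x (u1 x * bump x).
  by apply: eq_Rintegral => x _; rewrite /time_cutoff c0 mul1r.
have -> : \int[mu]_x (u0 x * (time_cutoff 0 * flap bump x)) = \int[mu]_x (u0 x * flap bump x).
  by apply: eq_Rintegral => x _; rewrite /time_cutoff c0 mul1r.
have -> : \int[mu]_x (u0 x * (time_cutoff1 0 * bump x)) = 0.
  rewrite /Rintegral (eq_integral (fun=> 0%E)) ?integral0// => x _.
  by rewrite /time_cutoff1 c1 mulr0 mul0r mulr0.
rewrite subr0 => ->.
rewrite (iterated (measurable_onePtR b0 beta) measurable_time_cutoff1 i2).
rewrite (iterated (measurable_onePtR (b0 * beta) (beta + 1)) measurable_time_cutoff i4).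
have mS := @measurable_slab R n S.
rewrite -RintegralB// -RintegralB//; last exact: (integrableB mS i1 i2).
rewrite -RintegralD//; last exact: (integrableB mS (integrableB mS i1 i2) i3).
by apply: eq_Rintegral => z _; rewrite /adjoint !mulrDr !mulrN.
Qed.

End tested.
End identity.

(** * Scales and separated integrals over slabs *)

Section scales.
Context {R : realType}.
Variables (s gam : R).
Hypotheses (s0 : 0 < s) (s2 : s < 2) (gam1 : 1 <= gam).
Variables (K L : R).
Hypotheses (K1 : 1 <= K) (L1 : 1 <= L).

Let K0 : 0 < K. Proof. exact: lt_le_trans K1. Qed.
Let L0 : 0 < L. Proof. exact: lt_le_trans L1. Qed.

(** The inverse width of the spatial cut-off for a time cut-off of length [L]: lengths
    scale like the power [gam] of time, and [K] is a free amplification. *)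
Definition width : R := (K * L `^ gam)^-1.

Lemma width_gt0 : 0 < width.
Proof. by rewrite invr_gt0 mulr_gt0// powR_gt0. Qed.

Lemma width_powR a : width `^ a = K `^ (- a) * L `^ (- (gam * a)).
Proof.
rewrite /width -powR_inv1 ?mulr_ge0 ?powR_ge0 ?(ltW K0)//.
by rewrite -powRrM mulN1r powRM ?powR_ge0 ?(ltW K0)// -powRrM mulrN.
Qed.

(** The exponents 2 and 2 gam are traded for the weaker s and 2, so that the Laplacian
    and the damping give the same power of [K]. *)
Lemma width_sqr_le : width ^+ 2 <= K `^ (- s) * L `^ (-2).
Proof.
rewrite -powR_mulrn ?(ltW width_gt0)// width_powR.
have h2 := s2; have h1 := gam1.
by apply: ler_pM; rewrite ?powR_ge0//; apply: ler_powR => //; lra.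
Qed.

Lemma shell_powR_le (beta t : R) : L / 2 < t -> t < L ->
  (1 + t) `^ (- beta) <= 2 `^ `|beta| * L `^ (- beta).
Proof.
move=> Lt tL; have h1 := L1; have t0 : 0 < 1 + t by lra.
have -> : 1 + t = ((1 + t) / L) * L by rewrite divfK// gt_eqF.
have q0 : 0 < (1 + t) / L by rewrite divr_gt0.
rewrite powRM ?(ltW q0) ?(ltW L0)// ler_wpM2r ?powR_ge0// -(normrN beta).
have [x1|x1] := leP 1 ((1 + t) / L).
  by apply: powR_le_abs => //; rewrite ler_pdivrMr//; lra.
have -> : (1 + t) / L = (L / (1 + t)) `^ (-1) by rewrite powR_inv1 ?invf_div// ltW// divr_gt0.
rewrite -powRrM mulN1r -normrN; apply: powR_le_abs.
  by rewrite ler_pdivlMr//; move: x1; rewrite ltr_pdivrMr//; lra.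
by rewrite ler_pdivrMr//; lra.
Qed.

End scales.

Section slab_tensor.
Context {R : realType} {n : nat}.
Local Notation Rn := 'rV[R]_n.
Local Notation mu := (lebesgue_row R n).
Local Notation leb := (@lebesgue_measure R).
Local Notation mu2 := (leb \x mu)%E.
Local Notation slab := (@slab R n).
Local Notation RRn := (measurableTypeR R * 'rV[R]_n)%type.

Lemma slab_tensor_integrable (L : R) (theta : R -> R) (f : Rn -> R) :
  measurable_fun setT theta -> leb.-integrable `]0, L[ (EFin \o theta) ->
  measurable_fun setT f -> mu.-integrable setT (EFin \o f) ->
  mu2.-integrable (slab L) (EFin \o (fun z : RRn => theta z.1 * f z.2)).
Proof.
move=> mth ith mf fi; have mI : measurable (`]0, L[%classic : set (measurableTypeR R)) by [].
have ith' : leb.-integrable setT (EFin \o (theta \_ `]0, L[)).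
  by rewrite -restrict_EFin; exact: (integrable_mkcond _ mI).1 ith.
have mth' : measurable_fun setT (theta \_ `]0, L[ : measurableTypeR R -> R).
  by apply/(measurable_restrictT _ mI); exact: measurable_funTS.
have := @integrable_tensor _ _ (measurableTypeR R) Rn R leb mu _ f mth' mf ith' fi.
move=> /(integrableS measurableT (@measurable_slab R n L) (@subsetT _ _)).
apply: eq_integrable; first exact: measurable_slab.
by move=> z; rewrite inE => -[/= zS _]; rewrite patchE mem_set.
Qed.

Lemma slab_tensor_integral (L : R) (theta : R -> R) (f : Rn -> R) :
  measurable_fun setT theta -> leb.-integrable `]0, L[ (EFin \o theta) ->
  measurable_fun setT f -> mu.-integrable setT (EFin \o f) ->
  \int[mu2]_(z in slab L) (theta z.1 * f z.2) =
  (\int[leb]_(t in `]0, L[) theta t) * \int[mu]_x f x.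
Proof.
move=> mth ith mf fi; have ii := slab_tensor_integrable mth ith mf fi.
rewrite -(@iterated_integral _ _ (measurableTypeR R) Rn R leb mu `]0, L[%classic theta
  (fun z : RRn => f z.2) (measurable_itv `]0, L[) mth (measurable_spatial mf) ii).
have E := @RintegralZr _ (measurableTypeR R) R leb `]0, L[%classic theta (\int[mu]_x f x) (measurable_itv _) ith.
exact: E.
Qed.

Lemma integrable_onePtR_powR (L delta : R) : 0 < L -> 0 < delta ->
  leb.-integrable `]0, L[ (EFin \o (fun t => (1 + t) `^ (delta - 1))).
Proof.
move=> L0 d0; apply/integrableP; split.
  apply/measurable_EFinP; apply: measurable_funTS; apply: measurable_powR_comp.
  exact: measurable_funD.
under eq_integral do rewrite /= ger0_norm ?powR_ge0//.
by apply: le_lt_trans (integral_powR_le L0 d0) _; rewrite ltry.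
Qed.

Lemma integrable_interval_cst (L c : R) : 0 < L ->
  leb.-integrable `]0, L[ (EFin \o cst c).
Proof.
move=> L0; have mI : measurable (`]0, L[%classic : set (measurableTypeR R)) by [].
apply/integrableP; split; first exact/measurable_EFinP.
have -> : (\int[leb]_(x in `]0%R, L[) `|(EFin \o cst c) x| = `|c|%:E * leb `]0%R, L[)%E.
  exact: (integral_cst leb mI `|c|%:E).
by rewrite lebesgue_measure_itv/= lte_fin L0 -EFinB -EFinM ltry.
Qed.

Lemma integrable_time (L delta c d : R) : 0 < L -> 0 < delta ->
  leb.-integrable `]0, L[ (EFin \o (fun t => c + d * (1 + t) `^ (delta - 1))).
Proof.
move=> L0 d0.
have ip := integrable_onePtR_powR L0 d0.
have mI : measurable (`]0, L[%classic : set (measurableTypeR R)) by [].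
have ic := integrable_interval_cst c L0.
have := integrableD mI ic (integrableZl mI d ip).
by apply: eq_integrable => // t _ /=; rewrite -EFinM -EFinD.
Qed.

Lemma integral_time_le (L delta c d : R) : 0 < L -> 0 < delta -> 0 <= d ->
  \int[leb]_(t in `]0, L[) (c + d * (1 + t) `^ (delta - 1)) <=
    c * L + d * ((1 + L) `^ delta / delta).
Proof.
move=> L0 d0 dd.
have mI : measurable (`]0, L[%classic : set (measurableTypeR R)) by [].
have ic := integrable_interval_cst c L0.
have ip := integrable_onePtR_powR L0 d0.
rewrite RintegralD//; last exact: (integrableZl mI d ip).
rewrite Rintegral_cst// RintegralZl//; apply: lerD.
  have E : leb `]0, L[%classic = L%:E.
    by rewrite lebesgue_measure_itv/= lte_fin L0 -EFinB subr0.
  by rewrite (_ : fine _ = L)//; exact: (congr1 fine E).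
rewrite ler_wpM2l// -lee_fin /Rintegral fineK; first exact: integral_powR_le.
exact: integrable_fin_num.
Qed.

End slab_tensor.

(** * Weighted Young inequality and powers of the scales *)

Section pointwise.
Context {R : realType}.

(** The terms [X2] and [X3], which live on the whole slab, get weight 1/4 each, to be
    absorbed. The term [X1], supported where the cut-off varies, gets an arbitrary
    weight [A]: a large one makes its contribution to the right-hand side small, at
    the expense of an integral over the shell. *)
Lemma young3 (x E b A p X1 X2 X3 : R) (h : bool) :
  1 < p -> 0 < A -> 0 <= x -> 0 <= E -> 0 <= b -> 0 <= X1 -> 0 <= X2 -> 0 <= X3 ->
  x * (E `^ p^-1 * b * (X1 * h%:R + X2 + X3)) <=
  (A * h%:R + 2^-1) * (x `^ p * (E * b)) +
  (A `^ (1 - p / (p - 1)) * X1 `^ (p / (p - 1)) +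
   4^-1 `^ (1 - p / (p - 1)) * X2 `^ (p / (p - 1)) +
   4^-1 `^ (1 - p / (p - 1)) * X3 `^ (p / (p - 1))) * b.
Proof.
move=> p1 A0 x0 E0 b0 X10 X20 X30; have p0 : p != 0 by rewrite gt_eqF// (lt_trans _ p1).
have a0 : 0 <= x * E `^ p^-1 by rewrite mulr_ge0 ?powR_ge0.
have aE : (x * E `^ p^-1) `^ p = x `^ p * E.
  by rewrite powRM ?powR_ge0// -powRrM mulVf// powRr1.
have q0 : 0 < 4^-1 :> R by rewrite invr_gt0.
have Y1 := young_powR p1 a0 X10 A0.
have Y2 := young_powR p1 a0 X20 q0.
have Y3 := young_powR p1 a0 X30 q0.
rewrite aE in Y1 Y2 Y3.
have w0 : 0 <= x `^ p * E by rewrite mulr_ge0 ?powR_ge0.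
have c0 : 0 <= A `^ (1 - p / (p - 1)) * X1 `^ (p / (p - 1)) by rewrite mulr_ge0 ?powR_ge0.
move: (4^-1 `^ _ * _) (4^-1 `^ _ * _) (A `^ _ * _) Y1 Y2 Y3 c0 => c3 c2 c1 Y1 Y2 Y3 c0.
have -> : x * (E `^ p^-1 * b * (X1 * h%:R + X2 + X3)) =
    ((x * E `^ p^-1) * X1 * h%:R + x * E `^ p^-1 * X2 + x * E `^ p^-1 * X3) * b by ring.
have -> : (A * h%:R + 2^-1) * (x `^ p * (E * b)) + (c1 + c2 + c3) * b =
    ((A * h%:R + 2^-1) * (x `^ p * E) + (c1 + c2 + c3)) * b by ring.
apply: ler_wpM2r => //.
move: (x * E `^ p^-1 * X1) (x * E `^ p^-1 * X2) (x * E `^ p^-1 * X3) (x `^ p * E) w0 Y1 Y2 Y3.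
by move=> y1 y2 y3 w w0 Y1 Y2 Y3; case: h => /=; lra.
Qed.

(** All powers of [L] cancel or have a nonpositive exponent: N gam + 1 <= 2 p' takes care
    of L^(1 - 2 p' + gam N), and [delta] is such that the third term has exponent 0. *)
Lemma scale_bound (s gam N p delta K L A C1 C2 C3 Q J : R) :
  1 < p -> 1 <= K -> 1 <= L -> 0 <= A -> 0 <= C1 -> 0 <= C2 -> 0 <= C3 -> 0 <= Q -> 0 <= J ->
  0 < delta -> delta = gam * (s * (p / (p - 1)) - N) ->
  N * gam + 1 <= 2 * (p / (p - 1)) ->
  ((A `^ (1 - p / (p - 1)) * (C1 * L `^ (-2)) `^ (p / (p - 1)) +
    Q * (C2 * (K `^ (- s) * L `^ (-2))) `^ (p / (p - 1))) * L +
   Q * (C3 * (K `^ (- s) * L `^ (- (gam * s)))) `^ (p / (p - 1)) *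
     ((1 + L) `^ delta / delta)) * (K `^ N * L `^ (gam * N) * J) <=
  C1 `^ (p / (p - 1)) * J * A `^ (1 - p / (p - 1)) * K `^ N +
  Q * J * (C2 `^ (p / (p - 1)) + C3 `^ (p / (p - 1)) * 2 `^ delta / delta) *
    K `^ (N - s * (p / (p - 1))).
Proof.
move=> p1 K1 L1 A0 C10 C20 C30 Q0 J0 d0 dE dim.
have K0 : 0 < K by exact: lt_le_trans K1.
have L0 : 0 < L by exact: lt_le_trans L1.
move: (p / (p - 1)) dE dim => p' dE dim.
have powM (a b c : R) : 0 < a -> a `^ (b + c) = a `^ b * a `^ c.
  by move=> a0; rewrite powRD// (gt_eqF a0) implybT.
rewrite !(powRM p') ?mulr_ge0 ?powR_ge0// -!powRrM.
set a := A `^ _; set c1 := C1 `^ _; set c2 := C2 `^ _; set c3 := C3 `^ _.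
have a0 : 0 <= a by exact: powR_ge0.
have c10 : 0 <= c1 by exact: powR_ge0.
have c20 : 0 <= c2 by exact: powR_ge0.
have c30 : 0 <= c3 by exact: powR_ge0.
have e1 : L `^ (- 2 * p') * L * L `^ (gam * N) <= 1.
  rewrite -[X in _ * X * _](powRr1 (ltW L0)) -!powM// -[leRHS](powRr0 L).
  by apply: ler_powR => //; lra.
have e2 : L `^ (- (gam * s) * p') * (1 + L) `^ delta * L `^ (gam * N) <= 2 `^ delta.
  apply: (@le_trans _ _ (L `^ (- (gam * s) * p') * (2 `^ delta * L `^ delta) * L `^ (gam * N))).
    apply: ler_wpM2r; first exact: powR_ge0.
    apply: ler_wpM2l; first exact: powR_ge0.
    rewrite -powRM// ?(ltW L0)//; apply: ge0_ler_powR (ltW d0) _ _ _ _ _; rewrite ?nnegrE; lra.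
  rewrite mulrCA -!mulrA ler_piMr ?powR_ge0// mulrA -!powM//.
  rewrite (_ : _ + _ = 0) ?powRr0//; rewrite dE; ring.
have KE : K `^ (N - s * p') = K `^ (- s * p') * K `^ N by rewrite -powM// addrC mulNr.
rewrite KE.
set k := K `^ (- s * p'); set kN := K `^ N; set l2 := L `^ (- 2 * p'); set lN := L `^ (gam * N).
set ls := L `^ _.
have k0 : 0 <= k by exact: powR_ge0.
have kN0 : 0 <= kN by exact: powR_ge0.
have -> : ((a * (c1 * l2) + Q * (c2 * (k * l2))) * L +
    Q * (c3 * (k * ls)) * ((1 + L) `^ delta / delta)) * (kN * lN * J) =
    (a * c1 * kN * J + Q * c2 * k * kN * J) * (l2 * L * lN) +
    Q * c3 * k * kN * J / delta * (ls * (1 + L) `^ delta * lN) by ring.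
have -> : c1 * J * a * kN + Q * J * (c2 + c3 * 2 `^ delta / delta) * (k * kN) =
    (a * c1 * kN * J + Q * c2 * k * kN * J) * 1 +
    Q * c3 * k * kN * J / delta * 2 `^ delta by ring.
apply: lerD; first by apply: ler_wpM2l => //; rewrite addr_ge0// !mulr_ge0.
by apply: ler_wpM2l => //; rewrite !mulr_ge0// invr_ge0 ltW.
Qed.

End pointwise.

(** * The test function method *)

Section test_function_method.
Context {R : realType} {n : nat}.
Local Notation Rn := 'rV[R]_n.
Local Notation mu := (lebesgue_row R n).
Local Notation leb := (@lebesgue_measure R).
Local Notation mu2 := (leb \x mu)%E.
Local Notation slab := (@slab R n).
Local Notation RRn := (measurableTypeR R * 'rV[R]_n)%type.
Variables (s gam beta p b0 CL : R) (m : nat) (u0 u1 : Rn -> R) (u : R -> Rn -> R).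
Hypotheses (s0 : 0 < s) (s2 : s < 2) (gam1 : 1 <= gam) (p1 : 1 < p).
Hypothesis damping : 1 - beta <= s * gam.
Hypothesis time_dim : n%:R * gam + 1 <= 2 * (p / (p - 1)).
Hypothesis space_dim : n%:R < s * (p / (p - 1)).
Hypothesis pm : m.+4%:R >= 2 * p / (p - 1).
Hypothesis CL0 : 0 <= CL.
Local Notation bump := (@bump R n s).
Local Notation flap := (@flap R n s).
Hypothesis HCL : forall lam x, 0 < lam -> `|flap (bump lam) x| <= CL * lam `^ s * bump lam x.
Hypothesis mu_u : measurable_fun setT (fun z : RRn => u z.1 z.2).
Hypothesis u_past : forall t x, t <= 0 -> u t x = 0.
Hypothesis sol : global_weak_solution s beta p b0 u0 u1 u.
Hypothesis u0_int : mu.-integrable setT (EFin \o u0).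
Hypothesis u1_int : mu.-integrable setT (EFin \o u1).

(** ** Size of the adjoint operator on the test function *)

Definition shell_cst : R := eta_cst m * (1 + `|b0| * (2 `^ `|beta|) * CL).
Definition laplacian_cst : R := n%:R * @bump_cst R n s.
Definition drift_cst : R := `|b0 * beta| * CL.

Let p' := p / (p - 1).
Let delta := gam * (s * p' - n%:R).
Let Q : R := 4^-1 `^ (1 - p').
Let J := \int[mu]_x @bracket R n s x.
Let C1 := shell_cst.
Let C2 := laplacian_cst.
Let C3 := drift_cst.

Definition shell_bound : R := C1 `^ p' * J.
Definition core_bound : R := Q * J * (C2 `^ p' + C3 `^ p' * 2 `^ delta / delta).

Let gam0 : 0 < gam. Proof. exact: lt_le_trans gam1. Qed.
Let delta0 : 0 < delta. Proof. by rewrite mulr_gt0// subr_gt0. Qed.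
Let J0 : 0 <= J. Proof. by apply: Rintegral_ge0 => x _; exact: ltW (bracket_gt0 _ _). Qed.
Let Q0 : 0 <= Q. Proof. exact: powR_ge0. Qed.
Let C10 : 0 <= C1.
Proof. by rewrite mulr_ge0 ?eta_cst_ge0// addr_ge0// !mulr_ge0 ?powR_ge0. Qed.
Let C20 : 0 <= C2. Proof. by rewrite mulr_ge0// bump_cst_ge0. Qed.
Let C30 : 0 <= C3. Proof. by rewrite mulr_ge0. Qed.
Let p'0 : 0 < p'. Proof. by rewrite divr_gt0 ?subr_gt0// (lt_trans _ p1). Qed.

Lemma shell_bound_ge0 : 0 <= shell_bound.
Proof. by rewrite mulr_ge0 ?powR_ge0. Qed.

Lemma core_bound_ge0 : 0 <= core_bound.
Proof. by rewrite !mulr_ge0// addr_ge0 ?mulr_ge0 ?powR_ge0// invr_ge0 ltW. Qed.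

Definition weight (K L : R) (z : RRn) : R :=
  `|u z.1 z.2| `^ p * (time_cutoff L m z.1 * bump (width gam K L) z.2).

(** The times at which the cut-off varies. *)
Definition in_shell (L t : R) : bool := L / 2 < t.

Section scaled.
Variables (K L A : R).
Hypotheses (K1 : 1 <= K) (L1 : 1 <= L) (A0 : 0 < A).
Local Notation lam := (width gam K L).

Let L0 : 0 < L. Proof. exact: lt_le_trans L1. Qed.
Let lam0 : 0 < lam. Proof. exact: width_gt0. Qed.

Let shell_tail (t : R) : L / 2 < t -> t < L ->
  (1 + t) `^ (- beta) * L^-1 * (CL * lam `^ s) <= 2 `^ `|beta| * CL * L `^ (-2).
Proof.
move=> Lt tL; have h := shell_powR_le L1 beta Lt tL.
apply: (@le_trans _ _ (2 `^ `|beta| * L `^ (- beta) * L^-1 * (CL * L `^ (- (gam * s))))).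
  apply: ler_pM; rewrite ?mulr_ge0 ?powR_ge0 ?invr_ge0 ?(ltW L0)//.
    by rewrite ler_wpM2r// invr_ge0 ltW.
  apply: ler_wpM2l => //; rewrite width_powR// ler_piMl ?powR_ge0//.
  rewrite powRN invf_le1 ?powR_gt0 ?(lt_le_trans _ K1)// -(powRr0 K).
  by apply: ler_powR => //; exact: ltW.
rewrite -(powR_inv1 (ltW L0)).
have -> : 2 `^ `|beta| * L `^ (- beta) * L `^ (-1) * (CL * L `^ (- (gam * s))) =
    2 `^ `|beta| * CL * (L `^ (- beta) * L `^ (-1) * L `^ (- (gam * s))) by ring.
apply: ler_wpM2l; first by rewrite mulr_ge0 ?powR_ge0.
rewrite -!powRD ?(gt_eqF L0) ?implybT//; apply: ler_powR => //.
by have := damping; lra.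
Qed.

Let root_le t : time_cutoff L m t <= time_cutoff L m t `^ p^-1.
Proof.
have p0 : 0 < p by exact: lt_trans p1.
rewrite /time_cutoff; have := eta_ge0 m (L^-1 * t); rewrite le_eqVlt => /orP[/eqP <-|e0].
  by rewrite powR_ge0.
rewrite -{1}(powRr1 (ltW e0)); apply: ger_powR; first by rewrite e0 eta_le1.
by rewrite invf_le1// ltW.
Qed.

Let small t : t <= L / 2 -> time_cutoff1 L m t = 0 /\ time_cutoff2 L m t = 0.
Proof.
move=> tL; have h : L^-1 * t <= 2^-1 by rewrite mulrC ler_pdivrMr// mulrC.
by have [_ E1 E2] := eta_small m h; rewrite /time_cutoff1 /time_cutoff2 E1 E2 !mulr0.
Qed.

Let e t := time_cutoff L m t `^ p^-1.
Let e0 t : 0 <= e t. Proof. exact: powR_ge0. Qed.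

(** The derivatives of the cut-off vanish for t <= L / 2. For t > L / 2 the second time
    derivative contributes L^-2, and the damping L^(-1 - beta - s gam), which is no
    more than L^-2 by the choice of [gam]. The Laplacian contributes the square of
    the inverse width. The derivative of the damping coefficient is not small at
    early times, whence the last term. *)
Lemma adjoint_le (t : R) (x : Rn) : 0 < t -> t < L ->
  `|adjoint s lam beta b0 L m (t, x)| <= e t * bump lam x *
    (shell_cst * L `^ (-2) * (L / 2 < t)%R%:R +
     laplacian_cst * (K `^ (- s) * L `^ (-2)) +
     drift_cst * (K `^ (- s) * L `^ (- (gam * s))) * (1 + t) `^ (- (beta + 1))).
Proof.
move=> t0 tL.
have b0x : 0 <= bump lam x by exact: bump_ge0.
have E1 := eta1_le (L^-1 * t) p1 pm; have E2 := eta2_le (L^-1 * t) p1 pm.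
have Li : 0 <= L^-1 by rewrite invr_ge0 ltW.
have c1 : `|time_cutoff1 L m t| <= L^-1 * (eta_cst m * e t).
  by rewrite /time_cutoff1 normrM ger0_norm// ler_wpM2l.
have L2 : L^-1 * L^-1 = L `^ (-2).
  by rewrite -(powR_inv1 (ltW L0)) -powRD ?(gt_eqF L0) ?implybT//; congr (_ `^ _); ring.
have c2 : `|time_cutoff2 L m t| <= L `^ (-2) * (eta_cst m * e t).
  by rewrite /time_cutoff2 mulrA normrM L2 ger0_norm ?powR_ge0// ler_wpM2l ?powR_ge0.
have HF := HCL x lam0.
have HL := @laplacian_bump_le R n s lam x.
have tc0 : 0 <= time_cutoff L m t by exact: eta_ge0.
have rl : time_cutoff L m t <= e t := root_le t.
have w2 := width_sqr_le s2 gam1 K1 L1.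
have ws : lam `^ s = K `^ (- s) * L `^ (- (gam * s)) by rewrite width_powR.
have -> : e t * bump lam x *
    (shell_cst * L `^ (-2) * (L / 2 < t)%R%:R + laplacian_cst * (K `^ (- s) * L `^ (-2)) +
     drift_cst * (K `^ (- s) * L `^ (- (gam * s))) * (1 + t) `^ (- (beta + 1))) =
  eta_cst m * L `^ (-2) * (L / 2 < t)%R%:R * (e t * bump lam x) +
  eta_cst m * (`|b0| * (2 `^ `|beta|) * CL) * L `^ (-2) * (L / 2 < t)%R%:R * (e t * bump lam x) +
  laplacian_cst * (K `^ (- s) * L `^ (-2)) * (e t * bump lam x) +
  drift_cst * (K `^ (- s) * L `^ (- (gam * s))) * (1 + t) `^ (- (beta + 1)) * (e t * bump lam x).
  by rewrite /shell_cst; ring.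
rewrite /adjoint /= -ws.
apply: (le_trans (ler_normD _ _)); apply: lerD; last first.
  rewrite normrM [`|_ / _|]normrM [`|time_cutoff _ _ _ * _|]normrM normfV [`|_ `^ (beta + 1)|]ger0_norm ?powR_ge0// -powRN.
  rewrite [`|time_cutoff _ _ _|]ger0_norm// /drift_cst.
  have -> : `|b0 * beta| * CL * lam `^ s * (1 + t) `^ (- (beta + 1)) * (e t * bump lam x) =
    `|b0 * beta| * (1 + t) `^ (- (beta + 1)) * (e t * (CL * lam `^ s * bump lam x)) by ring.
  by apply: ler_wpM2l; [rewrite mulr_ge0 ?powR_ge0|apply: ler_pM].
apply: (le_trans (ler_normB _ _)); apply: lerD; last first.
  rewrite normrM ger0_norm//.
  apply: (@le_trans _ _ (e t * (n%:R * (@bump_cst R n s * lam ^+ 2) * bump lam x))).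
    exact: ler_pM.
  have -> : e t * (n%:R * (@bump_cst R n s * lam ^+ 2) * bump lam x) =
    laplacian_cst * lam ^+ 2 * (e t * bump lam x) by rewrite /laplacian_cst; ring.
  apply: ler_wpM2r; first by rewrite mulr_ge0.
  by apply: ler_wpM2l => //; rewrite mulr_ge0// bump_cst_ge0.
apply: (le_trans (ler_normB _ _)).
have [tL2|tL2] := leP t (L / 2).
  have [-> ->] := small tL2.
  by rewrite !(mul0r, mulr0, normr0) addr0.
rewrite mulr1; apply: lerD.
  rewrite normrM [`|bump _ _|]ger0_norm//.
  have -> : eta_cst m * L `^ (-2) * (e t * bump lam x) =
    L `^ (-2) * (eta_cst m * e t) * bump lam x by ring.
  exact: ler_wpM2r.
rewrite normrM [`|_ / _|]normrM [`|time_cutoff1 _ _ _ * _|]normrM normfV [`|_ `^ beta|]ger0_norm ?powR_ge0// -powRN.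
apply: (@le_trans _ _ (`|b0| * (1 + t) `^ (- beta) *
    (L^-1 * (eta_cst m * e t) * (CL * lam `^ s * bump lam x)))).
  by apply: ler_wpM2l; [rewrite mulr_ge0 ?powR_ge0|apply: ler_pM].
have -> : `|b0| * (1 + t) `^ (- beta) *
    (L^-1 * (eta_cst m * e t) * (CL * lam `^ s * bump lam x)) =
  `|b0| * eta_cst m * (e t * bump lam x) * ((1 + t) `^ (- beta) * L^-1 * (CL * lam `^ s)) by ring.
have -> : eta_cst m * (`|b0| * 2 `^ `|beta| * CL) * L `^ (-2) * 1 * (e t * bump lam x) =
  `|b0| * eta_cst m * (e t * bump lam x) * (2 `^ `|beta| * CL * L `^ (-2)) by ring.
by apply: ler_wpM2l; [rewrite !mulr_ge0 ?eta_cst_ge0|exact: shell_tail].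
Qed.

(** ** The key inequality *)

Let K0 : 0 < K. Proof. exact: lt_le_trans K1. Qed.
Let mS := @measurable_slab R n L.

Lemma weight_ge0 z : 0 <= weight K L z.
Proof. by rewrite mulr_ge0 ?powR_ge0// mulr_ge0 ?eta_ge0 ?bump_ge0. Qed.

Lemma integrable_weight_slab : mu2.-integrable (slab L) (EFin \o weight K L).
Proof. exact: (integrable_weight m s0 lam0 p1 mu_u (sol L0)). Qed.

Lemma measurable_in_shell :
  measurable_fun setT (fun z : RRn => (in_shell L z.1)%:R : R).
Proof.
rewrite (_ : (fun z => _) = (fun z : RRn => \1_`]L / 2, +oo[ z.1)).
  by apply: measurable_temporal; exact: measurable_indic.
by apply/funext => z; rewrite indicE mem_setE in_itv/= andbT.
Qed.

Lemma integrable_weight_shell :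
  mu2.-integrable (slab L) (EFin \o (fun z => weight K L z * (in_shell L z.1)%:R)).
Proof.
have iW := integrable_weight_slab; apply: le_integrable iW => //.
  apply/measurable_EFinP; apply: measurable_funM.
    by apply/measurable_EFinP; case/integrableP: integrable_weight_slab.
  exact: measurable_funTS measurable_in_shell.
move=> z _; rewrite lee_fin normrM ler_piMr//.
by case: (in_shell _ _); rewrite ?normr0 ?normr1.
Qed.

Let c : R := A `^ (1 - p') * (C1 * L `^ (-2)) `^ p' + Q * (C2 * (K `^ (- s) * L `^ (-2))) `^ p'.
Let d : R := Q * (C3 * (K `^ (- s) * L `^ (- (gam * s)))) `^ p'.
Let theta (t : R) : R := c + d * (1 + t) `^ (delta - 1).

Let d0 : 0 <= d. Proof. by rewrite mulr_ge0// powR_ge0. Qed.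

Let time_exponent (t : R) : 0 < t -> ((1 + t) `^ (- (beta + 1))) `^ p' <= (1 + t) `^ (delta - 1).
Proof.
move=> t0; rewrite -powRrM; apply: ler_powR; first by lra.
have h := time_dim; rewrite -/p' in h.
(* As s gam + beta >= 1, the exponent is compared with the dimension condition. *)
have : (1 - (s * gam + beta)) * p' <= 0.
  by rewrite pmulr_lle0//; have := damping; lra.
rewrite /delta; move: (p') h => q h; lra.
Qed.

Let pointwise (t : R) (x : Rn) : 0 < t -> t < L ->
  u t x * adjoint s lam beta b0 L m (t, x) <=
  A * (weight K L (t, x) * (in_shell L t)%:R) + 2^-1 * weight K L (t, x) + theta t * bump lam x.
Proof.
move=> t0 tL.
apply: (le_trans (ler_norm _)); rewrite normrM.
have Ha := adjoint_le x t0 tL.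
apply: (le_trans (ler_wpM2l (normr_ge0 _) Ha)).
have L20 : 0 <= L `^ (-2) by exact: powR_ge0.
have X10 : 0 <= C1 * L `^ (-2) by rewrite mulr_ge0.
have X20 : 0 <= C2 * (K `^ (- s) * L `^ (-2)) by rewrite !mulr_ge0 ?powR_ge0.
have Y30 : 0 <= C3 * (K `^ (- s) * L `^ (- (gam * s))) by rewrite !mulr_ge0 ?powR_ge0.
have X30 : 0 <= C3 * (K `^ (- s) * L `^ (- (gam * s))) * (1 + t) `^ (- (beta + 1)).
  by rewrite mulr_ge0// powR_ge0.
have bx := bump_ge0 s lam x.
apply: (le_trans (young3 (in_shell L t) p1 A0 (normr_ge0 (u t x)) (eta_ge0 m (L^-1 * t)) bx X10 X20 X30)).
rewrite -/p' -/Q.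
have -> : A * (weight K L (t, x) * (in_shell L t)%:R) + 2^-1 * weight K L (t, x) =
  (A * (in_shell L t)%:R + 2^-1) * weight K L (t, x) by ring.
rewrite lerD2l; apply: ler_wpM2r => //.
rewrite /theta /c /d -!addrA lerD2l lerD2l -[leRHS]mulrA; apply: ler_wpM2l => //.
rewrite powRM ?powR_ge0//; apply: ler_wpM2l; first exact: powR_ge0.
exact: time_exponent.
Qed.

(** Pointwise Young's inequality for u times [adjoint], integrated over the slab. The
    constants do not depend on the scales [K] and [L] nor on the weight [A]. The power
    of [K] in the first term comes from the mass of the profile; the one in the second
    term is negative because n < s p'. *)
Lemma key_inequality :
  \int[mu2]_(z in slab L) weight K L z
  + \int[mu]_x (u1 x * bump lam x) + b0 * \int[mu]_x (u0 x * flap (bump lam) x) <=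
  A * \int[mu2]_(z in slab L) (weight K L z * (in_shell L z.1)%:R)
  + 2^-1 * \int[mu2]_(z in slab L) weight K L z
  + (shell_bound * A `^ (1 - p') * K `^ n%:R + core_bound * K `^ (n%:R - s * p')).
Proof.
rewrite (tested_identity s0 s2 lam0 p1 L0 mu_u (sol L0) pm).
have iW := integrable_weight_slab; have iS := integrable_weight_shell.
have ith := integrable_time c d L0 delta0.
have mth : measurable_fun setT theta.
  apply: measurable_funD => //; apply: measurable_funM => //.
  by apply: measurable_powR_comp; exact: measurable_funD.
have ib := @integrable_bump R n s s0 lam lam0.
have mb := @measurable_bump R n s lam.
have iT := slab_tensor_integrable mth ith mb ib.
have iWS := integrableD mS (integrableZl mS A iS) (integrableZl mS 2^-1 iW).
apply: (@le_trans _ _ (\int[mu2]_(z in slab L) (A * (weight K L z * (in_shell L z.1)%:R)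
    + 2^-1 * weight K L z + theta z.1 * bump lam z.2))).
  apply: le_Rintegral => //.
  - exact: (integrable_adjoint s0 s2 lam0 p1 mu_u (sol L0) pm).
  - exact: (integrableD mS iWS iT).
  - by move=> [t x] [/=]; rewrite in_itv/= => /andP[t0 tL] _; exact: pointwise.
rewrite RintegralD// RintegralD//; last 2 first.
- exact: (integrableZl mS A iS).
- exact: (integrableZl mS 2^-1 iW).
rewrite RintegralZl// RintegralZl// lerD2l.
rewrite (slab_tensor_integral mth ith mb ib) Rintegral_bump//.
have lamn : lam^-1 ^+ n = K `^ n%:R * L `^ (gam * n%:R).
  rewrite /width invrK exprMn -powR_mulrn ?(ltW K0)// -powR_mulrn ?powR_ge0//.
  by rewrite -powRrM.
rewrite lamn; apply: le_trans (ler_wpM2r _ (integral_time_le c L0 delta0 d0)) _.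
  by rewrite !mulr_ge0 ?powR_ge0.
exact: (scale_bound p1 K1 L1 (ltW A0) C10 C20 C30 Q0 J0 delta0 erefl time_dim).
Qed.

End scaled.
(** ** Contradiction by letting the scales grow *)

Let p0 : 0 < p. Proof. exact: lt_trans p1. Qed.
Let mu0 : measurable_fun setT u0. Proof. by case/integrableP: u0_int => /measurable_EFinP. Qed.
Let mu1 : measurable_fun setT u1. Proof. by case/integrableP: u1_int => /measurable_EFinP. Qed.

Definition power_density (z : RRn) : R := `|u z.1 z.2| `^ p.

Let measurable_power_density : measurable_fun setT power_density.
Proof. by apply: measurable_powR_comp; exact: measurableT_comp. Qed.

Let power_density_ge0 z : 0 <= power_density z. Proof. exact: powR_ge0. Qed.

Lemma weight_outside K L (z : RRn) : 0 < L -> ~ slab L z -> weight K L z = 0.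
Proof.
case: z => t x L0 nz; rewrite /weight /=.
have [t0|t0] := leP t 0; first by rewrite u_past// normr0 powR0 ?gt_eqF// mul0r.
have [tL|tL] := leP L t; first by rewrite time_cutoff_large// mul0r mulr0.
by exfalso; apply: nz; split => //=; rewrite in_itv/= t0 tL.
Qed.

Lemma measurable_weight K L : measurable_fun setT (weight K L).
Proof.
apply: measurable_funM => //; apply: measurable_funM.
  by apply: measurable_temporal; exact: measurable_time_cutoff.
by apply: measurable_spatial; exact: measurable_bump.
Qed.

Lemma Rintegral_slab (f : RRn -> R) L : (forall z, ~ slab L z -> f z = 0) ->
  \int[mu2]_(z in slab L) f z = \int[mu2]_z f z.
Proof.
move=> f0; rewrite [LHS]Rintegral_mkcond; apply: eq_Rintegral => z _.
by rewrite patchE; case: ifPn => // /negP zL; rewrite f0// => H; apply: zL; rewrite inE.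
Qed.

Lemma initial_velocity_le lam : `|\int[mu]_x (u1 x * bump lam x)| <= \int[mu]_x `|u1 x|.
Proof.
have mb := @measurable_bump R n s lam.
have i1 : mu.-integrable setT (EFin \o (fun x => u1 x * bump lam x)).
  apply: (integrable_dom _ (integrable_norm u1_int)); first exact: measurable_funM.
  by move=> x; rewrite normrM ler_piMr// ger0_norm ?bump_ge0 ?bump_le1.
apply: (le_trans (le_normr_Rintegral _ i1)) => //.
apply: le_Rintegral => //.
- exact: integrable_norm i1.
- exact: integrable_norm u1_int.
- by move=> x _; rewrite normrM ler_piMr// ger0_norm ?bump_ge0 ?bump_le1.
Qed.

Lemma initial_position_le lam : 0 < lam ->
  `|\int[mu]_x (u0 x * flap (bump lam) x)| <= CL * lam `^ s * \int[mu]_x `|u0 x|.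
Proof.
move=> lam0; have [mf _] := @dominated_flap_bump R n s lam s0 s2 lam0.
have C0 : 0 <= CL * lam `^ s by rewrite mulr_ge0 ?powR_ge0.
have H x : `|u0 x * flap (bump lam) x| <= CL * lam `^ s * `|u0 x|.
  rewrite normrM mulrC ler_wpM2r// (le_trans (HCL x lam0))//.
  by rewrite ler_piMr// bump_le1.
have i2 := integrableZl measurableT (CL * lam `^ s) (integrable_norm u0_int).
have i1 : mu.-integrable setT (EFin \o (fun x => u0 x * flap (bump lam) x)).
  by apply: (integrable_dom _ i2) => //; exact: measurable_funM.
apply: (le_trans (le_normr_Rintegral _ i1)) => //.
rewrite -RintegralZl//; last exact: integrable_norm u0_int.
by apply: le_Rintegral => //; exact: integrable_norm i1.
Qed.

Let lengths (k : nat) : R := k.+1%:R.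
Let lengths1 k : 1 <= lengths k. Proof. by rewrite ler1n. Qed.
Let lengths0 k : 0 < lengths k. Proof. exact: lt_le_trans (lengths1 k). Qed.

Section widths.
Variable K : R.
Hypothesis K1 : 1 <= K.
Local Notation lam k := (width gam K (lengths k)).

Lemma width_cvg0 : lam k @[k --> \oo] --> 0^'+.
Proof.
have l0 k : 0 < lam k by exact: width_gt0.
have c : lam k @[k --> \oo] --> (0 : R).
  apply: (squeeze_cvgr _ (cvg_cst (0 : R)) (@cvg_harmonic R)).
  apply: nearW => k; rewrite (ltW (l0 k))/= /harmonic /width lef_pV2 ?posrE//; last first.
    by rewrite mulr_gt0 ?powR_gt0// (lt_le_trans _ K1).
  apply: (@le_trans _ _ (lengths k `^ gam)); last by rewrite ler_peMl ?powR_ge0.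
  rewrite -[leLHS](powRr1 (ltW (lengths0 k))); exact: (ler_powR (lengths1 k) gam1).
move=> A /c; rewrite !nbhs_simpl /= => H.
by apply: filterS H => k; apply.
Qed.

Lemma width_powR_cvg0 : lam k `^ s @[k --> \oo] --> (0 : R).
Proof. exact: (cvg_comp _ _ width_cvg0 (powR_cvg0 s0)). Qed.

Lemma bump_cvg1 x : bump (lam k) x @[k --> \oo] --> (1 : R).
Proof.
have c1 : 1 + lam k ^+ 2 * sqn x @[k --> \oo] --> (1 : R).
  rewrite -[X in _ --> X]addr0; apply: cvgD; first exact: cvg_cst.
  rewrite -(mul0r (sqn x)); apply: cvgMl.
  have c0 : lam k @[k --> \oo] --> (0 : R).
    by move=> A A0; apply: width_cvg0; apply: filterS A0 => y Ay _.
  by rewrite -(mulr0 (0 : R)); exact: (cvgM c0 c0).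
have c2 : {for (1 : R), continuous (fun y : R => y `^ (- @rexp R n s))}.
  apply: differentiable_continuous; apply/derivable1_diffP.
  by have [] := is_derive1_powR (- @rexp R n s) (@ltr01 R).
have := cvg_comp _ _ c1 c2; rewrite one_powR.
rewrite (_ : _ \o _ = fun k => bump (lam k) x)//.
by apply/funext => k /=; rewrite bumpE.
Qed.

Lemma initial_velocity_cvg :
  \int[mu]_x (u1 x * bump (lam k) x) @[k --> \oo] --> \int[mu]_x u1 x.
Proof.
have [||||//] := @Rintegral_cvg_dominated _ _ _ mu (fun k x => u1 x * bump (lam k) x) u1
  (fun x => `|u1 x|).
- by move=> k; apply: measurable_funM => //; exact: measurable_bump.
- move=> x; rewrite -[X in _ --> X]mulr1; apply: cvgMr; exact: bump_cvg1.
- exact: integrable_norm u1_int.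
- by move=> k x; rewrite normrM ler_piMr// ger0_norm ?bump_ge0 ?bump_le1.
Qed.

Lemma time_cutoff_cvg1 (t : R) : time_cutoff (lengths k) m t @[k --> \oo] --> (1 : R).
Proof.
apply: cvg_near_cst; near=> k.
have h : (lengths k)^-1 * t <= 2^-1.
  have h : 2 * t <= k%:R by near: k; exact: nbhs_infty_ger.
  have hk : k.+1%:R = k%:R + 1 :> R by rewrite natr1.
  by rewrite mulrC ler_pdivrMr// /lengths hk; lra.
by have [E _ _] := eta_small m h; exact: E.
Unshelve. all: by end_near. Qed.

Lemma weight_cvg z : weight K (lengths k) z @[k --> \oo] --> power_density z.
Proof.
rewrite -[X in _ --> X]mulr1; apply: cvgMr.
rewrite -(mulr1 (1 : R)); apply: cvgM; [exact: time_cutoff_cvg1|exact: bump_cvg1].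
Qed.

Lemma weight_le k z : weight K (lengths k) z <= power_density z.
Proof.
by rewrite ler_piMr// -[leRHS]mulr1 ler_pM ?eta_ge0 ?bump_ge0 ?eta_le1 ?bump_le1.
Qed.

(** The shells escape to infinity, and the density is integrable. *)
Lemma shell_cvg0 : mu2.-integrable setT (EFin \o power_density) ->
  \int[mu2]_z (weight K (lengths k) z * (in_shell (lengths k) z.1)%:R) @[k --> \oo] --> (0 : R).
Proof.
move=> ig.
have [||||H _] := @Rintegral_cvg_dominated _ _ _ mu2
  (fun k (z : RRn) => weight K (lengths k) z * (in_shell (lengths k) z.1)%:R) (fun=> 0)
  power_density; last by move: H; rewrite Rintegral_cst// mul0r.
- by move=> k; apply: measurable_funM; [exact: measurable_weight|exact: measurable_in_shell].
- move=> z; apply: cvg_near_cst; near=> k.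
  have h : 2 * z.1 <= k%:R by near: k; exact: nbhs_infty_ger.
  have hk : k.+1%:R = k%:R + 1 :> R by rewrite natr1.
  have -> : in_shell (lengths k) z.1 = false.
    by apply/negbTE; rewrite -leNgt ler_pdivlMr// /lengths hk; lra.
  by rewrite mulr0.
- exact: ig.
- move=> k z; rewrite normrM ger0_norm ?weight_ge0//.
  rewrite (le_trans _ (weight_le k z))// ler_piMr ?weight_ge0//.
  by case: (in_shell _ _); rewrite ?normr0 ?normr1.
Unshelve. all: by end_near. Qed.

End widths.

Lemma key_inequality_setT K k A : 1 <= K -> 0 < A ->
  \int[mu2]_z weight K (lengths k) z
  + \int[mu]_x (u1 x * bump (width gam K (lengths k)) x)
  + b0 * \int[mu]_x (u0 x * flap (bump (width gam K (lengths k))) x) <=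
  A * \int[mu2]_z (weight K (lengths k) z * (in_shell (lengths k) z.1)%:R)
  + 2^-1 * \int[mu2]_z weight K (lengths k) z
  + (shell_bound * A `^ (1 - p / (p - 1)) * K `^ n%:R + core_bound * K `^ (n%:R - s * (p / (p - 1)))).
Proof.
move=> K1 A0.
have H := key_inequality K1 (lengths1 k) A0.
rewrite -(@Rintegral_slab (weight K (lengths k)) (lengths k)); last first.
  by move=> z; exact: weight_outside.
rewrite -(@Rintegral_slab (fun z => weight K (lengths k) z * (in_shell (lengths k) z.1)%:R)
  (lengths k)); last by move=> z zL; rewrite weight_outside// mul0r.
exact: H.
Qed.

Lemma integrable_weight_setT K k : 1 <= K ->
  mu2.-integrable setT (EFin \o weight K (lengths k)).
Proof.
move=> K1.
have := integrable_weight_slab K1 (lengths1 k).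
move=> /(integrable_mkcond _ (@measurable_slab R n (lengths k))).1.
apply: eq_integrable => // z _; rewrite restrict_EFin /= patchE.
by case: ifPn => // /negP zL; rewrite weight_outside// => H; apply: zL; rewrite inE.
Qed.

(** For K = 1 and A = 1/4, the key inequality bounds the integral of the weight by
    three quarters of itself plus a constant. *)
Lemma weight_bounded : exists M, forall k, \int[mu2]_z weight 1 (lengths k) z <= M.
Proof.
exists (4 * (shell_bound * 4^-1 `^ (1 - p / (p - 1)) + core_bound + \int[mu]_x `|u1 x|
  + `|b0| * (CL * \int[mu]_x `|u0 x|))) => k.
have A0 : 0 < 4^-1 :> R by rewrite invr_gt0.
have := key_inequality_setT k (lexx 1) A0; rewrite !one_powR !mulr1.
set lam := width gam 1 (lengths k).
have lam0 : 0 < lam by exact: width_gt0.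
have iW := integrable_weight_setT k (lexx 1).
have Sh : \int[mu2]_z (weight 1 (lengths k) z * (in_shell (lengths k) z.1)%:R) <=
    \int[mu2]_z weight 1 (lengths k) z.
  have w0 z : `|weight 1 (lengths k) z * (in_shell (lengths k) z.1)%:R| <= weight 1 (lengths k) z.
    rewrite normrM ger0_norm ?weight_ge0// ler_piMr ?weight_ge0//.
    by case: (in_shell _ _); rewrite ?normr0 ?normr1.
  apply: le_Rintegral => //.
    apply: (integrable_dom _ iW w0).
    by apply: measurable_funM; [exact: measurable_weight|exact: measurable_in_shell].
  by move=> z _; exact: le_trans (ler_norm _) (w0 z).
have U := initial_velocity_le lam; have F := initial_position_le lam0.
have l1 : lam `^ s <= 1.
  rewrite width_powR// one_powR mul1r -(powRr0 (lengths k)); apply: (ler_powR (lengths1 k)).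
  by rewrite oppr_le0 mulr_ge0 ?(ltW s0)// (le_trans _ gam1).
have F' : `|b0 * \int[mu]_x (u0 x * flap (bump lam) x)| <= `|b0| * (CL * \int[mu]_x `|u0 x|).
  rewrite normrM ler_wpM2l// (le_trans F)// ler_wpM2r ?ler_piMr//.
  by apply: Rintegral_ge0 => x _.
move: U F'; rewrite !ler_norml => /andP[U _] /andP[F' _].
move: (\int[mu2]_z weight _ _ z) (\int[mu2]_z (weight _ _ z * _)) Sh
  (\int[mu]_x (u1 x * _)) U (b0 * _) F' => I S Sh V U W F'.
lra.
Qed.

(** By Fatou's lemma, since the weights tend to the density. *)
Lemma integrable_power_density : mu2.-integrable setT (EFin \o power_density).
Proof.
apply: integrable_lty_ge0 => //.
have [M HM] := weight_bounded.
have mW k : measurable_fun setT (EFin \o weight 1 (lengths k)).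
  by apply/measurable_EFinP; exact: measurable_weight.
have W0 k (z : RRn) : setT z -> (0 <= (EFin \o weight 1 (lengths k)) z)%E.
  by move=> _; rewrite lee_fin weight_ge0.
have := fatou mu2 measurableT mW W0.
have -> : (fun z => limn_einf (fun k => (EFin \o weight 1 (lengths k)) z)) = EFin \o power_density.
  apply/funext => z; apply: (cvg_limn_einf_sup _).1; apply: cvg_EFin; first exact: nearW.
  exact: (weight_cvg (lexx 1)).
move=> /le_lt_trans; apply; apply: (@le_lt_trans _ _ M%:E); last exact: ltry.
(* The lower limit of a sequence bounded by [M] is at most [M]. *)
rewrite limn_einf_lim; apply: lime_le; first exact: is_cvg_einfs.
apply: nearW => k.
apply: (@le_trans _ _ (\int[mu2]_z (EFin \o weight 1 (lengths k)) z)%E).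
  by apply: ereal_inf_lbound; exists k => //=.
by rewrite (RintegralE (integrable_weight_setT k (lexx 1))) lee_fin.
Qed.

(** The limit L -> +oo of the key inequality: the shell term and the contribution of
    the initial position vanish, and the integral of the weight may be dropped,
    since its coefficient is larger on the left. *)
Lemma initial_velocity_bound K A : 1 <= K -> 0 < A ->
  \int[mu]_x u1 x <= shell_bound * A `^ (1 - p / (p - 1)) * K `^ n%:R
    + core_bound * K `^ (n%:R - s * (p / (p - 1))).
Proof.
move=> K1 A0; set B := _ + _.
pose Z := \int[mu]_x `|u0 x|.
have cR : A * \int[mu2]_z (weight K (lengths k) z * (in_shell (lengths k) z.1)%:R) + B
    + `|b0| * (CL * width gam K (lengths k) `^ s * Z) @[k --> \oo] --> B.
  have c1 := shell_cvg0 K integrable_power_density.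
  have c2 := width_powR_cvg0 K1.
  rewrite [X in _ --> X](_ : B = A * 0 + B + `|b0| * (CL * 0 * Z)); last by ring.
  apply: cvgD; last by apply: cvgMr; apply: cvgMl; apply: cvgMr; exact: c2.
  by apply: cvgD; [apply: cvgMr; exact: c1|exact: cvg_cst].
apply: (ler_cvg_to (initial_velocity_cvg K1) cR); apply: nearW => k.
have := key_inequality_setT k K1 A0; rewrite -/B.
have F := initial_position_le (width_gt0 gam K1 (lengths1 k)).
have F' : `|b0 * \int[mu]_x (u0 x * flap (bump (width gam K (lengths k))) x)| <=
    `|b0| * (CL * width gam K (lengths k) `^ s * Z).
  by rewrite normrM ler_wpM2l.
have I0 : 0 <= \int[mu2]_z weight K (lengths k) z.
  by apply: Rintegral_ge0 => z _; exact: weight_ge0.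
move: F'; rewrite ler_norml => /andP[F' _].
move: (\int[mu2]_z weight _ _ z) I0 (A * _) (\int[mu]_x (u1 x * _)) (b0 * _) (`|b0| * _) F'.
by move=> I I0 V U W X F'; lra.
Qed.

(** First [K] is chosen to make the second term of the bound small, then [A], depending
    on [K], for the first one. *)
Lemma no_positive_velocity : 0 < \int[mu]_x u1 x -> False.
Proof.
move=> U0; set U := \int[mu]_x u1 x in U0.
have U2 : 0 < U / 2 by rewrite divr_gt0.
have q1 : 0 < s * (p / (p - 1)) - n%:R by rewrite subr_gt0.
have q2 : 0 < p / (p - 1) - 1.
  rewrite subr_gt0 ltr_pdivlMr ?subr_gt0// mul1r; have := p1; lra.
have [K K1 HK] := powR_small core_bound_ge0 q1 U2.
have B10 : 0 <= shell_bound * K `^ n%:R by rewrite mulr_ge0 ?powR_ge0// shell_bound_ge0.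
have [A A1 HA] := powR_small B10 q2 U2.
have A0 : 0 < A by exact: lt_le_trans A1.
have := initial_velocity_bound K1 A0; rewrite -/U.
move: HK HA; rewrite !opprB mulrAC => HK HA.
by move: HK HA; lra.
Qed.

End test_function_method.

(** * From the conditions on p to the scaling exponent *)

Section exponents.
Context {R : realType}.

(** Clears the denominator in all cases, including a quotient read as infinite. *)
Lemma lt_quot_oo (p a d : R) : 0 < p -> 0 < a ->
  (p%:E < quot_oo a (Num.max 0%R d))%E -> p * d < a.
Proof.
move=> p0 a0; rewrite /quot_oo.
have [d0|d0] := leP d 0; first by move=> _; apply: le_lt_trans a0; rewrite pmulr_rle0.
by rewrite gt_eqF// lte_fin ltr_pdivlMr.
Qed.

(** The exponent is 1 if 1 - beta <= s and (1 - beta) / s otherwise. In terms of p, the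
    third condition reads p (n gam - 1) <= n gam + 1, which is the first bound on p in
    the hypothesis, equality included; the last one reads p (n - s) < n. In the
    critical cases p' is (n + 1) / 2 and (n (1 - beta) + s) / (2 s), respectively, and
    the last condition becomes the extra assumption on [s]. *)
Lemma scaling_exponent (n : nat) (s beta p : R) :
  (1 <= n)%N -> 0 < s -> 1 < p -> subcritical n s beta p \/ critical n s beta p ->
  exists gam, [/\ 1 <= gam, 1 - beta <= s * gam,
    n%:R * gam + 1 <= 2 * (p / (p - 1)) & n%:R < s * (p / (p - 1))].
Proof.
move=> n1 s0 p1; have p0 : 0 < p by exact: lt_trans p1.
have q0 : 0 < p - 1 by rewrite subr_gt0.
have N1 : 1 <= n%:R :> R by rewrite ler1n.
have time_dim g : p * (n%:R * g - 1) <= n%:R * g + 1 -> n%:R * g + 1 <= 2 * (p / (p - 1)).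
  by move=> h; rewrite mulrA ler_pdivlMr//; lra.
have space_dim : p * (n%:R - s) < n%:R -> n%:R < s * (p / (p - 1)).
  by move=> h; rewrite mulrA ltr_pdivlMr//; lra.
have gamma2 : s <= 1 - beta -> p * (n%:R * (1 - beta) - s) <= n%:R * (1 - beta) + s ->
    p * (n%:R - s) < n%:R -> exists gam, [/\ 1 <= gam, 1 - beta <= s * gam,
    n%:R * gam + 1 <= 2 * (p / (p - 1)) & n%:R < s * (p / (p - 1))].
  move=> h1 h2 h3; exists ((1 - beta) / s); split.
  - by rewrite ler_pdivlMr// mul1r.
  - by rewrite mulrC divfK// gt_eqF.
  - apply: time_dim; rewrite -(ler_pM2r s0).
    have -> : p * (n%:R * ((1 - beta) / s) - 1) * s = p * (n%:R * (1 - beta) - s).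
      by field; rewrite gt_eqF.
    by have -> : (n%:R * ((1 - beta) / s) + 1) * s = n%:R * (1 - beta) + s by field; rewrite gt_eqF.
  - exact: space_dim.
have gamma1 : 1 - beta <= s -> p * (n%:R - 1) <= n%:R + 1 ->
    p * (n%:R - s) < n%:R -> exists gam, [/\ 1 <= gam, 1 - beta <= s * gam,
    n%:R * gam + 1 <= 2 * (p / (p - 1)) & n%:R < s * (p / (p - 1))].
  move=> h1 h2 h3; exists 1; split => //; first by rewrite mulr1.
    by apply: time_dim; rewrite mulr1.
  exact: space_dim.
move=> [[[h1]|[h1]]|[[pE h1 h2 n2]|[D0 pE h2 h1]]].
- rewrite lt_min => /andP[/lt_quot_oo A /lt_quot_oo B]; apply: gamma1 => //.
    by apply: ltW; apply: A => //; lra.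
  by apply: B => //; lra.
- rewrite lt_min => /andP[/lt_quot_oo A /lt_quot_oo B]; apply: gamma2 => //.
    by apply: ltW; apply: A => //; nra.
  by apply: B => //; lra.
- have N2 : 0 < n%:R - 1 :> R by rewrite subr_gt0 ltr1n.
  have E : p * (n%:R - 1) = n%:R + 1 by rewrite pE divfK// gt_eqF.
  apply: gamma1 => //; first by rewrite E.
  rewrite ltr_pdivrMr in h2; last by lra.
  rewrite -(ltr_pM2r N2).
  have -> : p * (n%:R - s) * (n%:R - 1) = (n%:R + 1) * (n%:R - s) by rewrite -E; ring.
  by nra.
- have E : p * (n%:R * (1 - beta) - s) = n%:R * (1 - beta) + s by rewrite pE divfK.
  have Dp : 0 < n%:R * (1 - beta) - s.
    by rewrite -(pmulr_rgt0 _ q0) mulrBl E mul1r; lra.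
  apply: gamma2 => //; first by rewrite E.
  rewrite -(ltr_pM2r Dp).
  have -> : p * (n%:R - s) * (n%:R * (1 - beta) - s) = (n%:R * (1 - beta) + s) * (n%:R - s).
    by rewrite -E; ring.
  by nra.
Qed.

End exponents.

Theorem theorem1 (R : realType) (n : nat) (sigma beta p b0 : R)
    (u0 u1 : 'rV[R]_n -> R)
    (n_ge1 : (1 <= n)%N) (sigma_gt0 : 0 < sigma) (sigma_lt2 : sigma < 2)
    (p_gt1 : 1 < p) (b0_gt0 : 0 < b0)
    (u0_L1 : u0 \in Lfun (lebesgue_row R n) 1%:E)
    (u0_H1 : sobolev 1 u0)
    (u1_L1 : u1 \in Lfun (lebesgue_row R n) 1%:E)
    (u1_L2 : u1 \in Lfun (lebesgue_row R n) 2%:E)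
    (u1_pos : 0 < \int[lebesgue_row R n]_x u1 x)
    (exponent : subcritical n sigma beta p \/ critical n sigma beta p) :
  ~ exists u : R -> 'rV[R]_n -> R,
      global_weak_solution sigma beta p b0 u0 u1 u.
Proof.
move=> [v sol_v].
have [gam [gam1 damping time_dim space_dim]] :=
  scaling_exponent n_ge1 sigma_gt0 p_gt1 exponent.
have [CL [CL0 HCL]] := @flap_bump_le R n sigma sigma_gt0 sigma_lt2.
have [m pm] : exists m : nat, 2 * p / (p - 1) <= m.+4%:R.
  (* Any cut-off exponent that is large enough will do. *)
  exists (Num.truncn (2 * p / (p - 1))).
  by rewrite (le_trans (ltW (Num.Theory.truncnS_gt _)))// ler_nat ltnS -addn3 leq_addr.
have sol := global_weak_solution_positive_times sol_v.
have mu_u : measurable_fun setT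
    (fun z : (measurableTypeR R * 'rV[R]_n)%type => positive_times v z.1 z.2).
  by apply: measurable_positive_times => T T0; have [[]] := sol_v T T0.
have past t x : t <= 0 -> positive_times v t x = 0.
  by move=> t0; rewrite /positive_times ltNge t0.
have u0_int := (Lfun1_integrable _ _).1 u0_L1.
have u1_int := (Lfun1_integrable _ _).1 u1_L1.
exact: (no_positive_velocity sigma_gt0 sigma_lt2 gam1 p_gt1 damping time_dim space_dim
  pm CL0 HCL mu_u past sol u0_int u1_int u1_pos).
Qed.
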